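(* As $\mathrm{Im}\,\tau\to+\infty$, the connection $$\nabla_{\mathrm{KZB},\tau}=d-\sum_{\alpha\in\Phi^+}k\big(\alpha,\mathrm{ad}(\tfrac{x(\alpha^\vee)}2)\big|\tau\big)(t_\alpha)\,d\alpha+\sum_{i=1}^ny(u^i)\,du_i$$ degenerates to the following connection on $H_{\mathrm{reg}}$: $$\nabla^{\deg}=d-\sum_{\alpha\in\Phi^+}\frac{2\pi i\,t_\alpha}{e^{2\pi i\alpha}-1}\,d\alpha+\sum_{i=1}^n\left(y(u^i)-\sum_{\alpha\in\Phi^+}\alpha(u^i)\left(\frac{2\pi i\,e^{2\pi i\,\mathrm{ad}(x(\alpha^\vee)/2)}}{e^{2\pi i\,\mathrm{ad}(x(\alpha^\vee)/2)}-1}-\frac1{\mathrm{ad}(x(\alpha^\vee)/2)}\right)t_\alpha\right)du_i .$$ This degeneration gives rise to a Lie algebra map $\mathfrak t_{\mathrm{trig}}^\Phi\to\widehat{\mathfrak t_{\mathrm{ell}}^\Phi}$ given by $$t_\alpha\mapsto t_\alpha,\qquad X(u)\mapsto-y(u)+\sum_{\alpha\in\Phi^+}\alpha(u)\left(\frac{2\pi i\,e^{2\pi i\,\mathrm{ad}(x(\alpha^\vee)/2)}}{e^{2\pi i\,\mathrm{ad}(x(\alpha^\vee)/2)}-1}-\frac1{\mathrm{ad}(x(\alpha^\vee)/2)}\right)t_\alpha .$$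
   Context: $E$ is a Euclidean vector space, $\Phi\subset E^*$ a finite reduced crystallographic root system with Weyl group $W$, $\Phi^+$ a system of positive roots, $\Phi^-=-\Phi^+$, $\alpha^\vee$ the coroot of $\alpha$, $\mathfrak h=E\otimes_{\mathbb R}\mathbb C$, $P^\vee\subset E$ the coweight lattice (dual of the root lattice), $n=\dim\mathfrak h$, $\{u_i\},\{u^i\}$ dual bases of $\mathfrak h^*,\mathfrak h$. $H=\mathfrak h/P^\vee$ and $H_{\mathrm{reg}}=H\setminus\bigcup_{\alpha\in\Phi}\{e^{2\pi i\alpha}=1\}$. A root subsystem is a subset $\Psi\subset\Phi$ with $\mathbb Z\Psi\cap\Phi=\Psi$; $\Psi^+=\Psi\cap\Phi^+$. $\mathfrak t_{\mathrm{ell}}^\Phi$ is the Lie algebra generated by $t_\alpha$ ($\alpha\in\Phi$, $t_{-\alpha}=t_\alpha$) and linear maps $x,y:\mathfrak h\to\mathfrak t_{\mathrm{ell}}^\Phi$, with relations: $[t_\alpha,\sum_{\beta\in\Psi^+}t_\beta]=0$ for every rank 2 root subsystem $\Psi$ and $\alpha\in\Psi$; $[x(u),x(v)]=0=[y(u),y(v)]$; $[y(u),x(v)]=\sum_{\gamma\in\Phi^+}\langle v,\gamma\rangle\langle u,\gamma\rangle t_\gamma$; $[t_\alpha,x(u)]=0=[t_\alpha,y(u)]$ if $\alpha(u)=0$. $\widehat{\mathfrak t_{\mathrm{ell}}^\Phi}$ is its completion for the grading $\deg x(u)=\deg y(u)=1$, $\deg t_\alpha=2$. $\mathfrak t_{\mathrm{trig}}^\Phi$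 is the Lie algebra generated by $t_\alpha$ ($\alpha\in\Phi$, $t_{-\alpha}=t_\alpha$) and a linear map $X:\mathfrak h\to\mathfrak t_{\mathrm{trig}}^\Phi$ with relations (i) $[t_\alpha,\sum_{\beta\in\Psi^+}t_\beta]=0$ for every rank 2 root subsystem $\Psi$ and $\alpha\in\Psi$; (ii) $[X(u),X(v)]=0$; (iii) for $\alpha\in\Phi^+$, $w\in W$ such that $w^{-1}\alpha$ is simple, and $u\in\mathfrak h$ with $\alpha(u)=0$, $[t_\alpha,X_w(u)]=0$ where $X_w(u)=X(u)-2\pi i\sum_{\beta\in\Phi^+\cap w\Phi^-}\beta(u)t_\beta$. It is the universal Lie algebra for which the connection $d-\sum_{\alpha\in\Phi^+}\frac{2\pi i\,d\alpha}{e^{2\pi i\alpha}-1}t_\alpha-\sum_idu_i\,X(u^i)$ on $H_{\mathrm{reg}}$ is flat. For $\tau$ in the upper half plane, $\theta(z|\tau)$ is holomorphic in $z$ with zero set $\Lambda_\tau=\mathbb Z+\tau\mathbb Z$, $\partial_z\theta(0|\tau)=1$, $\theta(z+1|\tau)=-\theta(z|\tau)=\theta(-z|\tau)$, $\theta(z+\tau|\tau)=-e^{-\pi i\tau}e^{-2\pi iz}\theta(z|\tau)$; $k(z,x|\tau)=\frac{\theta(z+x|\tau)}{\theta(z|\tau)\theta(x|\tau)}-\frac1x$. Both $k(z,x|\tau)$ and $\frac{2\pi ie^{2\pi ix}}{e^{2\pi ix}-1}-\frac1x$ are regarded as power series in $x$, into which $\mathrm{ad}(x(\alpha^\vee)/2)$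 is substituted. ''Degenerates'' means that the coefficients of the connection form converge (in each degree of $\widehat{\mathfrak t_{\mathrm{ell}}^\Phi}$, at points of $\mathfrak h$ with $e^{2\pi i\alpha}\ne1$ for all $\alpha$) to those of the limit connection. *)

(* Defs.v *)
From HB Require Import structures.
From mathcomp Require Import all_boot all_order all_algebra finmap complex.
From mathcomp Require Import all_classical all_reals all_analysis.
From mathcomp Require Import ring.

Set Implicit Arguments.
Unset Strict Implicit.
Unset Printing Implicit Defensive.

Import Order.TTheory GRing.Theory Num.Theory.
Import numFieldNormedType.Exports.
Local Open Scope classical_set_scope.
Local Open Scope ring_scope.

HB.mixin Record isLieAlgebra (K : comNzRingType) L & GRing.Lmodule K L := {
  lie : L -> L -> L;
  lie_linearl : forall (c : K) (x y z : L),
    lie (c *: x + y) z = c *: lie x z + lie y z;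
  lie_linearr : forall (c : K) (x y z : L),
    lie z (c *: x + y) = c *: lie z x + lie z y;
  lie_alt : forall x : L, lie x x = 0;
  lie_jacobi : forall x y z : L,
    lie x (lie y z) + lie y (lie z x) + lie z (lie x y) = 0
}.

#[short(type="lieAlgType")]
HB.structure Definition LieAlgebra (K : comNzRingType) :=
  {L of GRing.Lmodule K L & isLieAlgebra K L}.

Definition lie_morphism (K : comNzRingType) (L M : lieAlgType K) (f : L -> M) :=
  (forall (c : K) (x y : L), f (c *: x + y) = c *: f x + f y) /\
  (forall x y : L, f (lie x y) = lie (f x) (f y)).

Section LieTheory.
Variables (K : comNzRingType) (L : lieAlgType K).
Implicit Types x y z : L.

Lemma lieDl x y z : lie (x + y) z = lie x z + lie y z.
Proof. by have := lie_linearl 1 x y z; rewrite !scale1r. Qed.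

Lemma lieDr x y z : lie z (x + y) = lie z x + lie z y.
Proof. by have := lie_linearr 1 x y z; rewrite !scale1r. Qed.

Lemma lie0l z : lie 0 z = 0.
Proof. by apply: (addIr (lie 0 z)); rewrite -lieDl !add0r. Qed.

Lemma lie0r z : lie z 0 = 0.
Proof. by apply: (addIr (lie z 0)); rewrite -lieDr !add0r. Qed.

Lemma lieZl c x z : lie (c *: x) z = c *: lie x z.
Proof. by have := lie_linearl c x 0 z; rewrite lie0l !addr0. Qed.

Lemma lieZr c x z : lie z (c *: x) = c *: lie z x.
Proof. by have := lie_linearr c x 0 z; rewrite lie0r !addr0. Qed.

Lemma lieNl x z : lie (- x) z = - lie x z.
Proof. by rewrite -scaleN1r lieZl scaleN1r. Qed.

Lemma lieNr x z : lie z (- x) = - lie z x.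
Proof. by rewrite -scaleN1r lieZr scaleN1r. Qed.

Lemma lieC x y : lie x y = - lie y x.
Proof.
apply/eqP; rewrite -addr_eq0; apply/eqP.
by have := lie_alt (x + y); rewrite lieDl !lieDr !lie_alt add0r addr0.
Qed.

Lemma lie_suml (I : Type) (r : seq I) (P : pred I) (F : I -> L) z :
  lie (\sum_(i <- r | P i) F i) z = \sum_(i <- r | P i) lie (F i) z.
Proof.
by apply: (big_morph (fun x => lie x z)) => [x y|]; rewrite ?lieDl ?lie0l.
Qed.

Lemma lie_sumr (I : Type) (r : seq I) (P : pred I) (F : I -> L) z :
  lie z (\sum_(i <- r | P i) F i) = \sum_(i <- r | P i) lie z (F i).
Proof.
by apply: (big_morph (fun x => lie z x)) => [x y|]; rewrite ?lieDr ?lie0r.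
Qed.

End LieTheory.

Inductive lie_word (K G : Type) : Type :=
| WGen of G
| WZero
| WAdd of lie_word K G & lie_word K G
| WScale of K & lie_word K G
| WLie of lie_word K G & lie_word K G.
Arguments WZero {K G}.
Arguments WGen {K G}.

HB.instance Definition _ (K G : Type) := gen_eqMixin (lie_word K G).
HB.instance Definition _ (K G : Type) := gen_choiceMixin (lie_word K G).

Section FreeLie.
Variables (K : comNzRingType) (G : Type).
Implicit Types (s t u : lie_word K G) (a b : K).

Inductive word_eq : lie_word K G -> lie_word K G -> Prop :=
| word_refl s : word_eq s s
| word_sym s t : word_eq s t -> word_eq t s
| word_trans t s u : word_eq s t -> word_eq t u -> word_eq s u
| word_congD s s' t t' :
    word_eq s s' -> word_eq t t' -> word_eq (WAdd s t) (WAdd s' t')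
| word_congZ a s s' : word_eq s s' -> word_eq (WScale a s) (WScale a s')
| word_congL s s' t t' :
    word_eq s s' -> word_eq t t' -> word_eq (WLie s t) (WLie s' t')
| word_addA s t u : word_eq (WAdd s (WAdd t u)) (WAdd (WAdd s t) u)
| word_addC s t : word_eq (WAdd s t) (WAdd t s)
| word_add0 s : word_eq (WAdd WZero s) s
| word_addN s : word_eq (WAdd (WScale (-1) s) s) WZero
| word_scaleA a b s : word_eq (WScale a (WScale b s)) (WScale (a * b) s)
| word_scale1 s : word_eq (WScale 1 s) s
| word_scaleDr a s t :
    word_eq (WScale a (WAdd s t)) (WAdd (WScale a s) (WScale a t))
| word_scaleDl s a b :
    word_eq (WScale (a + b) s) (WAdd (WScale a s) (WScale b s))
| word_lie_linearl a s t u :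
    word_eq (WLie (WAdd (WScale a s) t) u)
            (WAdd (WScale a (WLie s u)) (WLie t u))
| word_lie_linearr a s t u :
    word_eq (WLie u (WAdd (WScale a s) t))
            (WAdd (WScale a (WLie u s)) (WLie u t))
| word_lie_alt s : word_eq (WLie s s) WZero
| word_lie_jacobi s t u :
    word_eq (WAdd (WAdd (WLie s (WLie t u)) (WLie t (WLie u s)))
                  (WLie u (WLie s t))) WZero.

Definition word_eqb s t := `[< word_eq s t >].

Let word_eqb_refl : reflexive word_eqb.
Proof. by move=> s; apply/asboolP; exact: word_refl. Qed.

Let word_eqb_sym : symmetric word_eqb.
Proof. by move=> s t; apply/asboolP/asboolP; exact: word_sym. Qed.

Let word_eqb_trans : transitive word_eqb.
Proof.
move=> t s u /asboolP st /asboolP tu; apply/asboolP; exact: word_trans st tu.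
Qed.

Canonical word_equiv :=
  EquivRel word_eqb word_eqb_refl word_eqb_sym word_eqb_trans.

Local Open Scope quotient_scope.

Definition free_lie := {eq_quot word_equiv}.
HB.instance Definition _ := Choice.on free_lie.
HB.instance Definition _ := EqQuotient.on free_lie.

Definition free_gen (g : G) : free_lie := \pi_free_lie (WGen g).

Definition free_zero : free_lie := \pi_free_lie WZero.
Definition free_add := lift_op2 free_lie (@WAdd K G).
Definition free_scale (a : K) := lift_op1 free_lie (WScale a).
Definition free_br := lift_op2 free_lie (@WLie K G).

Let piP s t : word_eq s t -> \pi_free_lie s = \pi_free_lie t.
Proof. by move=> st; apply/eqquotP/asboolP. Qed.

Let reprP s : word_eq (repr (\pi_free_lie s)) s.
Proof. by apply/asboolP; apply/(@eqquotP _ word_eqb free_lie); rewrite reprK. Qed.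

Let addE s t :
  free_add (\pi_free_lie s) (\pi_free_lie t) = \pi_free_lie (WAdd s t).
Proof. by unlock free_add free_scale free_br; apply: piP; apply: word_congD; exact: reprP. Qed.

Let scaleE a s : free_scale a (\pi_free_lie s) = \pi_free_lie (WScale a s).
Proof. by unlock free_add free_scale free_br; apply: piP; apply: word_congZ; exact: reprP. Qed.

Let brE s t : free_br (\pi_free_lie s) (\pi_free_lie t) = \pi_free_lie (WLie s t).
Proof. by unlock free_add free_scale free_br; apply: piP; apply: word_congL; exact: reprP. Qed.

Let addA : associative free_add.
Proof.
elim/quotW=> s; elim/quotW=> t; elim/quotW=> u.
by rewrite !addE; exact/piP/word_addA.
Qed.
Let addC : commutative free_add.
Proof. by elim/quotW=> s; elim/quotW=> t; rewrite !addE; exact/piP/word_addC. Qed.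
Let add0 : left_id free_zero free_add.
Proof. by elim/quotW=> s; rewrite addE; exact/piP/word_add0. Qed.
Let addN : left_inverse free_zero (free_scale (-1)) free_add.
Proof. by elim/quotW=> s; rewrite scaleE addE; exact/piP/word_addN. Qed.

HB.instance Definition _ := GRing.isZmodule.Build free_lie addA addC add0 addN.

Let scaleA a b x : free_scale a (free_scale b x) = free_scale (a * b) x.
Proof. by elim/quotW: x => s; rewrite !scaleE; exact/piP/word_scaleA. Qed.
Let scale1 : left_id 1 free_scale.
Proof. by elim/quotW=> s; rewrite scaleE; exact/piP/word_scale1. Qed.
Let scaleDr : right_distributive free_scale +%R.
Proof. by move=> a; elim/quotW=> s; elim/quotW=> t;
  rewrite /GRing.add /= ?(addE, scaleE); exact/piP/word_scaleDr. Qed.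
Let scaleDl x : {morph free_scale^~ x : a b / a + b}.
Proof. by move=> a b; elim/quotW: x => s;
  rewrite [RHS]/GRing.add /= !scaleE addE; exact/piP/word_scaleDl. Qed.

HB.instance Definition _ := GRing.Zmodule_isLmodule.Build K free_lie
  scaleA scale1 scaleDr scaleDl.

Let br_linearl a x y z : free_br (a *: x + y) z = a *: free_br x z + free_br y z.
Proof.
elim/quotW: x => s; elim/quotW: y => t; elim/quotW: z => u.
rewrite /GRing.add /GRing.scale /= !(scaleE, addE, brE).
exact/piP/word_lie_linearl.
Qed.
Let br_linearr a x y z : free_br z (a *: x + y) = a *: free_br z x + free_br z y.
Proof.
elim/quotW: x => s; elim/quotW: y => t; elim/quotW: z => u.
rewrite /GRing.add /GRing.scale /= !(scaleE, addE, brE).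
exact/piP/word_lie_linearr.
Qed.
Let br_alt x : free_br x x = 0.
Proof. by elim/quotW: x => s; rewrite brE; exact/piP/word_lie_alt. Qed.
Let br_jacobi x y z : free_br x (free_br y z) + free_br y (free_br z x) +
  free_br z (free_br x y) = 0.
Proof.
elim/quotW: x => s; elim/quotW: y => t; elim/quotW: z => u.
by rewrite /GRing.add /= !(addE, brE); exact/piP/word_lie_jacobi.
Qed.

HB.instance Definition _ := isLieAlgebra.Build K free_lie
  br_linearl br_linearr br_alt br_jacobi.

End FreeLie.

Section LieQuotient.
Variables (K : comNzRingType) (L : lieAlgType K) (S : set L).

Inductive in_lie_ideal : L -> Prop :=
| ideal_rel x : S x -> in_lie_ideal x
| ideal_linear c x y :
    in_lie_ideal x -> in_lie_ideal y -> in_lie_ideal (c *: x + y)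
| ideal0 : in_lie_ideal 0
| ideal_lie x y : in_lie_ideal y -> in_lie_ideal (lie x y).

Definition lie_ideal : {pred L} := fun x => `[< in_lie_ideal x >].

Let lie_ideal_zmod : zmod_closed lie_ideal.
Proof.
split; first by apply/asboolP; exact: ideal0.
move=> x y /asboolP Ix /asboolP Iy; apply/asboolP.
by rewrite addrC -scaleN1r; exact: ideal_linear.
Qed.
HB.instance Definition _ := GRing.isZmodClosed.Build L lie_ideal lie_ideal_zmod.

Local Open Scope quotient_scope.

Definition lie_quot := {ideal_quot lie_ideal}.
HB.instance Definition _ := EqQuotient.on lie_quot.
HB.instance Definition _ := GRing.Zmodule.on lie_quot.

Let piE (x y : L) : in_lie_ideal (x - y) -> \pi_lie_quot x = \pi_lie_quot y.
Proof.
move=> /asboolT Ixy; apply/eqP.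
by have <- := Quotient.idealrBE lie_ideal x y.
Qed.

Let reprP (x : L) : in_lie_ideal (repr (\pi_lie_quot x) - x).
Proof.
apply/asboolP; suff : repr (\pi_lie_quot x) - x \in lie_ideal by [].
by rewrite (Quotient.idealrBE lie_ideal) reprK.
Qed.

Let piD (x y : L) : \pi_lie_quot x + \pi_lie_quot y = \pi_lie_quot (x + y).
Proof. by rewrite [RHS]Quotient.pi_add. Qed.

Let pi0 : \pi_lie_quot 0 = 0.
Proof. by apply: (addIr (\pi_lie_quot 0)); rewrite piD !add0r. Qed.

Let idealZ c x : in_lie_ideal x -> in_lie_ideal (c *: x).
Proof. by move=> Ix; rewrite -[_ *: _]addr0; apply: ideal_linear Ix ideal0. Qed.

Let idealD x y : in_lie_ideal x -> in_lie_ideal y -> in_lie_ideal (x + y).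
Proof. by move=> Ix Iy; rewrite -[x]scale1r; exact: ideal_linear. Qed.

Let idealLl x y : in_lie_ideal x -> in_lie_ideal (lie x y).
Proof. by move=> Ix; rewrite lieC -scaleN1r; apply/idealZ/ideal_lie. Qed.

Definition quot_scale (c : K) := lift_op1 lie_quot ( *:%R c).
Definition quot_br := lift_op2 lie_quot (@lie K L).

Let scaleE c (x : L) : quot_scale c (\pi_lie_quot x) = \pi_lie_quot (c *: x).
Proof. by unlock quot_scale; apply: piE; rewrite -scalerBr; exact/idealZ/reprP. Qed.

Let brE (x y : L) : quot_br (\pi_lie_quot x) (\pi_lie_quot y) = \pi_lie_quot (lie x y).
Proof.
unlock quot_br; apply: piE; set x' := repr _; set y' := repr _.
have -> : lie x' y' - lie x y = lie (x' - x) y' + lie x (y' - y).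
  by rewrite lieDl lieDr lieNl lieNr addrA subrK.
by apply: idealD; [apply: idealLl|apply: ideal_lie]; exact: reprP.
Qed.

Let scaleA a b x : quot_scale a (quot_scale b x) = quot_scale (a * b) x.
Proof. by elim/quotW: x => x; rewrite !scaleE scalerA. Qed.
Let scale1 : left_id 1 quot_scale.
Proof. by elim/quotW=> x; rewrite scaleE scale1r. Qed.
Let scaleDr : right_distributive quot_scale +%R.
Proof. by move=> a; elim/quotW=> x; elim/quotW=> y;
  rewrite ?(scaleE, piD) scalerDr. Qed.
Let scaleDl x : {morph quot_scale^~ x : a b / a + b}.
Proof. by move=> a b; elim/quotW: x => x; rewrite !(scaleE, piD) scalerDl. Qed.

HB.instance Definition _ := GRing.Zmodule_isLmodule.Build K lie_quot
  scaleA scale1 scaleDr scaleDl.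

Let piZ c (x : L) : c *: \pi_lie_quot x = \pi_lie_quot (c *: x).
Proof. exact: scaleE. Qed.

Let br_linearl a x y z : quot_br (a *: x + y) z = a *: quot_br x z + quot_br y z.
Proof.
elim/quotW: x => s; elim/quotW: y => t; elim/quotW: z => u.
by rewrite !(piZ, piD, brE) lie_linearl.
Qed.
Let br_linearr a x y z : quot_br z (a *: x + y) = a *: quot_br z x + quot_br z y.
Proof.
elim/quotW: x => s; elim/quotW: y => t; elim/quotW: z => u.
by rewrite !(piZ, piD, brE) lie_linearr.
Qed.
Let br_alt x : quot_br x x = 0.
Proof. by elim/quotW: x => s; rewrite brE lie_alt pi0. Qed.
Let br_jacobi x y z : quot_br x (quot_br y z) + quot_br y (quot_br z x) +
  quot_br z (quot_br x y) = 0.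
Proof.
elim/quotW: x => s; elim/quotW: y => t; elim/quotW: z => u.
by rewrite !(brE, piD) lie_jacobi pi0.
Qed.

HB.instance Definition _ := isLieAlgebra.Build K lie_quot
  br_linearl br_linearr br_alt br_jacobi.

Definition quot_proj (x : L) : lie_quot := \pi_lie_quot x.

Lemma quot_proj_lie_morphism : lie_morphism quot_proj.
Proof.
split=> [c x y|x y]; rewrite /quot_proj.
  by rewrite piZ piD.
exact: esym (brE x y).
Qed.

Lemma quot_proj_rel x : S x -> quot_proj x = 0.
Proof. by move=> Sx; rewrite -pi0; apply: piE; rewrite subr0; exact: ideal_rel. Qed.

End LieQuotient.

Definition lie_pres (K : comNzRingType) (G : Type) (S : set (free_lie K G)) :=
  lie_quot S.
HB.instance Definition _ K G S := LieAlgebra.on (@lie_pres K G S).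

Definition pres_gen (K : comNzRingType) (G : Type) (S : set (free_lie K G))
  (g : G) : lie_pres S := quot_proj S (free_gen K g).

Section Completion.
Variables (K : numFieldType) (G : Type) (S : set (free_lie K G)).
Variable wt : G -> nat.
Local Notation L := (lie_pres S).

(* When the relators are homogeneous for wt, this is the grading induced on
   the presented algebra by deg g = wt g. *)
Inductive homogeneous : nat -> L -> Prop :=
| homog_gen g : homogeneous (wt g) (pres_gen S g)
| homog0 d : homogeneous d 0
| homog_linear d c x y :
    homogeneous d x -> homogeneous d y -> homogeneous d (c *: x + y)
| homog_lie d e x y :
    homogeneous d x -> homogeneous e y -> homogeneous (d + e) (lie x y).

Definition homogeneous_family : {pred nat -> L} :=
  fun f => `[< forall d, homogeneous d (f d) >].

Let family_submod : submod_closed homogeneous_family.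
Proof.
split; first by apply/asboolP => d; exact: homog0.
move=> c f g /asboolP hf /asboolP hg; apply/asboolP => d.
exact: homog_linear.
Qed.
HB.instance Definition _ :=
  GRing.isSubmodClosed.Build K (nat -> L) homogeneous_family family_submod.

(* An element of the completion is the family of its homogeneous components:
   the completion is the product, over d, of the degree d parts. *)
Record completion :=
  Completion { component :> nat -> L; _ : component \in homogeneous_family }.

HB.instance Definition _ := [isSub for component].
HB.instance Definition _ := [Choice of completion by <:].
HB.instance Definition _ := [SubChoice_isSubLmodule of completion by <:].

Lemma componentP (f : completion) d : homogeneous d (f d).
Proof. by case: f => f /= /asboolP. Qed.

Lemma completion_eq (f g : completion) : (forall d, f d = g d) -> f = g.
Proof. by move=> fg; apply/val_inj/funext. Qed.

Lemma componentD (f g : completion) d : (f + g) d = f d + g d.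
Proof. by []. Qed.
Lemma componentZ c (f : completion) d : (c *: f) d = c *: f d.
Proof. by []. Qed.
Lemma component0 d : (0 : completion) d = 0. Proof. by []. Qed.

Lemma homogeneous_sum d (I : Type) (r : seq I) (P : pred I) (F : I -> L) :
  (forall i, P i -> homogeneous d (F i)) ->
  homogeneous d (\sum_(i <- r | P i) F i).
Proof.
move=> hF; elim/big_ind : _ => //; first exact: homog0.
by move=> x y hx hy; rewrite -[x]scale1r; exact: homog_linear.
Qed.

Definition completion_lie_fun (f g : completion) (d : nat) : L :=
  \sum_(i < d.+1) lie (f i) (g (d - i)%N).

Let completion_lie_homog f g : completion_lie_fun f g \in homogeneous_family.
Proof.
apply/asboolP => d; apply: homogeneous_sum => i _.
rewrite -{1}(subnKC (leq_ord i)).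
by apply: homog_lie; exact: componentP.
Qed.

Definition completion_lie f g : completion :=
  Completion (completion_lie_homog f g).

Lemma completion_lieE f g d :
  completion_lie f g d = \sum_(i < d.+1) lie (f i) (g (d - i)%N).
Proof. by []. Qed.

Let br_linearl a x y z : completion_lie (a *: x + y) z =
  a *: completion_lie x z + completion_lie y z.
Proof.
apply: completion_eq => d; rewrite componentD componentZ !completion_lieE.
rewrite scaler_sumr -big_split.
by apply: eq_bigr => i _; rewrite componentD componentZ lie_linearl.
Qed.

Let br_linearr a x y z : completion_lie z (a *: x + y) =
  a *: completion_lie z x + completion_lie z y.
Proof.
apply: completion_eq => d; rewrite componentD componentZ !completion_lieE.
rewrite scaler_sumr -big_split.
by apply: eq_bigr => i _; rewrite componentD componentZ lie_linearr.
Qed.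

Let br_alt x : completion_lie x x = 0.
Proof.
apply: completion_eq => d; rewrite component0 completion_lieE.
set s := \sum_(i < _) _.
have sN : s = - s.
  rewrite {1}/s (reindex_inj rev_ord_inj) /= -sumrN.
  by apply: eq_bigr => i _; rewrite subSS subKn ?leq_ord// -lieC.
have s2 : 2%:R *: s = 0 by rewrite scaler_nat mulr2n {1}sN addNr.
by rewrite -[s]scale1r -(@mulVf K 2%:R) ?pnatr_eq0// -scalerA s2 scaler0.
Qed.

Let triple (F : nat -> nat -> nat -> L) d :=
  \sum_(i < d.+1) \sum_(j < d.+1) \sum_(k < d.+1 | (i + j + k == d)%N) F i j k.

Let lie_lieE x y z d : completion_lie x (completion_lie y z) d =
  triple (fun i j k => lie (x i) (lie (y j) (z k))) d.
Proof.
rewrite completion_lieE; apply: eq_bigr => i _.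
rewrite completion_lieE lie_sumr.
rewrite [RHS](bigID (fun j : 'I_d.+1 => (j < (d - i).+1)%N)) /=.
rewrite [X in _ + X]big1 ?addr0; last first.
  move=> j; rewrite -leqNgt => dij; rewrite big1// => k /eqP ijk.
  have : (i + j <= d)%N by rewrite -[leqRHS]ijk leq_addr.
  by rewrite -leq_subRL ?leq_ord// leqNgt dij.
have le : ((d - i).+1 <= d.+1)%N by rewrite ltnS leq_subr.
rewrite (big_ord_widen _ (fun j => lie (x i) (lie (y j) (z (d - i - j)%N))) le).
apply: eq_bigr => j ji.
have kd : (d - i - j < d.+1)%N by rewrite ltnS -subnDA leq_subr.
rewrite (big_pred1 (Ordinal kd)) //= => k /=.
rewrite -(inj_eq val_inj) /= -subnDA -[RHS](eqn_add2l (i + j)) subnKC//.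
by rewrite -leq_subRL ?leq_ord.
Qed.

Let triple_rot F d : triple F d = triple (fun i j k => F k i j) d.
Proof.
transitivity (\sum_(i < d.+1) \sum_(j < d.+1) \sum_(k < d.+1)
   if (i + j + k == d)%N then F i j k else 0).
  by apply: eq_bigr => i _; apply: eq_bigr => j _; exact: big_mkcond.
rewrite exchange_big; apply: eq_bigr => j _ /=.
rewrite exchange_big; apply: eq_bigr => k _ /=.
rewrite [RHS]big_mkcond; apply: eq_bigr => i _.
by rewrite -addnA addnC.
Qed.

Let br_jacobi x y z : completion_lie x (completion_lie y z) +
  completion_lie y (completion_lie z x) +
  completion_lie z (completion_lie x y) = 0.
Proof.
apply: completion_eq => d; rewrite component0 !componentD !lie_lieE.
rewrite [X in X + _ + _]triple_rot [X in X + _ + _]triple_rot.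
rewrite [X in _ + X + _]triple_rot /triple -!big_split big1// => i _.
rewrite -!big_split big1// => j _; rewrite -!big_split big1//= => k _.
by rewrite -(lie_jacobi (x j) (y k) (z i)).
Qed.

HB.instance Definition _ := isLieAlgebra.Build K completion
  br_linearl br_linearr br_alt br_jacobi.

Let concentrated d (x : L) : homogeneous d x ->
  (fun e => if e == d then x else 0) \in homogeneous_family.
Proof.
move=> hx; apply/asboolP => e.
by case: eqP => [->//|_]; exact: homog0.
Qed.

Definition completion_gen (g : G) : completion :=
  Completion (concentrated (homog_gen g)).

Let ad_series_homog (c : nat -> K) (a b : completion) :
  (fun d => \sum_(k < d.+1) c k *: (iter k (lie a) b) d)
    \in homogeneous_family.
Proof.
apply/asboolP => d; apply: homogeneous_sum => k _.
rewrite -[_ *: _]addr0; apply: homog_linear; last exact: homog0.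
exact: componentP.
Qed.

(* The value at b of the power series \sum_k c_k (ad a)^k.  When all the
   weights are positive, (ad a)^k b has no component of degree less than k,
   so that the truncated sum in degree d contains all the nonzero terms. *)
Definition ad_series (c : nat -> K) (a b : completion) : completion :=
  Completion (ad_series_homog c a b).

End Completion.
Section Complexification.
Variables (R : realType) (E : vectType R).

(* E (x) C, with (a, b) standing for a + i b. *)
Definition complexification : Type := (E * E)%type.
HB.instance Definition _ := GRing.Zmodule.on complexification.

Let scale (c : R[i]) (u : complexification) : complexification :=
  (complex.Re c *: u.1 - complex.Im c *: u.2,
   complex.Re c *: u.2 + complex.Im c *: u.1).

Let scaleA a b u : scale a (scale b u) = scale (a * b) u.
Proof.
case: a b u => [a1 a2] [b1 b2] [u1 u2]; rewrite /scale /=.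
congr pair; rewrite !(scalerDr, scalerDl, scalerBl, scalerN, scaleNr, scalerA, opprD).
  by rewrite [LHS](AC (2*2) (1*4*(2*3))).
by rewrite [LHS](AC (2*2) (1*4*(2*3))).
Qed.
Let scale1 : left_id 1 scale.
Proof. by case=> u1 u2; rewrite /scale /= !scale1r !scale0r subr0 addr0. Qed.
Let scaleDr : right_distributive scale +%R.
Proof.
move=> a [u1 u2] [v1 v2]; rewrite /scale /=.
by congr pair; rewrite /= !scalerDr ?opprD addrACA.
Qed.
Let scaleDl u : {morph scale^~ u : a b / a + b}.
Proof.
move=> [a1 a2] [b1 b2]; case: u => u1 u2; rewrite /scale /=.
by congr pair; rewrite /= !scalerDl ?opprD addrACA.
Qed.
HB.instance Definition _ := GRing.Zmodule_isLmodule.Build R[i] complexification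
  scaleA scale1 scaleDr scaleDl.

Let n := \dim {:E}.
Let e := vbasis {:E}.
Let to_row (u : complexification) : 'rV[R[i]]_n :=
  \row_j (coord e j u.1 +i* coord e j u.2)%C.
Let of_row (r : 'rV[R[i]]_n) : complexification :=
  (\sum_j complex.Re (r 0 j) *: e`_j, \sum_j complex.Im (r 0 j) *: e`_j).

Let to_row_linear : linear to_row.
Proof.
move=> [c1 c2] [u1 u2] [v1 v2]; apply/rowP => j; rewrite !mxE /=.
by rewrite !linearD !linearZ !linearN /=; congr Complex; rewrite ?mulrN ?scalerN.
Qed.
Let to_row_bij : bijective to_row.
Proof.
have eP : basis_of {:E} e := vbasisP _.
exists of_row => [[u1 u2]|r].
  congr pair; rewrite [RHS](coord_basis eP (memvf _)).
    by apply: eq_bigr => j _; rewrite mxE.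
  by apply: eq_bigr => j _; rewrite mxE.
apply/rowP => j; rewrite !mxE /= !coord_sum_free ?(basis_free eP)//.
by case: (r 0 j).
Qed.
Let complexification_finDim : Vector.axiom n complexification.
Proof. by exists to_row; [exact: to_row_linear|exact: to_row_bij]. Qed.
HB.instance Definition _ := Lmodule_hasFinDim.Build R[i] complexification
  complexification_finDim.

Definition real_vec (v : E) : complexification := (v, 0).

(* The complex-linear extension to E (x) C of a real linear form. *)
Definition form_eval (a : 'Hom(E, R^o)) (u : complexification) : R[i] :=
  (a u.1 +i* a u.2)%C.

Lemma form_eval_linear a c u v :
  form_eval a (c *: u + v) = c * form_eval a u + form_eval a v.
Proof.
case: c u v => [c1 c2] [u1 u2] [v1 v2]; rewrite /form_eval /=.
by rewrite !linearD !linearZ !linearN /=; congr Complex; rewrite ?mulrN ?scalerN.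
Qed.

End Complexification.

Section RootSystem.
Variables (R : realType) (E : vectType R) (ip : {dot E for idfun}).
Local Notation dualE := 'Hom(E, R^o).

(* The isomorphism from E to its dual given by the Euclidean structure. *)
Definition flat : 'Hom(E, dualE) := linfun (fun u => linfun (ip u : E -> R^o)).
Definition sharp : 'Hom(dualE, E) := (flat^-1)%VF.

Let flatE u v : flat u v = ip u v.
Proof.
have lin_r w : linear (ip w : E -> R^o).
  by move=> c x y; rewrite linearPr.
pose f w : {linear E -> R^o} :=
  HB.pack (ip w : E -> R^o) (GRing.isLinear.Build _ _ _ _ _ (lin_r w)).
have fE w x : linfun (ip w : E -> R^o) x = ip w x by rewrite (lfunE (f w)).
have lin_l : linear (fun u => linfun (ip u : E -> R^o)).
  move=> c x y; apply/lfunP => z.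
  by rewrite add_lfunE scale_lfunE !fE linearPl.
pose g : {linear E -> dualE} :=
  HB.pack (fun u => linfun (ip u : E -> R^o))
    (GRing.isLinear.Build _ _ _ _ _ lin_l).
by rewrite /flat (lfunE g) /= fE.
Qed.

Lemma sharpP (l : dualE) v : ip (sharp l) v = l v.
Proof.
rewrite -flatE /sharp limg_lfunVK//.
suff -> : limg flat = fullv by exact: memvf.
apply/eqP; rewrite eqEdim subvf /=.
have ker0 : lker flat == 0%VS.
  apply/lker0P => u w uw; apply/eqP; rewrite -subr_eq0; apply/negPn/negP.
  move=> uw0; have := neq0_dnorm_gt0 (s := ip) _ uw0.
  have uw_0 : flat (u - w) = 0 by rewrite linearB /= uw subrr.
  by rewrite -flatE uw_0 zero_lfunE ltxx.
rewrite limg_dim_eq; last by rewrite (eqP ker0) capv0.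
by rewrite !dimvf /dim /= muln1.
Qed.

Definition coroot (a : dualE) : E :=
  (2 / ip (sharp a) (sharp a)) *: sharp a.

Definition reflection (a : dualE) : 'End(dualE) :=
  linfun (fun l : dualE => l - l (coroot a) *: a).

Lemma reflectionE (a l : dualE) : reflection a l = l - l (coroot a) *: a.
Proof.
have lin : linear (fun l : dualE => l - l (coroot a) *: a).
  move=> c x y; rewrite add_lfunE scale_lfunE scalerBr scalerDl opprD.
  by rewrite scalerA addrACA.
pose f : {linear dualE -> dualE} :=
  HB.pack (fun l : dualE => l - l (coroot a) *: a)
    (GRing.isLinear.Build _ _ _ _ _ lin).
by rewrite /reflection (lfunE f).
Qed.

Variable Phi : {fset dualE}.

Record root_system : Prop := RootSystem {
  root_span : <<Phi>>%VS = fullv;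
  root_neq0 : (0 : dualE) \notin Phi;
  root_reflection : forall a b, a \in Phi -> b \in Phi -> reflection a b \in Phi;
  root_crystallographic :
    forall a b, a \in Phi -> b \in Phi -> b (coroot a) \is a Num.int;
  root_reduced :
    forall (a : dualE) (c : R), a \in Phi -> c *: a \in Phi -> c = 1 \/ c = -1
}.

Definition positive_system (Phip : {set Phi}) : Prop :=
  exists v : E, forall a : Phi,
    (val a) v != 0 /\ (a \in Phip) = (0 < (val a) v).

Definition simple_root (Phip : {set Phi}) (l : dualE) : Prop :=
  exists a : Phi, [/\ a \in Phip, val a = l &
    forall b c : Phi, b \in Phip -> c \in Phip -> l <> val b + val c].

(* Reflections are involutions, so the submonoid they generate is a group. *)
Inductive weyl_group : 'End(dualE) -> Prop :=
| weyl_id : weyl_group \1%VF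
| weyl_reflection (a : Phi) w :
    weyl_group w -> weyl_group (reflection (val a) \o w)%VF.

Definition root_subsystem (Psi : {set Phi}) : Prop :=
  forall a : Phi,
    inIntSpan (in_tuple [seq val b | b in Psi]) (val a) <-> a \in Psi.

Definition subsystem_rank (Psi : {set Phi}) : nat := \dim <<[seq val b | b in Psi]>>%VS.

Definition in_root_lattice (l : dualE) : Prop := inIntSpan (in_tuple Phi) l.

Definition coweight_lattice : {pred complexification E} :=
  fun u => `[< exists2 v : E, u = real_vec v &
    forall l, in_root_lattice l -> l v \is a Num.int >].

Let coweight_zmod : zmod_closed coweight_lattice.
Proof.
split.
  by apply/asboolP; exists 0 => // l _; rewrite linear0.
move=> u v /asboolP[a -> ha] /asboolP[b -> hb]; apply/asboolP.
exists (a - b); first by rewrite /real_vec; congr pair; rewrite /= subr0.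
by move=> l hl; rewrite linearB /= rpredB// ?ha ?hb.
Qed.
HB.instance Definition _ := GRing.isZmodClosed.Build (complexification E)
  coweight_lattice coweight_zmod.

(* The quotient of E (x) C by the coweight lattice. *)
Definition torus := {ideal_quot coweight_lattice}.
HB.instance Definition _ := EqQuotient.on torus.
HB.instance Definition _ := GRing.Zmodule.on torus.

Definition torus_proj (z : complexification E) : torus := (\pi_torus z)%qT.

End RootSystem.

Section ComplexAnalysis.
Variable R : realType.
Local Notation C := R[i].

Definition cexp (z : C) : C :=
  (expR (complex.Re z))%:C%C *
  (cos (complex.Im z) +i* sin (complex.Im z))%C.

Definition two_pi_i : C := (0 +i* (2 * pi))%C.

Definition e2pii (z : C) : C := cexp (two_pi_i * z).

Lemma e2piiD z w : e2pii (z + w) = e2pii z * e2pii w.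
Proof.
rewrite /e2pii mulrDr; move: (_ * z) (_ * w) => [a b] [c d].
rewrite /cexp /= expRD cosD sinD.
by apply/eqP; rewrite eq_complex /=; apply/andP; split; apply/eqP; ring.
Qed.

Lemma e2pii_int (m : int) : e2pii m%:~R = 1.
Proof.
have e0 : e2pii 0 = 1.
  by rewrite /e2pii mulr0 /cexp /= expR0 cos0 sin0 mul1r.
have e1 : e2pii 1 = 1.
  rewrite /e2pii mulr1 /cexp /= expR0 mulr_natl cos2pi sin2pi.
  by rewrite mul1r.
have eN k : e2pii k%:R = 1.
  by elim: k => [//|k IHk]; rewrite -natr1 e2piiD IHk e1 mulr1.
case: m => k; first exact: eN.
by rewrite NegzE mulrNz -[LHS]mulr1 -{2}(eN k.+1) -e2piiD addNr.
Qed.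

(* The coefficients of the power series converging to f on a punctured
   neighbourhood of 0: f itself may have a removable singularity at 0. *)
Definition power_series_at0 (f : C -> C) : nat -> C :=
  xget (fun=> 0) [set c | \forall x \near (0 : C^o)^',
    series (fun k => c k * x ^+ k : C^o) @ \oo --> (f x : C^o)].

Definition im_pinfty : set_system C :=
  filter_from setT (fun M : R => [set tau : C | M < complex.Im tau]).

(* Convergence in a complex vector space, for functions that eventually stay in
   a finite-dimensional subspace: convergence of coefficients on a fixed finite
   family of vectors, i.e. convergence for the vector space topology of the
   subspace. *)
Definition cvg_in (V : lmodType C) (F : set_system C) (f : C -> V) (l : V) :=
  exists (m : nat) (b : 'I_m -> V) (c : C -> 'I_m -> C) (c0 : 'I_m -> C),
  [/\ \forall t \near F, f t = \sum_i c t i *: b i,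
      l = \sum_i c0 i *: b i &
      forall i, c t i @[t --> F] --> (c0 i : C^o)].

Definition period_lattice (tau : C) : set C :=
  [set z | exists m n : int, z = m%:~R + n%:~R * tau].

(* theta z tau stands for theta(z | tau). *)
Record theta_function (theta : C -> C -> C) : Prop := ThetaFunction {
  theta_holomorphic : forall tau z, 0 < complex.Im tau ->
    derivable (fun x : C^o => theta x tau : C^o) z 1;
  theta_zeros : forall tau, 0 < complex.Im tau ->
    [set z | theta z tau = 0] = period_lattice tau;
  theta_derive0 : forall tau, 0 < complex.Im tau ->
    'D_1 (fun x : C^o => theta x tau : C^o) 0 = 1;
  theta_add1 : forall tau z, 0 < complex.Im tau ->
    theta (z + 1) tau = - theta z tau;
  theta_opp : forall tau z, 0 < complex.Im tau ->
    theta (- z) tau = - theta z tau;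
  (* the first exponential is exp (- pi i tau) *)
  theta_addtau : forall tau z, 0 < complex.Im tau ->
    theta (z + tau) tau = - e2pii (- tau / 2) * e2pii (- z) * theta z tau
}.

Definition kzb_kernel (theta : C -> C -> C) (z x tau : C) : C :=
  theta (z + x) tau / (theta z tau * theta x tau) - x^-1.

Definition kzb_kernel_limit (x : C) : C :=
  two_pi_i * e2pii x / (e2pii x - 1) - x^-1.

End ComplexAnalysis.

Section Connections.
Variables (R : realType) (E : vectType R) (ip : {dot E for idfun}).
Local Notation C := R[i].
Local Notation dualE := 'Hom(E, R^o).
Local Notation h := (complexification E).
Variables (Phi : {fset dualE}) (Phip : {set Phi}).

Variant ell_generator : Type :=
| EllT of Phi
| EllX of h
| EllY of h.

Local Notation FL := (free_lie C ell_generator).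
Local Notation t a := (free_gen C (EllT a)).
Local Notation x u := (free_gen C (EllX u)).
Local Notation y u := (free_gen C (EllY u)).

Inductive ell_relator : FL -> Prop :=
| ell_tN (a b : Phi) : val b = - val a -> ell_relator (t b - t a)
| ell_x_linear (c : C) (u v : h) :
    ell_relator (x (c *: u + v) - (c *: x u + x v))
| ell_y_linear (c : C) (u v : h) :
    ell_relator (y (c *: u + v) - (c *: y u + y v))
| ell_tt (Psi : {set Phi}) (a : Phi) :
    root_subsystem Psi -> subsystem_rank Psi = 2%N -> a \in Psi ->
    ell_relator (lie (t a) (\sum_(b in Psi :&: Phip) t b))
| ell_xx u v : ell_relator (lie (x u) (x v))
| ell_yy u v : ell_relator (lie (y u) (y v))
| ell_yx u v :
    ell_relator (lie (y u) (x v) -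
      \sum_(g in Phip) (form_eval (val g) v * form_eval (val g) u) *: t g)
| ell_tx (a : Phi) u : form_eval (val a) u = 0 -> ell_relator (lie (t a) (x u))
| ell_ty (a : Phi) u : form_eval (val a) u = 0 -> ell_relator (lie (t a) (y u)).

Definition t_ell : lieAlgType C := lie_pres ell_relator.

Definition ell_weight (g : ell_generator) : nat :=
  match g with EllT _ => 2%N | EllX _ | EllY _ => 1%N end.

Definition t_ell_hat : lieAlgType C := completion ell_relator ell_weight.

Definition hat_t (a : Phi) : t_ell_hat := completion_gen _ _ (EllT a).
Definition hat_x (u : h) : t_ell_hat := completion_gen _ _ (EllX u).
Definition hat_y (u : h) : t_ell_hat := completion_gen _ _ (EllY u).

Variant trig_generator : Type :=
| TrigT of Phi
| TrigX of h.

Local Notation tT a := (free_gen C (TrigT a)).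
Local Notation tX u := (free_gen C (TrigX u)).

Definition inversion_root (w : 'End(dualE)) (b : Phi) : bool :=
  (b \in Phip) && [exists g in Phip, val b == w (- val g)].

Inductive trig_relator : free_lie C trig_generator -> Prop :=
| trig_tN (a b : Phi) : val b = - val a -> trig_relator (tT b - tT a)
| trig_X_linear (c : C) (u v : h) :
    trig_relator (tX (c *: u + v) - (c *: tX u + tX v))
| trig_tt (Psi : {set Phi}) (a : Phi) :
    root_subsystem Psi -> subsystem_rank Psi = 2%N -> a \in Psi ->
    trig_relator (lie (tT a) (\sum_(b in Psi :&: Phip) tT b))
| trig_XX u v : trig_relator (lie (tX u) (tX v))
| trig_tX (a : Phi) (w : 'End(dualE)) u :
    a \in Phip -> weyl_group ip Phi w ->
    simple_root Phip ((w^-1)%VF (val a)) -> form_eval (val a) u = 0 ->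
    trig_relator (lie (tT a)
      (tX u - two_pi_i R *:
         \sum_(b | inversion_root w b) form_eval (val b) u *: tT b)).

Definition t_trig : lieAlgType C := lie_pres trig_relator.
Definition trig_t (a : Phi) : t_trig := pres_gen _ (TrigT a).
Definition trig_X (u : h) : t_trig := pres_gen _ (TrigX u).

Definition hat_component (f : t_ell_hat) (d : nat) : t_ell := component f d.

(* The power series c evaluated at ad (x(a^\vee) / 2) and applied to t_a. *)
Definition half_ad_x (c : nat -> C) (a : Phi) : t_ell_hat :=
  ad_series c (2^-1 *: hat_x (real_vec (coroot ip (val a)))) (hat_t a).

Definition X_image (u : h) : t_ell_hat :=
  - hat_y u + \sum_(a in Phip)
    form_eval (val a) u *: half_ad_x (power_series_at0 (@kzb_kernel_limit R)) a.

Definition dual_bases (n : nat) (e : n.-tuple h) (eps : n.-tuple 'Hom(h, C^o)) :=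
  [/\ basis_of fullv e, basis_of fullv eps &
      forall i j : 'I_n, (tnth eps i) (tnth e j) = (i == j)%:R].

(* torus_char_proj below: this does not depend on the representative. *)
Definition torus_char (a : dualE) (q : torus Phi) : C :=
  e2pii (form_eval a (repr q)).

Lemma torus_char_proj (a : dualE) (z : h) : a \in Phi ->
  torus_char a (torus_proj Phi z) = e2pii (form_eval a z).
Proof.
move=> aPhi; rewrite /torus_char; set z' := repr _.
have /asboolP[v zz' hv] : z' - z \in coweight_lattice Phi.
  by rewrite (Quotient.idealrBE (coweight_lattice Phi)) reprK.
rewrite -(subrK z z') zz' -[X in X + z]scale1r form_eval_linear mul1r e2piiD.
have /intrP[k ak] : a v \is a Num.int.
  apply: hv; rewrite /in_root_lattice.
  have ia : (index a Phi < size Phi)%N by rewrite index_mem.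
  exists [ffun i => (i == Ordinal ia)%:Z].
  rewrite (bigD1 (Ordinal ia)) //= big1 => [|i ni]; last first.
    by rewrite ffunE (negPf ni) mulr0z.
  by rewrite ffunE eqxx addr0 nth_index.
have -> : form_eval a (real_vec v) = k%:~R.
  by rewrite /form_eval /= linear0 ak -(rmorph_int (real_complex R)).
by rewrite e2pii_int mul1r.
Qed.

Definition torus_reg : set (torus Phi) :=
  [set q | forall a : Phi, torus_char (val a) q <> 1].

(* A connection d + omega on a trivial bundle over h, or over the torus, is given
   by its form omega, whose value on a tangent vector v in h at a point z is
   [omega z v]. *)

Definition kzb_form (theta : C -> C -> C) (tau : C) (n : nat) (e : n.-tuple h)
    (eps : n.-tuple 'Hom(h, C^o)) (z v : h) : t_ell_hat :=
  - (\sum_(a in Phip) form_eval (val a) v *: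
      half_ad_x (power_series_at0
        (fun x => kzb_kernel theta (form_eval (val a) z) x tau)) a)
  + \sum_(i < n) (tnth eps i) v *: hat_y (tnth e i).

Definition deg_form (n : nat) (e : n.-tuple h)
    (eps : n.-tuple 'Hom(h, C^o)) (q : torus Phi) (v : h) : t_ell_hat :=
  - (\sum_(a in Phip) form_eval (val a) v *:
      ((two_pi_i R / (torus_char (val a) q - 1)) *: hat_t a))
  + \sum_(i < n) (tnth eps i) v *:
      (hat_y (tnth e i) - \sum_(a in Phip) form_eval (val a) (tnth e i) *:
          half_ad_x (power_series_at0 (@kzb_kernel_limit R)) a).

Definition trig_form (n : nat) (e : n.-tuple h)
    (eps : n.-tuple 'Hom(h, C^o)) (q : torus Phi) (v : h) : t_trig :=
  - (\sum_(a in Phip) form_eval (val a) v *: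
      ((two_pi_i R / (torus_char (val a) q - 1)) *: trig_t a))
  - \sum_(i < n) (tnth eps i) v *: trig_X (tnth e i).

End Connections.

(* Main.v *)
Require Import Defs.
From mathcomp Require Import all_boot all_order all_algebra finmap complex.
From mathcomp Require Import all_classical all_reals all_analysis.
From mathcomp Require Import ring lra.

(** Write [e z] for [e2pii z], [kappa x] for the limit kernel
    [2 pi i * e x / (e x - 1) - 1 / x], [kappa x = \sum_k c_k x ^ k], and [x_a]
    for [x (a^vee) / 2].

    Degeneration.  The function [e (z / 2) * theta z] is 1-periodic, and the
    quasi-periodicity in [tau] becomes a recurrence on its Fourier coefficients:
    up to a relative error of the order of [|e tau|], uniformly on horizontal
    strips, it is a multiple of [e z - 1] ([theta_approx]).  The normalisation
    [theta' 0 = 1] fixes the multiple, and the kernel [k z x] tends to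
    [2 pi i / (e z - 1) + kappa x] uniformly on the circle of radius 1/2 in [x].
    Taylor coefficients are means over this circle, so they converge as well
    ([kernel_coef_cvg]); the constant term [2 pi i / (e z - 1)] is the rational
    coefficient of the limit connection.  The Fourier and Taylor expansions rest
    on Goursat's lemma, in the form that the mean of a periodic holomorphic
    function over a horizontal period does not depend on its height.

    The Lie algebra map.  By the universal property of a presentation, the
    relations of [t_trig] have to be checked on the images in the completion,
    which is done degree by degree.

    The defining relations between the [t_a], indexed by rank 2 subsystems, are
    equivalent to relations along root strings: the sum of the brackets of [t_a]
    with [t_c], for [c] in an [a]-string not through [a], vanishes
    ([string_relation]).  On such a string, elements [x u] with [a u = 0] act by a
    single weight, so the relation persists for the [(ad x_c) ^ N t_c].  As
    [c_N = 0] for even [N > 0] and [c_0 = pi i] ([kcoef_even], [kcoef0]), the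
    relation between [t_a] and [X_w u] reduces for odd [N] to sums over all
    roots, which are unions of strings, and for [N = 0] to the sum over the
    positive system [w Phip], in which [a] is simple, and which is therefore also
    a union of [a]-strings apart from [a] itself ([weyl_sum_t]).

    The bracket of the images of [X u] and [X v] is, in degree [n + 4], half the
    sum over pairs of positive roots of [F_ab [t_a, t_b]], where [F_ab] is a
    binary form of degree [n] in the commuting operators [ad (x u)] and
    [ad (x v)] ([act_edge_form]).  The cotangent addition theorem for [kappa]
    ([kcoef_addition]) says precisely that [F_ab = F_ac + F_cb] whenever
    [c = a + b] ([edge_form_triangle]).  A family with this property pairs to zero
    with the brackets [[t_a, t_b]], because of the string relations: the roots are
    removed one at a time, by decreasing height ([edge_sum_zero]). *)

Set Implicit Arguments.
Unset Strict Implicit.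
Unset Printing Implicit Defensive.

Import Order.TTheory GRing.Theory Num.Theory.
Import numFieldNormedType.Exports.
Local Open Scope classical_set_scope.
Local Open Scope ring_scope.

(** * Complex norm and primitives of complex-valued functions *)

Section ComplexNorm.
Variable R : realType.
Local Notation C := R[i].
Local Notation N := (@Normc.normc R).
Local Notation Re := (@complex.Re R).
Local Notation Im := (@complex.Im R).
Implicit Types (z w : C) (x y : R).

Lemma normc_ge0 z : 0 <= N z.
Proof. by case: z => a b; exact: sqrtr_ge0. Qed.

Lemma normcD z w : N (z + w) <= N z + N w.
Proof. exact: le_normcD. Qed.

Lemma normcB z w : N (z - w) = N (w - z).
Proof. by rewrite -normcN opprB. Qed.

Lemma normc_sub z w : N z - N w <= N (z - w).
Proof. by rewrite lerBlDr; have := normcD (z - w) w; rewrite subrK. Qed.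

Lemma normcBD z w : N (z - w) <= N z + N w.
Proof. by rewrite -[N w]normcN; exact: normcD. Qed.

Lemma normc_eq0 z : (N z == 0) = (z == 0).
Proof. by apply/eqP/eqP => [/Normc.eq0_normc//|->]; rewrite Normc.normc0. Qed.

Lemma normc_gt0 z : (0 < N z) = (z != 0).
Proof. by rewrite lt_def normc_ge0 normc_eq0 andbT. Qed.

Lemma normcX z n : N (z ^+ n) = N z ^+ n.
Proof.
by elim: n => [|n IHn]; rewrite ?expr0 ?Normc.normc1// !exprS Normc.normcM IHn.
Qed.

Lemma ler_normc_Re z : `|Re z| <= N z.
Proof.
case: z => a b /=; rewrite -sqrtr_sqr; apply: ler_wsqrtr.
by rewrite lerDl sqr_ge0.
Qed.

Lemma ler_normc_Im z : `|Im z| <= N z.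
Proof.
case: z => a b /=; rewrite -sqrtr_sqr; apply: ler_wsqrtr.
by rewrite lerDr sqr_ge0.
Qed.

Lemma normc_le_ReIm z : N z <= `|Re z| + `|Im z|.
Proof.
case: z => a b /=; rewrite -[leRHS]ger0_norm ?addr_ge0// -sqrtr_sqr.
apply: ler_wsqrtr; rewrite sqrrD !real_normK ?num_real//.
by rewrite addrAC lerDl mulrn_wge0// mulr_ge0.
Qed.

Lemma normc_real x : N x%:C%C = `|x|.
Proof. by rewrite /= expr0n addr0 sqrtr_sqr. Qed.

Lemma normC_normc z : `|z| = (N z)%:C%C.
Proof. by case: z. Qed.

Lemma normc_sum (I : Type) (r : seq I) (P : pred I) (F : I -> C) :
  N (\sum_(i <- r | P i) F i) <= \sum_(i <- r | P i) N (F i).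
Proof.
elim/big_rec2 : _ => [|i y z _ h]; first by rewrite Normc.normc0.
by apply: le_trans (normcD _ _) _; rewrite lerD2l.
Qed.

Lemma ReD z w : Re (z + w) = Re z + Re w. Proof. by case: z; case: w. Qed.
Lemma ImD z w : Im (z + w) = Im z + Im w. Proof. by case: z; case: w. Qed.
Lemma ReN z : Re (- z) = - Re z. Proof. by case: z. Qed.
Lemma ImN z : Im (- z) = - Im z. Proof. by case: z. Qed.
Lemma ReM z w : Re (z * w) = Re z * Re w - Im z * Im w.
Proof. by case: z; case: w. Qed.
Lemma ImM z w : Im (z * w) = Re z * Im w + Im z * Re w.
Proof. by case: z; case: w. Qed.

End ComplexNorm.

Section Primitive.
Variable R : realType.
Local Notation C := R[i].
Local Notation N := (@Normc.normc R).
Local Notation Re := (@complex.Re R).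
Local Notation Im := (@complex.Im R).

Lemma is_derive_increment (F f : R -> R) (a b : R) : a <= b ->
  (forall x, a <= x <= b -> is_derive x (1 : R) F (f x)) ->
  exists2 c, a <= c <= b & F b - F a = f c * (b - a).
Proof.
move=> ab dF; have [c cab ->] : exists2 c, c \in `[a, b]%R & F b - F a = f c * (b - a).
  apply: MVT_segment => // [x|].
    by rewrite in_itv /= => /andP[/ltW ax /ltW xb]; apply: dF; rewrite ax.
  apply: derivable_within_continuous => x; rewrite in_itv /= => xab.
  by case: (dF x xab).
by exists c.
Qed.

(** Primitives on the bounded intervals ]-n, n[, normalised at 0, agree where
    they overlap, and so glue to a primitive on the whole line. *)
Lemma real_primitive_exists (f : R -> R) : continuous f ->
  exists F : R -> R, forall x, is_derive x (1 : R) F (f x).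
Proof.
move=> cf.
have G_ex (n : nat) : exists G : R -> R, G 0 = 0 /\
    forall x : R, - n.+1%:R < x < n.+1%:R -> is_derive x (1 : R) G (f x).
  pose a : R := - n.+1%:R; pose u : R := n.+2%:R.
  pose F x := (\int[lebesgue_measure]_(t in [set` `[a, x]]) (f t))%R.
  have au : a < u by rewrite /a /u (lt_trans (_ : _ < 0))// ?oppr_lt0// ltr0n.
  have dF (x : R) : - n.+1%:R < x < n.+1%:R -> is_derive x (1 : R) F (f x).
    move=> /andP[ax xn].
    have xu : x < u by rewrite (lt_trans xn)// ltr_nat.
    have [] := @continuous_FTC1_closed R f a x u xu _ ax (cf x).
      apply: continuous_compact_integrable; first exact: segment_compact.
      by apply: continuous_subspaceT; exact: cf.
    by move=> dFx FxE; apply: DeriveDef; [exact: dFx|rewrite -derive1E; exact: FxE].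
  exists (fun x => F x - F 0); split; first by rewrite subrr.
  move=> x /dF dFx.
  have -> : f x = f x - 0 by rewrite subr0.
  by apply: is_deriveB.
pose G n := sval (cid (G_ex n)).
have G0 n : G n 0 = 0 by exact: (svalP (cid (G_ex n))).1.
have dG n (x : R) : - n.+1%:R < x < n.+1%:R -> is_derive x 1 (G n) (f x).
  exact: (svalP (cid (G_ex n))).2.
have GE m n x : (m <= n)%N -> - m.+1%:R < x < m.+1%:R -> G m x = G n x.
  move=> mn /andP[mx xm].
  have mnR : (m.+1%:R : R) <= n.+1%:R by rewrite ler_nat ltnS.
  have m0 : (0 : R) < m.+1%:R by rewrite ltr0n.
  pose D y := G m y - G n y.
  have dD (y : R) : - m.+1%:R < y < m.+1%:R -> is_derive y 1 D 0.
    move=> ym; rewrite -(subrr (f y)).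
    by apply: is_deriveB; apply: dG => //; lra.
  apply/eqP; rewrite -subr_eq0 -/(D x); apply/eqP.
  have D0 : D 0 = 0 by rewrite /D !G0 subrr.
  have [x0|x0] := lerP 0 x.
    have [] := @is_derive_increment D (fun=> 0) 0 x x0.
      by move=> y yx; apply: dD; lra.
    by move=> c _; rewrite D0 subr0 mul0r.
  have [] := @is_derive_increment D (fun=> 0) x 0 (ltW x0).
    by move=> y yx; apply: dD; lra.
  by move=> c _; rewrite D0 sub0r mul0r => /eqP; rewrite oppr_eq0 => /eqP.
exists (fun x => G (Num.truncn `|x|) x) => x.
pose n := (Num.truncn `|x|).+2.
have xn : `|x| + 1 < n%:R.
  by rewrite /n -natr1 ltrD2r; exact: truncnS_gt.
have : is_derive x 1 (G n) (f x).
  apply: dG; rewrite -ltr_norml (lt_trans _ (_ : n%:R < _)) ?ltr_nat//.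
  by rewrite (lt_trans _ xn)// ltrDl.
apply: near_eq_is_derive.
near=> y.
have xy : `|y| < `|x| + 1.
  have : `|y - x| < 1.
    by rewrite distrC; near: y; exact: (@nbhsx_ballx _ _ x 1).
  by have := ler_normD (y - x) x; rewrite subrK; lra.
apply/esym/GE.
  rewrite truncn_le_nat (lt_trans xy)// (lt_trans xn)// ltr_nat//.
by rewrite -ltr_norml; exact: truncnS_gt.
Unshelve. all: by end_near.
Qed.

(** A primitive in the real variable of a complex-valued function; increments
    of primitives play the role of integrals throughout. *)
Definition primitive (F f : R -> C) := forall x : R,
  is_derive x (1 : R) (fun t => Re (F t)) (Re (f x)) /\
  is_derive x (1 : R) (fun t => Im (F t)) (Im (f x)).

Definition continuousC (f : R -> C) := forall x e, 0 < e ->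
  exists2 d, 0 < d & forall y, `|y - x| < d -> N (f y - f x) <= e.

Lemma primitive_exists f : continuousC f -> exists F, primitive F f.
Proof.
move=> cf.
have [F1 dF1] : exists F : R -> R, forall x, is_derive x (1 : R) F (Re (f x)).
  apply: real_primitive_exists => x; apply/cvgrPdist_le => e e0.
  have [d d0 fd] := cf x e e0.
  near=> y; rewrite -ReN -ReD; apply: le_trans (ler_normc_Re _) _.
  rewrite normcB; apply: fd; rewrite distrC; near: y.
  exact: (@nbhsx_ballx _ _ x (PosNum d0)%:num).
have [F2 dF2] : exists F : R -> R, forall x, is_derive x (1 : R) F (Im (f x)).
  apply: real_primitive_exists => x; apply/cvgrPdist_le => e e0.
  have [d d0 fd] := cf x e e0.
  near=> y; rewrite -ImN -ImD; apply: le_trans (ler_normc_Im _) _.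
  rewrite normcB; apply: fd; rewrite distrC; near: y.
  exact: (@nbhsx_ballx _ _ x (PosNum d0)%:num).
by exists (fun x => (F1 x +i* F2 x)%C) => x; split=> /=.
Unshelve. all: by end_near.
Qed.

Lemma primitive_le F f a b M : a <= b -> primitive F f ->
  (forall x, a <= x <= b -> N (f x) <= M) -> N (F b - F a) <= 2 * M * (b - a).
Proof.
move=> ab pF fM.
have [c cab cE] := @is_derive_increment _ _ a b ab (fun x _ => (pF x).1).
have [d dab dE] := @is_derive_increment _ _ a b ab (fun x _ => (pF x).2).
apply: le_trans (normc_le_ReIm _) _; rewrite ReD ReN ImD ImN cE dE !normrM.
rewrite (ger0_norm (_ : 0 <= b - a)) ?subr_ge0// -mulrDl.
rewrite ler_wpM2r ?subr_ge0// mulr_natl mulr2n lerD//.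
  exact: le_trans (ler_normc_Re _) (fM _ _).
exact: le_trans (ler_normc_Im _) (fM _ _).
Qed.

Lemma primitive_ext F f g : f =1 g -> primitive F f -> primitive F g.
Proof. by move=> fg pF x; rewrite -fg. Qed.

Lemma primitiveD F f G g : primitive F f -> primitive G g ->
  primitive (fun x => F x + G x) (fun x => f x + g x).
Proof.
move=> pF pG x; have [F1 F2] := pF x; have [G1 G2] := pG x.
split.
  rewrite [X in is_derive _ _ X](_ : _ = (fun t => Re (F t)) + (fun t => Re (G t))).
    by rewrite ReD; exact: is_deriveD.
  by apply/funext => t; rewrite ReD.
rewrite [X in is_derive _ _ X](_ : _ = (fun t => Im (F t)) + (fun t => Im (G t))).
  by rewrite ImD; exact: is_deriveD.
by apply/funext => t; rewrite ImD.
Qed.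

Lemma primitiveZ c F f : primitive F f ->
  primitive (fun x => c * F x) (fun x => c * f x).
Proof.
move=> pF x; have [F1 F2] := pF x; case: c => a b.
split.
  rewrite [X in is_derive _ _ X](_ : _ = (a \*: (fun t => Re (F t))) - (b \*: (fun t => Im (F t)))).
    by rewrite ReM; apply: is_deriveB; exact: is_deriveZ.
  by apply/funext => t; rewrite ReM.
rewrite [X in is_derive _ _ X](_ : _ = (a \*: (fun t => Im (F t))) + (b \*: (fun t => Re (F t)))).
  by rewrite ImM; apply: is_deriveD; exact: is_deriveZ.
by apply/funext => t; rewrite ImM.
Qed.

Lemma primitiveB F f G g : primitive F f -> primitive G g ->
  primitive (fun x => F x - G x) (fun x => f x - g x).
Proof.
move=> pF /(primitiveZ (-1)) pG; have := primitiveD pF pG.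
by under eq_fun do rewrite mulN1r; under [X in primitive _ X]eq_fun do rewrite mulN1r.
Qed.

Lemma primitive_shift F f s : primitive F f ->
  primitive (fun x => F (x + s)) (fun x => f (x + s)).
Proof.
move=> pF x; have [F1 F2] := pF (x + s).
have ds : is_derive x 1 (fun t : R => t + s) 1.
  by rewrite -[X in is_derive _ _ _ X]addr0; apply: is_deriveD.
split.
  by rewrite -[X in is_derive _ _ _ X]mulr1;
    exact: (@is_derive1_comp _ (fun t => Re (F t)) (fun t => t + s)).
by rewrite -[X in is_derive _ _ _ X]mulr1;
  exact: (@is_derive1_comp _ (fun t => Im (F t)) (fun t => t + s)).
Qed.

Lemma primitive0 F : primitive F (fun=> 0) -> forall a b, F a = F b.
Proof.
move=> pF a b; apply/eqP; rewrite eq_complex; apply/andP; split; apply/eqP.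
  exact: (@is_derive_0_is_cst _ (fun t => Re (F t)) a b (fun x => (pF x).1)).
exact: (@is_derive_0_is_cst _ (fun t => Im (F t)) a b (fun x => (pF x).2)).
Qed.

Lemma primitive_increment F G f a b : primitive F f -> primitive G f ->
  F b - F a = G b - G a.
Proof.
move=> pF pG; have /primitive0/(_ a b) : primitive (fun x => F x - G x) (fun=> 0).
  by have := primitiveB pF pG; under [X in primitive _ X]eq_fun do rewrite subrr.
move=> E; rewrite -[F b](subrK (G b)) -E; ring.
Qed.

Lemma primitive_cst c : primitive (fun x => c * x%:C%C) (fun=> c).
Proof.
rewrite -[X in primitive _ X](_ : (fun=> c * 1) = _); last first.
  by apply/funext => x; rewrite mulr1.
apply: primitiveZ => x; split => /=; [exact: is_derive_id|exact: is_derive_cst].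
Qed.

Lemma primitive_lin c : primitive (fun x => c * (x ^+ 2 / 2)%:C%C) (fun x => c * x%:C%C).
Proof.
apply: primitiveZ => x; split => /=; last exact: is_derive_cst.
have d := @is_deriveZ _ _ _ (id * id : R -> R) 2^-1 x 1 _
  (is_deriveM (is_derive_id x 1) (is_derive_id x 1)).
rewrite (_ : (fun t => t ^+ 2 / 2) = 2^-1 \*: (id * id : R -> R)); last first.
  by apply/funext => t; rewrite /= expr2 mulrC.
have E : 2^-1 * (x * 1 + x * 1) = x by field.
exact: is_derive_eq d E.
Qed.

Lemma continuousC_bounded f a b : continuousC f ->
  exists2 M, 0 <= M & forall x, a <= x <= b -> N (f x) <= M.
Proof.
move=> cf; have [ab|ba] := lerP a b; last first.
  by exists 0 => // x /andP[ax xb]; have := le_lt_trans (le_trans ax xb) ba; rewrite ltxx.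
have cN : continuous (fun x => N (f x)).
  move=> x; apply/cvgrPdist_le => e e0; have [d d0 fd] := cf x e e0.
  near=> y; have yx : `|y - x| < d.
    by rewrite distrC; near: y; exact: (@nbhsx_ballx _ _ x (PosNum d0)%:num).
  have := fd y yx; have := normc_sub (f x) (f y); have := normc_sub (f y) (f x).
  by rewrite (normcB (f x)) ler_norml => *; lra.
have [c _ fc] := EVT_max ab (continuous_subspaceT cN).
by exists (N (f c)) => [|x xab]; [exact: normc_ge0|apply: fc; rewrite in_itv].
Unshelve. all: by end_near.
Qed.

End Primitive.

(** * Goursat's lemma on rectangles *)

Section Goursat.
Variable R : realType.
Local Notation C := R[i].
Local Notation N := (@Normc.normc R).
Local Notation Re := (@complex.Re R).
Local Notation Im := (@complex.Im R).

Lemma nested_halving_point (a : nat -> R) (s : R) : 0 <= s ->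
  (forall n, a n <= a n.+1 <= a n + s / 2 ^+ n.+1) ->
  exists p, forall n, a n <= p <= a n + s / 2 ^+ n.
Proof.
move=> s0 ha.
have half n : s / 2 ^+ n = s / 2 ^+ n.+1 + s / 2 ^+ n.+1.
  by rewrite exprS; field; rewrite expf_neq0.
have up n k : a n <= a (n + k)%N /\ a (n + k)%N + s / 2 ^+ (n + k) <= a n + s / 2 ^+ n.
  elim: k => [|k [IH1 IH2]]; first by rewrite addn0.
  have /andP[h1 h2] := ha (n + k)%N.
  by rewrite addnS; split; move: (half (n + k)%N); lra.
have pos n : 0 <= s / 2 ^+ n by rewrite divr_ge0// exprn_ge0.
have bnd m n : a m <= a n + s / 2 ^+ n.
  have [mn|/ltnW nm] := leqP m n.
    have [h _] := up m (n - m)%N; move: h; rewrite subnKC// => h.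
    by have := pos n; lra.
  have [_ h] := up n (m - n)%N; move: h; rewrite subnKC// => h.
  by have := pos m; lra.
have nonempty : range a !=set0 by exists (a 0%N), 0%N.
exists (sup (range a)) => n; apply/andP; split.
  apply: ub_le_sup; last by exists n.
  by exists (a 0%N + s / 2 ^+ 0) => _ [m _ <-]; exact: bnd.
by apply: ge_sup => // _ [m _ <-]; exact: bnd.
Qed.

Lemma dist_in_segment (a s p x : R) :
  a <= p <= a + s -> a <= x <= a + s -> `|x - p| <= s.
Proof. by move=> hp hx; rewrite ler_norml; apply/andP; split; lra. Qed.

(** The integral over the boundary of a rectangle, for a family [P y] of
    primitives along horizontal lines and [Q x] along vertical ones. *)
Definition rect_int (P Q : R -> R -> C) (x1 x2 y1 y2 : R) : C :=
  (P y1 x2 - P y1 x1) + 'i%C * (Q x2 y2 - Q x2 y1)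
  - (P y2 x2 - P y2 x1) - 'i%C * (Q x1 y2 - Q x1 y1).

Lemma rect_int_split P Q x1 x2 y1 y2 x y :
  rect_int P Q x1 x2 y1 y2 =
  rect_int P Q x1 x y1 y + rect_int P Q x x2 y1 y +
  (rect_int P Q x1 x y y2 + rect_int P Q x x2 y y2).
Proof. by rewrite /rect_int; ring. Qed.

Lemma normc_i (z : C) : N ('i%C * z) = N z.
Proof. by rewrite Normc.normcM /= expr0n expr1n add0r sqrtr1 mul1r. Qed.

(** Affine functions have explicit primitives and their boundary integrals
    vanish, so that only the deviation from the first-order expansion counts. *)
Lemma rect_int_le_affine (f : R -> R -> C) P Q x1 x2 y1 y2 (u c : C) (e : R) :
  x1 <= x2 -> y1 <= y2 ->
  (forall y, primitive (P y) (fun x => f x y)) ->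
  (forall x, primitive (Q x) (fun y => f x y)) ->
  (forall x y, x1 <= x <= x2 -> y1 <= y <= y2 ->
    N (f x y - (u + c * (x +i* y)%C)) <= e) ->
  N (rect_int P Q x1 x2 y1 y2) <= 4 * e * ((x2 - x1) + (y2 - y1)).
Proof.
move=> x12 y12 pP pQ fe.
have xyE (x y : R) : (x +i* y)%C = x%:C%C + 'i%C * y%:C%C.
  by apply/eqP; rewrite eq_complex /= !mul0r !mul1r !subr0 !addr0 !add0r !eqxx.
pose PA (y x : R) : C := u * x%:C%C + c * (x ^+ 2 / 2)%:C%C + c * 'i%C * y%:C%C * x%:C%C.
pose QA (x y : R) : C := u * y%:C%C + c * x%:C%C * y%:C%C + c * 'i%C * (y ^+ 2 / 2)%:C%C.
have pPA y : primitive (PA y) (fun x => u + c * (x +i* y)%C).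
  apply: primitive_ext (primitiveD (primitiveD (primitive_cst u) (primitive_lin c)) (primitive_cst _)).
  by move=> x; rewrite xyE; ring.
have pQA x : primitive (QA x) (fun y => u + c * (x +i* y)%C).
  apply: primitive_ext (primitiveD (primitiveD (primitive_cst u) (primitive_cst _)) (primitive_lin _)).
  by move=> y; rewrite xyE; ring.
have JA : rect_int PA QA x1 x2 y1 y2 = 0 by rewrite /rect_int /PA /QA; ring.
have bP y : y1 <= y <= y2 ->
    N ((P y x2 - PA y x2) - (P y x1 - PA y x1)) <= 2 * e * (x2 - x1).
  move=> yy; have pB := primitiveB (pP y) (pPA y).
  by apply: (primitive_le x12 pB) => x xx; exact: fe.
have bQ x : x1 <= x <= x2 ->
    N ((Q x y2 - QA x y2) - (Q x y1 - QA x y1)) <= 2 * e * (y2 - y1).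
  move=> xx; have pB := primitiveB (pQ x) (pQA x).
  by apply: (primitive_le y12 pB) => y yy; exact: fe.
have -> : rect_int P Q x1 x2 y1 y2 =
    ((P y1 x2 - PA y1 x2) - (P y1 x1 - PA y1 x1))
    + 'i%C * ((Q x2 y2 - QA x2 y2) - (Q x2 y1 - QA x2 y1))
    - ((P y2 x2 - PA y2 x2) - (P y2 x1 - PA y2 x1))
    - 'i%C * ((Q x1 y2 - QA x1 y2) - (Q x1 y1 - QA x1 y1)).
  rewrite -[LHS]subr0 -JA /rect_int; ring.
apply: le_trans (normcBD _ _) _.
apply: le_trans (lerD (normcBD _ _) (lexx _)) _.
apply: le_trans (lerD (lerD (normcD _ _) (lexx _)) (lexx _)) _.
rewrite !normc_i.
have := bP y1; have := bP y2; have := bQ x1; have := bQ x2.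
rewrite !lexx x12 y12 /= => /(_ isT) h1 /(_ isT) h2 /(_ isT) h3 /(_ isT) h4.
lra.
Qed.

(** Bisection: one of the four quarters of a rectangle carries at least a quarter
    of the boundary integral, whereas near the limit point of the bisection the
    deviation from the first-order expansion is small compared to the side, so
    that the integral is small compared to the square of the side. *)
Lemma goursat (f : R -> R -> C) P Q x1 x2 y1 y2 :
  x1 <= x2 -> y1 <= y2 ->
  (forall y, primitive (P y) (fun x => f x y)) ->
  (forall x, primitive (Q x) (fun y => f x y)) ->
  (forall x y, x1 <= x <= x2 -> y1 <= y <= y2 -> exists c : C,
    forall e, 0 < e -> exists2 d, 0 < d & forall x' y',
      x1 <= x' <= x2 -> y1 <= y' <= y2 -> `|x' - x| < d -> `|y' - y| < d ->
      N (f x' y' - f x y - c * ((x' - x) +i* (y' - y))%C)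
        <= e * (`|x' - x| + `|y' - y|)) ->
  rect_int P Q x1 x2 y1 y2 = 0.
Proof.
move=> x12 y12 pP pQ df.
set J := rect_int P Q; set s := x2 - x1; set t := y2 - y1.
have s0 : 0 <= s by rewrite subr_ge0.
have t0 : 0 <= t by rewrite subr_ge0.
pose S (n : nat) (z : R * R) := J z.1 (z.1 + s / 2 ^+ n) z.2 (z.2 + t / 2 ^+ n).
pose K := N (J x1 x2 y1 y2).
pose bad (n : nat) (z : R * R) := K / 4 ^+ n <= N (S n z).
pose sub (n : nat) (z z' : R * R) :=
  (z.1 <= z'.1 <= z.1 + s / 2 ^+ n.+1) /\ (z.2 <= z'.2 <= z.2 + t / 2 ^+ n.+1).
have half u n : u / 2 ^+ n = u / 2 ^+ n.+1 + u / 2 ^+ n.+1 :> R.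
  by rewrite exprS; field; rewrite expf_neq0.
have step n z : bad n z -> exists z', sub n z z' /\ bad n.+1 z'.
  move=> bz; set s' := s / 2 ^+ n.+1; set t' := t / 2 ^+ n.+1.
  have s'0 : 0 <= s' by rewrite divr_ge0// exprn_ge0.
  have t'0 : 0 <= t' by rewrite divr_ge0// exprn_ge0.
  apply: contrapT => nz.
  have good (a b : R) : sub n z (a, b) ->
      N (J a (a + s') b (b + t')) < K / 4 ^+ n.+1.
    move=> ab; rewrite ltNge; apply/negP => h; apply: nz.
    by exists (a, b).
  have split4 a b : J a (a + (s' + s')) b (b + (t' + t')) =
      (J a (a + s') b (b + t') + J (a + s') (a + s' + s') b (b + t')) +
      (J a (a + s') (b + t') (b + t' + t') +
        J (a + s') (a + s' + s') (b + t') (b + t' + t')).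
    by rewrite [a + (_ + _)]addrA [b + (_ + _)]addrA; exact: rect_int_split.
  have := bz; rewrite /bad /S (half s n) (half t n) -/s' -/t' split4 leNgt.
  move=> /negP; apply.
  apply: le_lt_trans (normcD _ _) _.
  apply: le_lt_trans (lerD (normcD _ _) (normcD _ _)) _.
  have g1 := good z.1 z.2; have g2 := good (z.1 + s') z.2.
  have g3 := good z.1 (z.2 + t'); have g4 := good (z.1 + s') (z.2 + t').
  have -> : K / 4 ^+ n = (K / 4 ^+ n.+1 + K / 4 ^+ n.+1) +
      (K / 4 ^+ n.+1 + K / 4 ^+ n.+1).
    by rewrite exprS; field; rewrite expf_neq0.
  by apply: ltrD; apply: ltrD;
    [apply: g1|apply: g2|apply: g3|apply: g4]; rewrite /sub /= -/s' -/t'; clear -s'0 t'0; split; lra.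

pose nxt n z := xget z [set z' | sub n z z' /\ bad n.+1 z'].
pose z := fix z n := if n is m.+1 then nxt m (z m) else (x1, y1).
have zbad n : bad n (z n).
  elim: n => [|n IHn].
    by rewrite /bad /S /K /= expr0 !divr1 /s /t !subrKC.
  have [z' hz'] := step _ _ IHn.
  by have [] : [set z' | sub n (z n) z' /\ bad n.+1 z'] (z n.+1) by apply: xgetI hz'.
have zsub n : sub n (z n) (z n.+1).
  have [z' hz'] := step _ _ (zbad n).
  by have [] : [set z' | sub n (z n) z' /\ bad n.+1 z'] (z n.+1) by apply: xgetI hz'.
have [p hp] := @nested_halving_point (fun n => (z n).1) s s0 (fun n => (zsub n).1).
have [q hq] := @nested_halving_point (fun n => (z n).2) t t0 (fun n => (zsub n).2).
have z_in n : (x1 <= (z n).1 /\ (z n).1 + s / 2 ^+ n <= x2) /\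
    (y1 <= (z n).2 /\ (z n).2 + t / 2 ^+ n <= y2).
  elim: n => [|n [[h1 h2] [h3 h4]]]; first by rewrite /= !divr1 /s /t !subrKC !lexx.
  have [/andP[h5 h6] /andP[h7 h8]] := zsub n.
  by move: (half s n) (half t n) => hs ht; clear -h1 h2 h3 h4 h5 h6 h7 h8 hs ht; split; split; lra.
have px : x1 <= p <= x2 by have := hp 0%N; rewrite /= divr1 /s subrKC.
have qy : y1 <= q <= y2 by have := hq 0%N; rewrite /= divr1 /t subrKC.
have [c hc] := df p q px qy.
suff K0 : K = 0 by apply/eqP; rewrite -normc_eq0; apply/eqP.
apply/eqP; rewrite eq_le normc_ge0 andbT.
apply/ler_addgt0Pr => e' e'0; rewrite add0r.
pose L := 4 * (s + t) ^+ 2 + 1.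
have L0 : 0 < L by rewrite ltr_wpDl// mulr_ge0// sqr_ge0.
have [d d0 hd] := hc (e' / L) (divr_gt0 e'0 L0).
have [n [sn tn]] : exists n, s / 2 ^+ n < d /\ t / 2 ^+ n < d.
  have [n hn] : exists n : nat, (s + t) / d < n%:R.
    by exists (Num.truncn ((s + t) / d)).+1; exact: truncnS_gt.
  have n2 : n%:R <= 2 ^+ n :> R by rewrite -natrX ler_nat; exact/ltnW/ltn_expl.
  have p2 : 0 < 2 ^+ n :> R by rewrite exprn_gt0.
  have : (s + t) / d < 2 ^+ n by exact: lt_le_trans hn n2.
  rewrite ltr_pdivrMr// => h; exists n.
  by rewrite !ltr_pdivrMr// [d * _]mulrC; clear -h s0 t0; split; lra.
have p2 : 0 < 2 ^+ n :> R by rewrite exprn_gt0.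
have [[h1 h2] [h3 h4]] := z_in n.
have hpn := hp n; have hqn := hq n.
set s' := s / 2 ^+ n in sn h2 hpn *; set t' := t / 2 ^+ n in tn h4 hqn *.
have s'0 : 0 <= s' by rewrite divr_ge0// ltW.
have t'0 : 0 <= t' by rewrite divr_ge0// ltW.
have := @rect_int_le_affine f P Q (z n).1 ((z n).1 + s') (z n).2 ((z n).2 + t')
  (f p q - c * (p +i* q)%C) c (e' / L * (s' + t')).
rewrite !lerDl => /(_ s'0 t'0 pP pQ) hJ.
have {}hJ : N (S n (z n)) <= 4 * (e' / L * (s' + t')) * (s' + t').
  have sK (a b : R) : a + b - a = b by rewrite addrC addKr.
  apply: le_trans (hJ _) _; last by rewrite !sK.
  move=> x y xx yy.
  have ax : `|x - p| <= s' by exact: (dist_in_segment hpn xx).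
  have ay : `|y - q| <= t' by exact: (dist_in_segment hqn yy).
  have -> : f x y - (f p q - c * (p +i* q)%C + c * (x +i* y)%C) =
      f x y - f p q - c * ((x - p) +i* (y - q))%C.
    have -> : ((x - p) +i* (y - q))%C = (x +i* y)%C - (p +i* q)%C by [].
    by ring.
  apply: le_trans (hd _ _ _ _ _ _) _.
  - by clear -xx h1 h2; lra.
  - by clear -yy h3 h4; lra.
  - exact: le_lt_trans ax sn.
  - exact: le_lt_trans ay tn.
  by rewrite ler_wpM2l ?lerD // ltW ?divr_gt0.
have := le_trans (zbad n) hJ.
have -> : 4 * (e' / L * (s' + t')) * (s' + t') = 4 * e' * (s + t) ^+ 2 / L / 4 ^+ n.
  rewrite /s' /t' (_ : 4 = 2 * 2 :> R); last by rewrite -natrM.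
  by rewrite exprMn; field; rewrite !gt_eqF.
rewrite ler_pM2r ?invr_gt0 ?exprn_gt0// => KL; apply: le_trans KL _.
by rewrite ler_pdivrMr// [4 * e']mulrC -mulrA ler_pM2l// /L lerDl.
Qed.

End Goursat.

(** * Means of periodic holomorphic functions *)

Section Holomorphic.
Variable R : realType.
Local Notation C := R[i].
Local Notation N := (@Normc.normc R).
Local Notation Re := (@complex.Re R).
Local Notation Im := (@complex.Im R).

Definition holo (f : C -> C) (p : C) := derivable (f : C^o -> C^o) p 1.

Lemma nbhs_normcP (p : C) (A : set C) : nbhs (p : C^o) A <->
  exists2 d, 0 < d & forall w, N (w - p) < d -> A w.
Proof.
split=> [/nbhs_ballP[d d0 dA]|[d d0 dA]].
  have [r dr] : exists r, d = r%:C%C by apply/complex_realP; exact: gtr0_real.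
  subst d; exists r => [|w wp]; first by rewrite -ltcR.
  by apply: dA; rewrite /ball /= /ball_ normC_normc ltcR normcB.
apply/nbhs_ballP; exists (d%:C%C); first by rewrite /= ltcR.
by move=> w; rewrite /ball /= /ball_ normC_normc ltcR normcB; exact: dA.
Qed.

Lemma dnbhs_normcP (p : C) (A : set C) : (p : C^o)^' A <->
  exists2 d, 0 < d & forall w, 0 < N (w - p) < d -> A w.
Proof.
rewrite /dnbhs /within /=; split=> [/nbhs_normcP[d d0 dA]|[d d0 dA]].
  exists d => // w /andP[wp wd]; apply: dA => //.
  by move: wp; rewrite normc_gt0 subr_eq0.
apply/nbhs_normcP; exists d => // w wd wp; apply: dA.
by rewrite wd andbT normc_gt0 subr_eq0.
Qed.

Lemma cvg_normcP (T : Type) (F : set_system T) (FF : Filter F) (f : T -> C) (l : C) :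
  (f : T -> C^o) @ F --> (l : C^o) <-> forall e, 0 < e -> \forall t \near F, N (f t - l) <= e.
Proof.
split=> [fl e e0|fl].
  move/cvgrPdist_le : fl => /(_ (e%:C%C)); rewrite ltcR => /(_ e0).
  by apply: filterS => t; rewrite normC_normc normcB lecR.
apply/cvgrPdist_le => e e0.
have [r er] : exists r, e = r%:C%C by apply/complex_realP; exact: gtr0_real.
subst e; have := fl r; rewrite -ltcR => /(_ e0).
by apply: filterS => t; rewrite normC_normc normcB lecR.
Qed.

(** Estimates use differentiability only through this first-order expansion;
    the next lemma is the converse. *)
Lemma holo_expansion f p : holo f p -> exists c, forall e, 0 < e ->
  exists2 d, 0 < d & forall w, N (w - p) < d ->
    N (f w - f p - c * (w - p)) <= e * N (w - p).
Proof.
move=> df; exists (derive (f : C^o -> C^o) p 1) => e e0.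
set c := derive _ _ _.
have /cvg_normcP/(_ e e0)/dnbhs_normcP[d d0 hd] :
    (fun h : C => h^-1 *: ((f (h *: (1 : C^o) + p) : C^o) - f p) : C^o) @ (0 : C^o)^' --> (c : C^o).
  exact: df.
exists d => // w wd; have [->|wp] := eqVneq w p.
  by rewrite !subrr mulr0 subrr Normc.normc0 mulr0.
have wp0 : w - p != 0 by rewrite subr_eq0.
have := hd (w - p); rewrite subr0 normc_gt0 wp0 wd => /(_ isT).
rewrite /GRing.scale /= mulr1 subrK.
have -> : f w - f p - c * (w - p) = (w - p) * ((w - p)^-1 * (f w - f p) - c).
  by rewrite [RHS]mulrBr mulVKf// [c * _]mulrC.
by rewrite Normc.normcM => h; rewrite mulrC ler_wpM2r ?normc_ge0.
Qed.

Lemma holo_of_expansion f p c : (forall e, 0 < e ->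
  exists2 d, 0 < d & forall w, N (w - p) < d ->
    N (f w - f p - c * (w - p)) <= e * N (w - p)) ->
  is_derive (p : C^o) 1 (f : C^o -> C^o) c.
Proof.
move=> hf.
have fc : (fun h : C => h^-1 *: ((f (h *: (1 : C^o) + p) : C^o) - f p) : C^o) @ (0 : C^o)^' --> (c : C^o).
  apply/cvg_normcP => e e0; have [d d0 hd] := hf e e0.
  apply/dnbhs_normcP; exists d => // w; rewrite subr0 => /andP[w0 wd].
  have wn0 : w != 0 by rewrite -normc_gt0.
  have := hd (w + p); rewrite addrK => /(_ wd).
  rewrite /GRing.scale /= mulr1 => h; rewrite -(ler_pM2r w0) -Normc.normcM.
  by rewrite mulrBl mulrAC mulVf// mul1r.
apply: DeriveDef; first by apply/cvg_ex; exists c.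
exact: cvg_lim fc.
Qed.

Definition continuousCC (f : C -> C) (p : C) := forall e, 0 < e ->
  exists2 d, 0 < d & forall w, N (w - p) < d -> N (f w - f p) <= e.

Lemma continuousCCP f p : {for p, continuous (f : C^o -> C^o)} <-> continuousCC f p.
Proof.
split=> [fp e e0|fp].
  apply: (nbhs_normcP p _).1.
  exact: ((@cvg_normcP _ (nbhs (p : C^o)) _ f (f p)).1 fp e e0).
apply: (@cvg_normcP _ (nbhs (p : C^o)) _ f (f p)).2 => e e0.
exact: (nbhs_normcP p _).2 (fp e e0).
Qed.

Lemma holo_continuous f p : holo f p -> continuousCC f p.
Proof.
by move=> /derivable1_diffP/differentiable_continuous/continuousCCP.
Qed.

Lemma holo_cst c p : holo (fun=> c) p. Proof. exact: derivable_cst. Qed.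
Lemma holo_id p : holo id p. Proof. exact: derivable_id. Qed.
Lemma holoD f g p : holo f p -> holo g p -> holo (fun w => f w + g w) p.
Proof. exact: derivableD. Qed.
Lemma holoB f g p : holo f p -> holo g p -> holo (fun w => f w - g w) p.
Proof. exact: derivableB. Qed.
Lemma holoM f g p : holo f p -> holo g p -> holo (fun w => f w * g w) p.
Proof. exact: derivableM. Qed.
Lemma holoV f p : f p != 0 -> holo f p -> holo (fun w => (f w)^-1) p.
Proof. exact: derivableV. Qed.
Lemma holo_comp f g p : holo g p -> holo f (g p) -> holo (fun w => f (g w)) p.
Proof.
move=> /derivable1_diffP dg /derivable1_diffP df; apply/derivable1_diffP.
exact: (differentiable_comp dg df).
Qed.

Lemma holo_near_eq f g p d : 0 < d ->
  (forall w, N (w - p) < d -> f w = g w) -> holo f p -> holo g p.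
Proof.
move=> d0 fg; apply: near_eq_derivable; apply/nbhs_normcP; exists d => // w.

Qed.

End Holomorphic.
Arguments holo_cst {R} c p.
Arguments holo_id {R} p.

Section Mean.
Variable R : realType.
Local Notation C := R[i].
Local Notation N := (@Normc.normc R).
Local Notation Re := (@complex.Re R).
Local Notation Im := (@complex.Im R).

(** The integral over a period is taken to be the increment of a primitive, which
    exists for every continuous function. *)
Definition mean (f : R -> C) : C :=
  let F := xget (fun=> 0) [set F | primitive F f] in F 1 - F 0.

Lemma mean_primitive f F : primitive F f -> mean f = F 1 - F 0.
Proof.
move=> pF; apply: (@primitive_increment _ _ _ f) => //.
exact: (@xgetPex _ _ [set F | primitive F f] (ex_intro _ F pF)).
Qed.

Lemma mean_le f M : continuousC f -> (forall x, 0 <= x <= 1 -> N (f x) <= M) ->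
  N (mean f) <= 2 * M.
Proof.
move=> /primitive_exists[F pF] fM; rewrite (mean_primitive pF).
by have := primitive_le (@ler01 R) pF fM; rewrite subr0 mulr1.
Qed.

Lemma meanB f g : continuousC f -> continuousC g ->
  mean (fun x => f x - g x) = mean f - mean g.
Proof.
move=> /primitive_exists[F pF] /primitive_exists[G pG].
rewrite (mean_primitive (primitiveB pF pG)) (mean_primitive pF) (mean_primitive pG).
by ring.
Qed.

Lemma meanD f g : continuousC f -> continuousC g ->
  mean (fun x => f x + g x) = mean f + mean g.
Proof.
move=> /primitive_exists[F pF] /primitive_exists[G pG].
rewrite (mean_primitive (primitiveD pF pG)) (mean_primitive pF) (mean_primitive pG).
by ring.
Qed.

Lemma meanZ c f : continuousC f -> mean (fun x => c * f x) = c * mean f.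
Proof.
move=> /primitive_exists[F pF].
by rewrite (mean_primitive (primitiveZ c pF)) (mean_primitive pF) mulrBr.
Qed.

Lemma mean_cst c : mean (fun=> c) = c.
Proof. by rewrite (mean_primitive (primitive_cst c)) mulr1 mulr0 subr0. Qed.

Lemma mean_shift f s : continuousC f -> (forall x, f (x + 1) = f x) ->
  mean (fun x => f (x + s)) = mean f.
Proof.
move=> /primitive_exists[F pF] per.
rewrite (mean_primitive (primitive_shift s pF)) (mean_primitive pF) add0r [1 + s]addrC.
have p0 : primitive (fun x => F (x + 1) - F x) (fun=> 0).
  apply: primitive_ext (primitiveB (primitive_shift 1 pF) pF) => x.
  by rewrite per subrr.
by have E := primitive0 p0 s 0; rewrite E add0r.
Qed.

End Mean.

Section Strip.
Variable R : realType.
Local Notation C := R[i].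
Local Notation N := (@Normc.normc R).
Local Notation Re := (@complex.Re R).
Local Notation Im := (@complex.Im R).

Lemma max_lip (a b c : R) : `|Num.max a b - Num.max a c| <= `|b - c|.
Proof.
by case: (leP a b) => ab; case: (leP a c) => ac; rewrite ?subrr ?normr0// ler_norml;
  have := ler_norm (b - c); have := ler_norm (- (b - c)); rewrite normrN => *;
  apply/andP; split; lra.
Qed.

Lemma min_lip (a b c : R) : `|Num.min a c - Num.min b c| <= `|a - b|.
Proof.
by case: (leP a c) => ac; case: (leP b c) => bc; rewrite ?subrr ?normr0// ler_norml;
  have := ler_norm (a - b); have := ler_norm (- (a - b)); rewrite normrN => *;
  apply/andP; split; lra.
Qed.

Definition hline (G : C -> C) (y : R) : R -> C := fun x => G (x +i* y)%C.

Lemma hline_continuous G y :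
  (forall x, continuousCC G (x +i* y)%C) -> continuousC (hline G y).
Proof.
move=> cG x e e0; have [d d0 hd] := cG x e e0; exists d => // x' xx'.
apply: hd; rewrite (_ : _ - _ = (x' - x)%:C%C) ?normc_real//.
by apply/eqP; rewrite eq_complex /= subrr !eqxx.
Qed.

(** Goursat on a rectangle one period wide: the vertical sides cancel. *)
Lemma mean_hline_const G y1 y2 : y1 <= y2 ->
  (forall w, y1 <= Im w <= y2 -> holo G w) ->
  (forall w, y1 <= Im w <= y2 -> G (w + 1) = G w) ->
  mean (hline G y1) = mean (hline G y2).
Proof.
move=> y12 hG per.
(* clamping the ordinate makes the integrands continuous on the whole plane *)
pose cl (y : R) := Num.max y1 (Num.min y y2).
have cl_in y : y1 <= cl y <= y2.
  by rewrite /cl le_max lexx /= ge_max y12 ge_min lexx orbT.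
have cl_id y : y1 <= y <= y2 -> cl y = y.
  by move=> /andP[h1 h2]; rewrite /cl (min_idPl h2) (max_idPr h1).
have cl_lip y y' : `|cl y' - cl y| <= `|y' - y|.
  exact: le_trans (max_lip _ _ _) (min_lip _ _ _).
pose f (x y : R) := G (x +i* cl y)%C.
have cG (w : C) : y1 <= Im w <= y2 -> continuousCC G w.
  by move=> /hG; exact: holo_continuous.
have cfx y : continuousC (fun x => f x y).
  by apply: hline_continuous => x; apply: cG; exact: cl_in.
have cfy x : continuousC (fun y => f x y).
  move=> y e e0; have [d d0 hd] := cG (x +i* cl y)%C (cl_in y) e e0.
  exists d => // y' yy'; apply: hd.
  apply: le_lt_trans (normc_le_ReIm _) _; rewrite /= subrr normr0 add0r.
  exact: le_lt_trans (cl_lip _ _) yy'.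
pose P y := sval (cid (primitive_exists (cfx y))).
pose Q x := sval (cid (primitive_exists (cfy x))).
have pP y : primitive (P y) (fun x => f x y) by exact: (svalP (cid (primitive_exists (cfx y)))).
have pQ x : primitive (Q x) (fun y => f x y) by exact: (svalP (cid (primitive_exists (cfy x)))).
have := @goursat R f P Q 0 1 y1 y2 ler01 y12 pP pQ.
have Qe : Q 1 y2 - Q 1 y1 = Q 0 y2 - Q 0 y1.
  apply: (primitive_increment _ _ (pQ 1)).
  apply: primitive_ext (pQ 0) => y; rewrite /f -per//=.
  by congr G; apply/eqP; rewrite eq_complex /= add0r addr0 !eqxx.
have Pe y : y1 <= y <= y2 -> mean (hline G y) = P y 1 - P y 0.
  by move=> yy; apply: mean_primitive; apply: primitive_ext (pP y) => x; rewrite /f cl_id.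
rewrite /rect_int Qe -!Pe ?lexx ?y12// => E.
apply/eqP; rewrite -subr_eq0; apply/eqP; rewrite -E; first by ring.
move=> x y _ yy; have [c hc] := holo_expansion (hG (x +i* y)%C yy).
exists c => e e0; have [d d0 hd] := hc e e0; exists (d / 2); first by rewrite divr_gt0.
move=> x' y' _ yy' dx dy; rewrite /f !cl_id//.
have nle : N ((x' - x) +i* (y' - y))%C <= `|x' - x| + `|y' - y|.
  exact: (normc_le_ReIm ((x' - x) +i* (y' - y))%C).
apply: le_trans (hd (x' +i* y')%C _) _; last by rewrite ler_wpM2l// ltW.
apply: le_lt_trans nle _; clear -dx dy; lra.
Qed.

(** Uniformity in the abscissa comes from compactness of a period. *)
Lemma mean_hline_continuous G y0 Y1 Y2 : Y1 < y0 < Y2 ->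
  (forall w, Y1 < Im w < Y2 -> continuousCC G w) ->
  forall e, 0 < e -> exists2 d, 0 < d & forall y, Y1 < y < Y2 -> `|y - y0| < d ->
    N (mean (hline G y) - mean (hline G y0)) <= e.
Proof.
move=> y0Y cG e e0.
have [d d0 hd] : exists2 d, 0 < d & forall y, `|y - y0| < d ->
    forall x, 0 <= x <= 1 -> N (G (x +i* y)%C - G (x +i* y0)%C) <= e / 2.
  pose P y x := N (G (x +i* y)%C - G (x +i* y0)%C) <= e / 2.
  have cov : forall x : R, `[0, 1]%classic x -> \near x & y0, P y0 x.
    move=> x _; have [d d0 hd] := cG (x +i* y0)%C y0Y _ (divr_gt0 e0 (ltr0n R 4)).
    exists (ball x (d / 2), ball y0 (d / 2)).
      by split; apply: nbhsx_ballx; rewrite divr_gt0.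
    move=> [x' y'] [/= xx' yy'] /=.
    have h1 : N (G (x' +i* y')%C - G (x +i* y0)%C) <= e / 4.
      apply: hd; apply: le_lt_trans (normc_le_ReIm _) _ => /=.
      by move: xx' yy'; rewrite /ball /= distrC [X in _ -> X < _ -> _]distrC; clear; lra.
    have h2 : N (G (x' +i* y0)%C - G (x +i* y0)%C) <= e / 4.
      apply: hd; apply: le_lt_trans (normc_le_ReIm _) _ => /=.
      move: xx'; rewrite /ball /= distrC subrr normr0 addr0 => h; apply: lt_trans h _.
      by clear -d0; lra.
    have := normcBD (G (x' +i* y')%C - G (x +i* y0)%C) (G (x' +i* y0)%C - G (x +i* y0)%C).
    rewrite opprB addrA subrK /P; clear -h1 h2; lra.
  have H := (compact_near_coveringP _).1 (@segment_compact R 0 1) R (nbhs y0) P _ cov.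
  have [d /= d0 hd] := (nbhs_ballP _ _).1 (H _).
  exists d => // y yd x x01.
  by apply: (hd y); rewrite ?/ball /= ?/ball_ 1?distrC ?in_itv.
exists d => // y yY yd.
have c1 : continuousC (hline G y) by apply: hline_continuous => x; exact: cG.
have c2 : continuousC (hline G y0) by apply: hline_continuous => x; exact: cG.
rewrite -meanB//.
rewrite (_ : e = 2 * (e / 2)); last by rewrite mulrC divfK.
apply: mean_le; last by move=> x x01; exact: hd.
move=> x t t0; have [d1 d10 h1] := c1 x _ (divr_gt0 t0 (ltr0n R 2)).
have [d2 d20 h2] := c2 x _ (divr_gt0 t0 (ltr0n R 2)).
exists (Num.min d1 d2) => [|x']; first by rewrite lt_min d10.
rewrite lt_min => /andP[/h1 {}h1 /h2 {}h2].
have := normcBD (hline G y x' - hline G y x) (hline G y0 x' - hline G y0 x).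
rewrite (_ : _ - _ - _ = hline G y x' - hline G y0 x' - (hline G y x - hline G y0 x)); last by ring.
by clear -h1 h2; lra.
Qed.

(** A line of mere continuity is harmless: the mean is constant on each side
    and continuous across. *)
Lemma mean_hline_const_across G y0 Y1 Y2 y y' : Y1 < y0 < Y2 ->
  (forall w, Y1 < Im w < Y2 -> continuousCC G w) ->
  (forall w, Y1 < Im w < Y2 -> Im w != y0 -> holo G w) ->
  (forall w, Y1 < Im w < Y2 -> G (w + 1) = G w) ->
  Y1 < y < Y2 -> Y1 < y' < Y2 -> mean (hline G y) = mean (hline G y').
Proof.
move=> y0Y cG hG per.
suff main t : Y1 < t < Y2 -> mean (hline G t) = mean (hline G y0).
  by move=> /main-> /main->.
move=> tY; have [->//|ty0] := eqVneq t y0.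
apply/eqP; rewrite -subr_eq0 -normc_eq0 eq_le normc_ge0 andbT.
apply/ler_addgt0Pr => e e0; rewrite add0r.
have [d d0 hd] := mean_hline_continuous y0Y cG e0.
have [lt|gt|E] := ltgtP t y0; last by rewrite E eqxx in ty0.
- pose s := Num.max t (y0 - d / 2).
  have [ts sy ds] : [/\ t <= s, s < y0 & y0 - d / 2 <= s].
    by rewrite /s; case: (leP t (y0 - d / 2)) => h; split=> //; clear -h lt d0 tY; lra.
  have -> : mean (hline G t) = mean (hline G s).
    apply: mean_hline_const => // w /andP[w1 w2]; [apply: hG|apply: per];
      by clear -w1 w2 tY y0Y sy; lra.
  apply: hd; first by clear -ts tY sy y0Y; lra.
  by rewrite ler0_norm ?subr_le0 ?ltW//; clear -ds d0; lra.
pose s := Num.min t (y0 + d / 2).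
have [st ys sd] : [/\ s <= t, y0 < s & s <= y0 + d / 2].
  by rewrite /s; case: (leP t (y0 + d / 2)) => h; split=> //; clear -h gt d0 tY; lra.
have <- : mean (hline G s) = mean (hline G t).
  apply: mean_hline_const => // w /andP[w1 w2]; [apply: hG|apply: per];
    by clear -w1 w2 tY y0Y ys; lra.
apply: hd; first by clear -st tY ys y0Y; lra.
by rewrite ger0_norm ?subr_ge0 ?ltW//; clear -sd d0; lra.
Qed.

End Strip.

(** * The complex exponential and Laurent expansions *)

Section ComplexExponential.
Variable R : realType.
Local Notation C := R[i].
Local Notation N := (@Normc.normc R).
Local Notation Re := (@complex.Re R).
Local Notation Im := (@complex.Im R).

Lemma e2pii0 : e2pii (0 : C) = 1.
Proof. by rewrite -(e2pii_int R 0). Qed.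

Lemma e2piiN (w : C) : e2pii (- w) = (e2pii w)^-1.
Proof.
have E : e2pii w * e2pii (- w) = 1 by rewrite -e2piiD subrr e2pii0.
have w0 : e2pii w != 0.
  by apply/negP => /eqP w0; move/eqP: E; rewrite w0 mul0r eq_sym oner_eq0.
by apply: (mulfI w0); rewrite E mulfV.
Qed.

Lemma e2pii_neq0 (w : C) : e2pii w != 0.
Proof.
apply/negP => /eqP w0; have /eqP : e2pii w * e2pii (- w) = 1 by rewrite -e2piiD subrr e2pii0.
by rewrite w0 mul0r eq_sym oner_eq0.
Qed.

Lemma e2pii_add1 (w : C) : e2pii (w + 1) = e2pii w.
Proof. by rewrite e2piiD (e2pii_int R 1) mulr1. Qed.

Lemma e2piiMn (n : nat) (w : C) : e2pii (n%:R * w) = e2pii w ^+ n.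
Proof.
elim: n => [|n IHn]; first by rewrite mul0r e2pii0.
by rewrite -natr1 mulrDl mul1r e2piiD IHn exprSr.
Qed.

Lemma e2piiE (x y : R) : e2pii (x +i* y)%C =
  (expR (- (2 * pi) * y))%:C%C * (cos (2 * pi * x) +i* sin (2 * pi * x))%C.
Proof.
by rewrite /e2pii /cexp /two_pi_i /= !mul0r sub0r add0r mulNr.
Qed.

Lemma normc_cos_sin (x : R) : N (cos x +i* sin x)%C = 1.
Proof. by rewrite /= cos2Dsin2 sqrtr1. Qed.

Lemma normc_e2pii (w : C) : N (e2pii w) = expR (- (2 * pi) * Im w).
Proof.
case: w => x y; rewrite e2piiE Normc.normcM normc_cos_sin mulr1 normc_real.
by rewrite ger0_norm ?expR_ge0.
Qed.

Lemma e2pii_eq1 (w : C) : e2pii w = 1 -> exists k : int, w = k%:~R.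
Proof.
move=> w1; have : N (e2pii w) = expR 0 by rewrite w1 Normc.normc1 expR0.
rewrite normc_e2pii => /expR_inj; case: w w1 => x y w1 /= E.
have y0 : y = 0.
  have p0 : 2 * pi != 0 :> R by rewrite mulf_neq0 ?pnatr_eq0// gt_eqF ?pi_gt0.
  by apply: (mulfI p0); rewrite mulr0 -[LHS]opprK -mulNr E oppr0.
subst y; pose k := Num.floor x; exists k; pose t := x - k%:~R.
have /andP[t0 t1] : 0 <= t < 1.
  by rewrite /t subr_ge0 floor_le ltrBlDr -[1]/(1%:~R) addrC -intrD floorD1_gt.
have tE : (t +i* 0)%C = (x +i* 0)%C - k%:~R :> C.
  rewrite -(rmorph_int (real_complex R)) /=.
  by apply/eqP; rewrite eq_complex /= subr0 !eqxx.
have : e2pii (t +i* 0)%C = 1.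
  by rewrite tE e2piiD w1 -(rmorphN (intmul 1)) e2pii_int mulr1.
rewrite e2piiE mulr0 expR0 mul1r => /eqP; rewrite eq_complex /= => /andP[/eqP ct _].
suff t00 : t = 0 by apply/eqP; rewrite -subr_eq0 -tE t00.
apply/eqP/negP => /negP tn0.
have tgt0 : 0 < t by rewrite lt_def tn0.
have : cos (2 * pi * t) = cos (pi * t) ^+ 2 *+ 2 - 1.
  by rewrite -cos_mulr2n; congr cos; ring.
rewrite ct cos2sin2 => c1; have : sin (pi * t) ^+ 2 = 0 by move: c1; clear; lra.
move=> /eqP; rewrite expf_eq0 /= gt_eqF// sin_gt0_pi//.
by rewrite mulr_gt0 ?pi_gt0//= gtr_pMr ?pi_gt0.
Qed.

Lemma e2pii_surj (x : C) : x != 0 -> exists w, e2pii w = x.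
Proof.
move=> x0; have n0 : 0 < N x by rewrite normc_gt0.
pose u := x / (N x)%:C%C.
have nu : N u = 1.
  by rewrite Normc.normcM Normc.normcV normc_real ger0_norm ?ltW// divff// gt_eqF.
have Nx0 : (N x)%:C%C != 0 :> C by rewrite -normc_gt0 normc_real ger0_norm ?ltW.
have [t tE] : exists t : R, u = (cos t +i* sin t)%C.
  case: u nu => a b /= ab1.
  have ab : a ^+ 2 + b ^+ 2 = 1.
    by rewrite -[LHS]sqr_sqrtr ?addr_ge0 ?sqr_ge0// ab1 expr1n.
  have a1 : -1 <= a <= 1.
    rewrite -ler_norml -(@ler_pXn2r _ 2) ?nnegrE// expr1n real_normK ?num_real//.
    by rewrite -ab lerDl sqr_ge0.
  have ca := acosK a1.
  have [b0|b0] := lerP 0 b.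
    exists (acos a); rewrite ca sin_acos//; congr Complex.
    by rewrite -ab addrC addKr sqrtr_sqr ger0_norm.
  exists (- acos a); rewrite cosN sinN ca sin_acos//; congr Complex.
  by rewrite -ab addrC addKr sqrtr_sqr ltr0_norm// opprK.
have p0 : 2 * pi != 0 :> R by rewrite mulf_neq0 ?pnatr_eq0// gt_eqF ?pi_gt0.
exists ((t / (2 * pi)) +i* (- ln (N x) / (2 * pi)))%C.
rewrite e2piiE [2 * pi * (t / _)]mulrC divfK// -tE.
rewrite (_ : - (2 * pi) * (- ln (N x) / (2 * pi)) = ln (N x)); last first.
  by move: (2 * pi) p0 => q q0; field.
by rewrite lnK ?posrE// /u mulrC divfK.
Qed.

Lemma is_derive_expansion (f : R -> R) (c : R) : is_derive (0 : R) 1 f c ->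
  forall e, 0 < e -> exists2 d, 0 < d & forall h, `|h| < d ->
    `|f h - f 0 - c * h| <= e * `|h|.
Proof.
move=> [df dc] e e0.
have : (fun h : R => h^-1 *: (f (h *: (1 : R) + 0) - f 0)) @ (0 : R)^' --> c by rewrite -dc.
move=> /cvgrPdist_le/(_ e e0)/nbhs_ballP[d /= d0 hd].
exists d => // h hh; have [->|h0] := eqVneq h 0.
  by rewrite subrr mulr0 subrr normr0 mulr0.
have := hd h; rewrite /ball /= sub0r normrN => /(_ hh h0).
rewrite /GRing.scale /= mulr1 addr0 => H.
rewrite (_ : f h - f 0 - c * h = - (c - h^-1 * (f h - f 0)) * h); last by field.
by rewrite normrM normrN ler_wpM2r.
Qed.

Lemma cexp_expansion e : 0 < e -> exists2 d, 0 < d & forall h : C, N h < d ->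
  N (cexp h - 1 - h) <= e * N h.
Proof.
move=> e0; pose e' := Num.min (e / 10) 1.
have e'0 : 0 < e' by rewrite lt_min divr_gt0//=.
have [e'1 e'2] : e' <= e / 10 /\ e' <= 1 by rewrite /e'; split; rewrite ge_min lexx ?orbT.
clearbody e'.
have [d1 d10 h1] := is_derive_expansion (is_derive_expR 0) e'0.
have [d2 d20 h2] := is_derive_expansion (is_derive_cos 0) e'0.
have [d3 d30 h3] := is_derive_expansion (is_derive_sin 0) e'0.
pose d := Num.min (Num.min d1 d2) (Num.min d3 e').
exists d; first by rewrite !lt_min d10 d20 d30 e'0.
case=> a b; set n := N _ => hN.
have an : `|a| <= n := ler_normc_Re (a +i* b)%C.
have bn : `|b| <= n := ler_normc_Im (a +i* b)%C.
have n0 : 0 <= n := normc_ge0 _.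
have := le_lt_trans bn hN; have := le_lt_trans an hN; clearbody n.
rewrite !lt_min => /andP[/andP[a1 a2] /andP[a3 a4]] /andP[/andP[b1 b2] /andP[b3 b4]].
have := h1 _ a1; have := h2 _ b2; have := h3 _ b3.
rewrite expR0 cos0 sin0 oppr0 mul0r !subr0 !addr0 !mul1r => hs hc he.
apply: le_trans (normc_le_ReIm _) _; rewrite /cexp /=.
rewrite !mul0r !subr0 addr0.
have E1 : `|expR a - 1| <= 2 * `|a|.
  have := ler_normD (expR a - 1 - a) a; rewrite subrK => H; apply: le_trans H _.
  have : e' * `|a| <= 1 * `|a| by rewrite ler_wpM2r.
  by clear -he; lra.
have E2 : `|expR a| <= 3.
  have := ler_normD (expR a - 1) 1; rewrite subrK normr1 => H; apply: le_trans H _.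
  by clear -E1 a4 e'2; lra.
have R1 : `|expR a * cos b - 1 - a| <= 4 * e' * n.
  rewrite (_ : _ - _ - _ = expR a * (cos b - 1) + (expR a - 1 - a)); last by ring.
  apply: le_trans (ler_normD _ _) _; rewrite normrM.
  have : `|expR a| * `|cos b - 1| <= 3 * (e' * `|b|) by apply: ler_pM; rewrite ?normr_ge0 ?mulr_ge0.
  have : e' * `|a| <= e' * n by rewrite ler_pM2l.
  have : e' * `|b| <= e' * n by rewrite ler_pM2l.
  by clear -he; lra.
have R2 : `|expR a * sin b - b| <= 5 * e' * n.
  rewrite (_ : _ - _ = expR a * (sin b - b) + (expR a - 1) * b); last by ring.
  apply: le_trans (ler_normD _ _) _; rewrite !normrM.
  have : `|expR a| * `|sin b - b| <= 3 * (e' * `|b|) by apply: ler_pM.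
  have : `|expR a - 1| * `|b| <= (2 * `|a|) * n by apply: ler_pM; rewrite ?normr_ge0 ?mulr_ge0.
  have : `|a| * n <= e' * n by rewrite ler_wpM2r// ltW.
  have : e' * `|b| <= e' * n by rewrite ler_pM2l.
  by clear; lra.
have : e' * n <= e / 10 * n by rewrite ler_wpM2r.
have : 0 <= e * n by rewrite mulr_ge0 // ltW.
by move: R1 R2; clear; lra.
Qed.

Lemma normc_two_pi_i : N (two_pi_i R) = 2 * pi.
Proof.
rewrite /= expr0n add0r sqrtr_sqr ger0_norm// mulr_ge0// ltW// pi_gt0//.
Qed.

Lemma two_pi_i_neq0 : two_pi_i R != 0.
Proof. by rewrite -normc_gt0 normc_two_pi_i mulr_gt0// pi_gt0. Qed.

Lemma e2pii_expansion (p : C) e : 0 < e -> exists2 d, 0 < d & forall w, N (w - p) < d ->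
  N (e2pii w - e2pii p - two_pi_i R * e2pii p * (w - p)) <= e * N (w - p).
Proof.
move=> e0; have P0 : 0 < N (e2pii p) by rewrite normc_gt0 e2pii_neq0.
have T0 : 0 < N (two_pi_i R) by rewrite normc_gt0 two_pi_i_neq0.
have [d d0 hd] := cexp_expansion (divr_gt0 e0 (mulr_gt0 P0 T0)).
exists (d / N (two_pi_i R)); first by rewrite divr_gt0.
move=> w; rewrite ltr_pdivlMr// mulrC -Normc.normcM => /hd h.
have -> : e2pii w - e2pii p - two_pi_i R * e2pii p * (w - p) =
    e2pii p * (cexp (two_pi_i R * (w - p)) - 1 - two_pi_i R * (w - p)).
  by rewrite -/(e2pii (w - p)) -{1}(subrK p w) e2piiD; ring.
rewrite Normc.normcM; apply: le_trans (ler_wpM2l (normc_ge0 _) h) _.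
rewrite Normc.normcM le_eqVlt; apply/orP; left; apply/eqP; field.
by rewrite !gt_eqF.
Qed.

Lemma holo_e2pii (p : C) : holo (@e2pii R) p.
Proof. by have [] := holo_of_expansion (e2pii_expansion p). Qed.

Lemma holo_e2pii_comp (g : C -> C) p : holo g p -> holo (fun w => e2pii (g w)) p.
Proof. move=> hg; exact: (@holo_comp R (@e2pii R) g p hg (@holo_e2pii (g p))). Qed.

End ComplexExponential.
Arguments holo_e2pii {R} p.

Section Laurent.
Variable R : realType.
Local Notation C := R[i].
Local Notation N := (@Normc.normc R).
Local Notation Re := (@complex.Re R).
Local Notation Im := (@complex.Im R).

(** Fourier coefficients along a horizontal line.  Being means of holomorphic
    periodic functions, they do not depend on the line: they are the coefficients
    of the Laurent series in [e2pii w]. *)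
Definition fcoef (G : C -> C) (y : R) (m : int) : C :=
  mean (hline (fun w : C => G w * e2pii (- (m%:~R * w))) y).

Lemma Im_intM (m : int) (w : C) : Im (m%:~R * w) = m%:~R * Im w.
Proof.
rewrite -(rmorph_int (real_complex R)); case: w => a b /=.
by rewrite mul0r addr0.
Qed.

Lemma holo_mode G (m : int) p : holo G p ->
  holo (fun w : C => G w * e2pii (- (m%:~R * w))) p.
Proof.
move=> hG; apply: (holoM hG); apply: (@holo_e2pii_comp _ (fun w => - (m%:~R * w))).
rewrite (_ : (fun w => _) = (fun w => (- m%:~R) * w)).
  refine (holoM (holo_cst _ p) (holo_id p)).
by apply/funext => w; rewrite mulNr.
Qed.

Lemma continuousCCM f g p : continuousCC f p -> continuousCC g p ->
  continuousCC (fun w : C => f w * g w) p.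
Proof.
move=> /continuousCCP cf /continuousCCP cg; apply/continuousCCP.
exact: (@cvgM _ _ _ _ (f : C^o -> C^o) g _ _ cf cg).
Qed.

Lemma continuous_mode G (m : int) p : continuousCC G p ->
  continuousCC (fun w : C => G w * e2pii (- (m%:~R * w))) p.
Proof.
move=> cG; apply: (continuousCCM cG); apply: holo_continuous.
have := @holo_mode (fun=> 1) m p (holo_cst _ _).
by under eq_fun do rewrite mul1r.
Qed.

Lemma periodic_mode G (m : int) (w : C) : G (w + 1) = G w ->
  G (w + 1) * e2pii (- (m%:~R * (w + 1))) = G w * e2pii (- (m%:~R * w)).
Proof.
move=> ->; congr (_ * _).
by rewrite mulrDr mulr1 opprD e2piiD -(rmorphN (intmul 1)) e2pii_int mulr1.
Qed.

Lemma fcoef_const_mode (c : C) y m : fcoef (fun=> c) y m = if m == 0 then c else 0.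
Proof.
rewrite /fcoef /hline; case: eqVneq => [->|m0].
  rewrite (_ : (fun x => _) = fun=> c) ?mean_cst//; apply/funext => x.
  by rewrite mul0r oppr0 e2pii0 mulr1.
set f := (fun x => _).
have cf : continuousC f.
  apply: (@hline_continuous _ (fun w => c * e2pii (- (m%:~R * w))) y) => x.
  exact/continuous_mode/holo_continuous/holo_cst.
pose s : R := (2 * m%:~R)^-1.
(* a half-period shift negates the mode *)
have fs x : f (x + s) = -1 * f x.
  rewrite /f; have -> : ((x + s)%R +i* y)%C = (x +i* y)%C + s%:C%C :> C.
    by apply/eqP; rewrite eq_complex /= addr0 !eqxx.
  rewrite mulrDr opprD e2piiD.
  have -> : e2pii (- (m%:~R * s%:C%C)) = -1 :> C.
    rewrite -(rmorph_int (real_complex R)) -rmorphM/= /s invfM mulrCA divff ?intr_eq0// mulr1.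
    rewrite e2piiN; have -> : (2^-1 : R)%:C%C = (2^-1 +i* 0)%C by [].
    rewrite e2piiE mulr0 expR0 mul1r [2 * pi]mulrC mulfK ?pnatr_eq0// cospi sinpi.
    have -> : (-1 +i* 0)%C = -1 :> C by rewrite -(rmorphN1 (real_complex R)).
    by rewrite invrN invr1.
  by ring.
have per x : f (x + 1) = f x.
  rewrite /f; have -> : ((x + 1)%R +i* y)%C = (x +i* y)%C + 1 :> C.
    by apply/eqP; rewrite eq_complex /= addr0 !eqxx.
  exact: (@periodic_mode (fun=> c)).
have := mean_shift s cf per; rewrite (_ : (fun x => f (x + s)) = fun x => -1 * f x); last exact/funext.
rewrite meanZ// => /eqP; rewrite mulN1r eq_sym -subr_eq0 opprK -mulr2n mulrn_eq0 /=.
by move/eqP.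
Qed.

Lemma fcoef_le G y m M : (forall x, continuousCC G (x +i* y)%C) ->
  (forall x, 0 <= x <= 1 -> N (G (x +i* y)%C) <= M) ->
  N (fcoef G y m) <= 2 * (M * expR (2 * pi * (m%:~R * y))).
Proof.
move=> cG GM; apply: mean_le.
  by apply: hline_continuous => x; apply: continuous_mode.
move=> x x01; rewrite /hline Normc.normcM normc_e2pii ImN Im_intM /= mulrNN.
by rewrite ler_wpM2r ?expR_ge0// GM.
Qed.

Lemma expR_decay (A u e : R) : 0 < u -> 0 < e -> exists n0 : nat, forall n, (n0 <= n)%N ->
  A * expR (- u * n%:R) <= e.
Proof.
move=> u0 e0.
exists (Num.truncn (A / (e * u))).+1 => n hn.
have h : A / (e * u) < n%:R.
  by apply: lt_le_trans (truncnS_gt _) _; rewrite ler_nat.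
have h2 : u * n%:R < expR (u * n%:R).
  by apply: lt_le_trans (expR_ge1Dx _); rewrite ltrDr.
rewrite mulNr expRN -ler_pdivlMr ?invr_gt0 ?expR_gt0// invrK.
have := h; rewrite ltr_pdivrMr ?mulr_gt0// => h3.
apply: le_trans (ltW h3) _.
rewrite (_ : n%:R * (e * u) = e * (u * n%:R)); last by ring.
by rewrite ler_pM2l// ltW.
Qed.

Section LaurentExpansion.
Variables (G : C -> C) (Y1 Y2 : R).
Hypothesis hG : forall w, Y1 < Im w < Y2 -> holo G w.
Hypothesis perG : forall w, Y1 < Im w < Y2 -> G (w + 1) = G w.

Lemma fcoef_indep y y' m : Y1 < y < Y2 -> Y1 < y' < Y2 -> fcoef G y m = fcoef G y' m.
Proof.
wlog yy' : y y' / y <= y'.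
  by move=> H hy hy'; case: (lerP y y') => [/H->//|/ltW/H<-].
move=> hy hy'; apply: mean_hline_const => // w hw.
  by apply: holo_mode; apply: hG; clear -hw hy hy'; lra.
by apply: periodic_mode; apply: perG; clear -hw hy hy'; lra.
Qed.

Variable w0 : C.
Hypothesis w0Y : Y1 < Im w0 < Y2.

(* [h] is the divided difference of [G] at [w0] in the variable [e2pii w]; it is
   continuous, but differentiability is not clear on the line through [w0] *)
Let quotient_limit := xget 0 [set c | forall e, 0 < e ->
  exists2 d, 0 < d & forall w, 0 < N (w - w0) < d ->
    N ((G w - G w0) / (e2pii (w - w0) - 1) - c) <= e].

Let h (w : C) : C := if e2pii (w - w0) == 1 then quotient_limit
  else (G w - G w0) / (e2pii (w - w0) - 1).

Let quotient_limitP e : 0 < e ->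
  exists2 d, 0 < d & forall w, 0 < N (w - w0) < d ->
    N ((G w - G w0) / (e2pii (w - w0) - 1) - quotient_limit) <= e.
Proof.
move: e; apply: (@xgetPex _ 0 [set c | forall e, 0 < e ->
  exists2 d, 0 < d & forall w, 0 < N (w - w0) < d ->
    N ((G w - G w0) / (e2pii (w - w0) - 1) - c) <= e]).
have [g hg] := holo_expansion (hG w0Y).
pose T := two_pi_i R; have T0 : 0 < N T by rewrite normc_gt0 two_pi_i_neq0.
have Tn0 : T != 0 by rewrite two_pi_i_neq0.
exists (g / T) => /= e e0.
have [d1 d10 h1] := hg _ (divr_gt0 (mulr_gt0 e0 T0) (ltr0n R 4)).
pose e2 := Num.min (N T / 2) (e * N T ^+ 2 / (4 * (N g + 1))).
have g1 : 0 < N g + 1 by rewrite ltr_wpDl ?normc_ge0.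
have e20 : 0 < e2 by rewrite lt_min divr_gt0// divr_gt0// ?mulr_gt0// exprn_gt0.
have [d2 d20 h2] := @e2pii_expansion R 0 _ e20.
exists (Num.min d1 d2) => [|w]; first by rewrite lt_min d10.
rewrite lt_min => /andP[z0 /andP[/h1 {}h1]]; rewrite -[w - w0]subr0 => /h2 {h2}.
rewrite subr0 e2pii0 mulr1 -/T; set z := w - w0 in z0 h1 *; set E := e2pii z - 1 => h2.
have [e21 e22] : e2 <= N T / 2 /\ e2 <= e * N T ^+ 2 / (4 * (N g + 1)).
  by rewrite /e2; split; rewrite ge_min lexx ?orbT.
have zn : z != 0 by rewrite -normc_gt0.
(* the denominator is at least half its linear part *)
have Elow : N T / 2 * N z <= N E.
  have := normc_sub (T * z) (T * z - E); rewrite (_ : T * z - (T * z - E) = E); last by ring.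
  rewrite (normcB (T * z)) Normc.normcM.
  have : e2 * N z <= N T / 2 * N z by rewrite ler_wpM2r ?normc_ge0.
  by move: h2; clear; lra.
have E0 : 0 < N E by apply: lt_le_trans Elow; rewrite mulr_gt0// divr_gt0.
have En : E != 0 by rewrite -normc_gt0.
have -> : (G w - G w0) / E - g / T = ((G w - G w0 - g * z) - g / T * (E - T * z)) / E.
  by field; apply/andP.
rewrite Normc.normcM Normc.normcV ler_pdivrMr//.
apply: le_trans (_ : _ <= e * (N T / 2 * N z)) _; last by rewrite ler_pM2l.
apply: le_trans (normcBD _ _) _; rewrite !Normc.normcM Normc.normcV.
have : N g / N T * N (E - T * z) <= e * N T / 4 * N z.
  apply: le_trans (ler_wpM2l _ h2) _; first by rewrite divr_ge0 ?normc_ge0.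
  rewrite mulrA ler_wpM2r ?normc_ge0// mulrAC ler_pdivrMr//.
  apply: le_trans (ler_wpM2l (normc_ge0 _) e22) _.
  rewrite mulrA ler_pdivrMr ?mulr_gt0//.
  rewrite (_ : e * N T / 4 * N T * (4 * (N g + 1)) = e * N T ^+ 2 * (N g + 1)); last by field.
  rewrite mulrC ler_wpM2l ?lerDl// mulr_ge0 ?exprn_ge0 ?ltW//.
by move: h1; clear; lra.
Qed.

Let hE w : G w = G w0 + h w * (e2pii (w - w0) - 1) \/ e2pii (w - w0) = 1.
Proof.
rewrite /h; case: eqVneq => [?|n1]; [by right|left].
by rewrite divfK ?subr_eq0// [RHS]addrC subrK.
Qed.

Let perGn (n : nat) w : Y1 < Im w < Y2 -> G (w + n%:R) = G w.
Proof.
have ImDn (w' : C) (k : nat) : Im (w' + k%:R) = Im w'.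
  by rewrite ImD -(rmorph_nat (real_complex R)) /= addr0.
elim: n => [|n IHn] hw; first by rewrite addr0.
by rewrite -natr1 addrA perG ?ImDn// IHn.
Qed.

Let perGz (k : int) w : Y1 < Im w < Y2 -> G (w + k%:~R) = G w.
Proof.
move=> hw; case: k => n; first exact: perGn.
rewrite NegzE mulrNz -(@perGn n.+1 (w - n.+1%:R)) ?subrK//.
by rewrite ImD ImN -(rmorph_nat (real_complex R)) /= subr0.
Qed.

Let h_mul w : Y1 < Im w < Y2 -> G w = G w0 + h w * (e2pii (w - w0) - 1).
Proof.
move=> wY; have [//|w1] := hE w.
rewrite w1 subrr mulr0 addr0; have [k kE] := e2pii_eq1 w1.
by rewrite -(subrK w0 w) kE addrC perGz.
Qed.

Let h_per w : Y1 < Im w < Y2 -> h (w + 1) = h w.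
Proof. by move=> wY; rewrite /h [w + 1 - w0]addrAC e2pii_add1 perG. Qed.

Let h_holo_away w : Y1 < Im w < Y2 -> e2pii (w - w0) != 1 -> holo h w.
Proof.
move=> wY w1.
have hd p : holo (fun w => e2pii (w - w0) - 1) p.
  have hw : holo (fun w => w - w0) p := holoB (holo_id p) (holo_cst w0 p).
  refine (holoB (holo_e2pii_comp hw) (holo_cst 1 p)).
have n0 : 0 < N (e2pii (w - w0) - 1) by rewrite normc_gt0 subr_eq0.
have [d d0 hw] := holo_continuous (hd w) (divr_gt0 n0 (ltr0n R 2)).
apply: (@holo_near_eq _ (fun w => (G w - G w0) / (e2pii (w - w0) - 1)) _ _ d) => //.
  move=> w' /hw; rewrite /h; case: eqP => // ->.
  rewrite subrr sub0r normcN => H; exfalso; move: H n0; lra.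
have hV : holo (fun w => (e2pii (w - w0) - 1)^-1) w.
  by apply: (holoV _ (hd w)); rewrite subr_eq0.
refine (holoM (holoB (hG wY) (holo_cst _ w)) hV).
Qed.

Let h_continuous w : Y1 < Im w < Y2 -> continuousCC h w.
Proof.
move=> wY; have [w1|w1] := eqVneq (e2pii (w - w0)) 1; last exact/holo_continuous/h_holo_away.
have [k kE] := e2pii_eq1 w1.
move=> e e0; have [d d0 hd] := quotient_limitP e0.
have /andP[wY1 wY2] := wY.
exists (Num.min d (Num.min (Im w - Y1) (Y2 - Im w))) => [|w'].
  by rewrite !lt_min d0 !subr_gt0 wY1.
rewrite !lt_min => /andP[ww' /andP[w'1 w'2]].
have w'Y : Y1 < Im w' < Y2.
  have := ler_normc_Im (w' - w); rewrite ImD ImN ler_norml; move: w'1 w'2; lra.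
rewrite {2}/h w1 eqxx /h; case: eqP => [_|/eqP n1].
  by rewrite subrr Normc.normc0 ltW.
pose v := w' - k%:~R.
have vw : v - w0 = w' - w by rewrite /v -kE; ring.
have ev : e2pii (v - w0) = e2pii (w' - w0).
  by rewrite /v addrAC e2piiD -(rmorphN (intmul 1)) e2pii_int mulr1.
have Gv : G v = G w' by rewrite /v -mulrNz perGz.
rewrite -ev -Gv; apply: hd; rewrite vw ww' andbT normc_gt0 -vw subr_eq0.
by apply: contraNneq n1 => vw0; rewrite -ev vw0 subrr e2pii0.
Qed.

Let h_indep y y' m : Y1 < y < Y2 -> Y1 < y' < Y2 -> fcoef h y m = fcoef h y' m.
Proof.
move=> yY y'Y; apply: (mean_hline_const_across w0Y _ _ _ yY y'Y) => w wY.
- exact/continuous_mode/h_continuous.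
- move=> wn; apply/holo_mode/h_holo_away => //; apply: contraNneq wn => /e2pii_eq1[k kE].
  have -> : w = w0 + k%:~R by rewrite -kE; ring.
  by rewrite ImD -(rmorph_int (real_complex R)) /= addr0.
- exact/periodic_mode/h_per.
Qed.

Let mode (m : int) : C := e2pii (m%:~R * w0).

(** Comparing the Fourier coefficients of both sides of
    [G w = G w0 + h w * (e2pii (w - w0) - 1)] makes the Laurent sum telescope. *)
Let fcoef_telescope y m : Y1 < y < Y2 ->
  fcoef G y m * mode m =
  (if m == 0 then G w0 else 0) + (fcoef h y (m - 1) * mode (m - 1) - fcoef h y m * mode m).
Proof.
move=> yY.
have cc (F : C -> C) k : (forall w, Y1 < Im w < Y2 -> continuousCC F w) ->
    continuousC (hline (fun w : C => F w * e2pii (- (k%:~R * w))) y).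
  by move=> cF; apply: hline_continuous => x; apply: continuous_mode; exact: cF.
have c0 := cc (fun=> G w0) m (fun w _ => holo_continuous (holo_cst _ w)).
have c1 := cc h (m - 1) h_continuous.
have c2 := cc h m h_continuous.
have cS f g : continuousC f -> continuousC g -> continuousC (fun x : R => f x - g x).
  move=> cf cg x t t0; have [d1 d10 h1] := cf x _ (divr_gt0 t0 (ltr0n R 2)).
  have [d2 d20 h2] := cg x _ (divr_gt0 t0 (ltr0n R 2)).
  exists (Num.min d1 d2) => [|x']; first by rewrite lt_min d10.
  rewrite lt_min => /andP[/h1 {}h1 /h2 {}h2].
  have := normcBD (f x' - f x) (g x' - g x).
  rewrite (_ : _ - _ - _ = f x' - g x' - (f x - g x)); last by ring.
  by move: h1 h2; lra.
have cZ c f : continuousC f -> continuousC (fun x : R => c * f x).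
  move=> cf x t t0.
  have c10 : 0 < N c + 1 by rewrite ltr_wpDl ?normc_ge0.
  have [d d0 hd] := cf x _ (divr_gt0 t0 c10).
  exists d => // x' /hd; rewrite ler_pdivlMr// -mulrBr Normc.normcM => H.
  by apply: le_trans H; rewrite mulrC ler_wpM2l ?normc_ge0// lerDl ler01.
have -> : fcoef G y m = fcoef (fun=> G w0) y m +
    (e2pii (- w0) * fcoef h y (m - 1) - fcoef h y m).
  rewrite /fcoef -meanZ// -meanB//; last exact: cZ.
  rewrite -meanD//; last by apply: cS => //; exact: cZ.
  congr mean; apply/funext => x; rewrite /hline [in LHS]h_mul//.
  set w := (x +i* y)%C.
  have -> : e2pii (- ((m - 1)%:~R * w)) = e2pii w * e2pii (- (m%:~R * w)).
    by rewrite -e2piiD; congr e2pii; rewrite intrB; ring.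
  rewrite e2piiD; ring.
have modeB : mode (m - 1) = e2pii (- w0) * mode m.
  by rewrite /mode -e2piiD; congr e2pii; rewrite intrB; ring.
rewrite fcoef_const_mode modeB; case: eqVneq => [->|_]; last by ring.
rewrite /mode mul0r e2pii0; ring.
Qed.

Let tail_le y M (m : int) :
  Y1 < y < Y2 -> (forall x, 0 <= x <= 1 -> N (h (x +i* y)%C) <= M) ->
  N (fcoef h y m * mode m) <= 2 * M * expR (- (2 * pi * (Im w0 - y)) * m%:~R).
Proof.
move=> yY hM; rewrite Normc.normcM normc_e2pii Im_intM.
have h1 : N (fcoef h y m) <= 2 * (M * expR (2 * pi * (m%:~R * y))).
  by apply: fcoef_le => // x; exact: h_continuous.
apply: le_trans (ler_wpM2r (expR_ge0 _) h1) _.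
rewrite -!mulrA -expRD le_eqVlt; apply/orP; left; apply/eqP; congr (_ * (_ * expR _)).
ring.
Qed.

Let tails y e : Y1 < y < Y2 -> 0 < e -> exists n0 : nat, forall n : nat, (n0 <= n)%N ->
  N (fcoef h y n%:Z * mode n%:Z) <= e /\ N (fcoef h y (- n%:Z) * mode (- n%:Z)) <= e.
Proof.
move=> yY e0; have /andP[w01 w02] := w0Y.
pose y1 := (Y1 + Im w0) / 2; pose y2 := (Y2 + Im w0) / 2.
have [y1Y y2Y] : Y1 < y1 < Y2 /\ Y1 < y2 < Y2 by rewrite /y1 /y2; split; lra.
have [y1w y2w] : 0 < Im w0 - y1 /\ 0 < y2 - Im w0 by rewrite /y1 /y2; split; lra.
have bnd t : Y1 < t < Y2 -> exists2 M, 0 <= M & forall x, 0 <= x <= 1 -> N (h (x +i* t)%C) <= M.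
  move=> tY; apply: (@continuousC_bounded _ (hline h t)).
  by apply: hline_continuous => x; exact: h_continuous.
have [M1 _ hM1] := bnd _ y1Y; have [M2 _ hM2] := bnd _ y2Y.
have pi20 : 0 < 2 * pi :> R by rewrite mulr_gt0// pi_gt0.
have [n1 hn1] := expR_decay (2 * M1) (mulr_gt0 pi20 y1w) e0.
have [n2 hn2] := expR_decay (2 * M2) (mulr_gt0 pi20 y2w) e0.
exists (maxn n1 n2) => n; rewrite geq_max => /andP[h1 h2]; split.
  rewrite (h_indep _ yY y1Y); apply: le_trans (tail_le _ y1Y hM1) _.
  exact: hn1.
rewrite (h_indep _ yY y2Y); apply: le_trans (tail_le _ y2Y hM2) _.
apply: le_trans (hn2 n h2); rewrite mulrNz le_eqVlt; apply/orP; left; apply/eqP.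
congr (_ * expR _); rewrite -[n%:Z%:~R]/(n%:R); ring.
Qed.

(** By [fcoef_telescope] the partial sums are [G w0] plus two boundary terms, which
    decay geometrically because the coefficients of [h] may be computed on a line
    above or below [w0]. *)
Theorem laurent y e : Y1 < y < Y2 -> 0 < e -> exists n0 : nat, forall K L : nat,
  (n0 <= K)%N -> (n0 <= L)%N ->
  N (\sum_(k < K) fcoef G y k%:Z * e2pii (k%:R * w0)
     + \sum_(k < L) fcoef G y (- k.+1%:Z) * e2pii (- (k.+1%:R * w0)) - G w0) <= e.
Proof.
move=> yY e0; have [n0 hn0] := tails yY (divr_gt0 e0 (ltr0n R 2)).
exists n0.+1 => K L hK hL.
pose H m := fcoef h y m * mode m.
have S1 n : \sum_(k < n.+1) fcoef G y k%:Z * e2pii (k%:R * w0) = G w0 + (H (-1) - H n%:Z).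
  elim: n => [|n IHn].
    by rewrite big_ord_recl big_ord0 addr0 (fcoef_telescope 0 yY).
  rewrite big_ord_recr IHn /= (fcoef_telescope n.+1%:Z yY) /= -/(H _) -/(H _).
  by rewrite -addn1 PoszD addrK; ring.
have S2 n : \sum_(k < n) fcoef G y (- k.+1%:Z) * e2pii (- (k.+1%:R * w0)) =
    H (- n.+1%:Z) - H (-1).
  elim: n => [|n IHn]; first by rewrite big_ord0 subrr.
  rewrite big_ord_recr IHn /=.
  have -> : e2pii (- (n.+1%:R * w0)) = mode (- n.+1%:Z) by rewrite /mode mulrNz mulNr.
  rewrite (fcoef_telescope _ yY) oppr_eq0 /= -/(H _) -/(H _).
  have -> : - n.+1%:Z - 1 = - n.+2%:Z by rewrite -opprD -PoszD addn1.
  by ring.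
case: K hK => // K; rewrite ltnS => /hn0[h1 _].
have [_ h2] := hn0 L.+1 (leqW (ltnW hL)).
rewrite S1 S2 (_ : _ - _ = H (- L.+1%:Z) - H K%:Z); last by ring.
apply: le_trans (normcBD _ _) _; rewrite /H; lra.
Qed.

End LaurentExpansion.
End Laurent.

(** * Taylor expansions on a punctured disc *)

Section Taylor.
Variable R : realType.
Local Notation C := R[i].
Local Notation N := (@Normc.normc R).
Local Notation Im := (@complex.Im R).

(** The height of the horizontal line that [e2pii] wraps around the circle of
    radius [rho]. *)
Definition circle_height (rho : R) : R := - ln rho / (2 * pi).

Lemma circle_heightK rho : 0 < rho -> expR (- (2 * pi) * circle_height rho) = rho.
Proof.
move=> r0; rewrite /circle_height; have p0 : 2 * pi != 0 :> R.
  by rewrite mulf_neq0 ?pnatr_eq0// gt_eqF ?pi_gt0.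
rewrite (_ : - (2 * pi) * _ = ln rho); first by rewrite lnK.
by move: (2 * pi) p0 => q q0; field.
Qed.

Lemma lt_circle_height (w : C) rho : 0 < rho ->
  (N (e2pii w) < rho) = (circle_height rho < Im w).
Proof.
move=> r0; rewrite -{1}(circle_heightK r0) normc_e2pii ltr_expR.
by rewrite ltr_nM2l// oppr_lt0 mulr_gt0// pi_gt0.
Qed.

Lemma ltr_circle_height rho rho' : 0 < rho -> 0 < rho' ->
  (circle_height rho < circle_height rho') = (rho' < rho).
Proof.
move=> r0 r'0; have := @lt_circle_height (0 +i* circle_height rho')%C _ r0.
by rewrite normc_e2pii /= circle_heightK.
Qed.

(** The Cauchy integral over the circle of radius [rho], in the coordinate
    [x = e2pii w]. *)
Definition tcoef (f : C -> C) (rho : R) (k : nat) : C :=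
  fcoef (fun w => f (e2pii w)) (circle_height rho) k%:Z.

Lemma tcoef_diff_le f g rho k M : 0 < rho ->
  (forall x, N x = rho -> holo f x) -> (forall x, N x = rho -> holo g x) ->
  (forall t, 0 <= t <= 1 ->
    let x := e2pii (t +i* circle_height rho)%C in N (f x - g x) <= M) ->
  N (tcoef f rho k - tcoef g rho k) <= 2 * (M * rho^-1 ^+ k).
Proof.
move=> r0 hf hg fg; set y := circle_height rho.
have on_circle x : N (e2pii (x +i* y)%C) = rho.
  by rewrite normc_e2pii /= circle_heightK.
have cF F : (forall x, N x = rho -> holo F x) ->
    forall x, holo (fun w => F (e2pii w)) (x +i* y)%C.
  by move=> hF x; refine (@holo_comp R F (@e2pii R) _ (holo_e2pii _) (hF _ (on_circle x))).
have cc F : (forall x, N x = rho -> holo F x) ->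
    continuousC (hline (fun w : C => F (e2pii w) * e2pii (- (k%:Z%:~R * w))) y).
  move=> hF; apply: hline_continuous => x.
  by apply: (@continuous_mode _ (fun w => F (e2pii w)) k%:Z); exact/holo_continuous/cF.
rewrite /tcoef /fcoef -meanB; [|exact: cc|exact: cc].
rewrite (_ : (fun x => _) = hline (fun w => (f (e2pii w) - g (e2pii w)) * e2pii (- (k%:Z%:~R * w))) y);
  last by apply/funext => x; rewrite /hline mulrBl.
have := @fcoef_le R (fun w => f (e2pii w) - g (e2pii w)) y k%:Z M.
rewrite /fcoef => H; apply: le_trans (H _ _) _.
- by move=> x; apply/holo_continuous; refine (holoB (cF f hf x) (cF g hg x)).
- exact: fg.
rewrite (_ : expR _ = rho^-1 ^+ k)//.
have := circle_heightK r0; rewrite -/y => <-; rewrite -expRN -expRM_natl; congr expR.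
by rewrite -[k%:Z%:~R]/(k%:R); ring.
Qed.

(** Pulling back along [e2pii] turns a punctured disc into a half-plane and the
    power series into the Laurent expansion; the singularity being weaker than
    a pole kills the coefficients of negative index. *)
Lemma taylor f r rho : 0 < rho < r ->
  (forall x, 0 < N x < r -> holo f x) ->
  (forall e, 0 < e -> exists2 d, 0 < d & forall x, 0 < N x < d -> N (x * f x) <= e) ->
  forall x, 0 < N x < r -> forall e, 0 < e -> exists n0, forall K : nat, (n0 <= K)%N ->
    N (\sum_(k < K) tcoef f rho k * x ^+ k - f x) <= e.
Proof.
move=> /andP[rho0 rhor] hf f0 x /andP[x0 xr] e e0.
have r0 : 0 < r := lt_trans rho0 rhor.
pose G w := f (e2pii w); pose Y1 := circle_height r.
have N0 w : 0 < N (e2pii w) by rewrite normc_gt0 e2pii_neq0.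
have hG Y2 w : Y1 < Im w < Y2 -> holo G w.
  move=> /andP[]; rewrite -lt_circle_height// => wr _.
  by refine (@holo_comp R f (@e2pii R) _ (holo_e2pii _) (hf _ _)); rewrite N0.
have pG Y2 w : Y1 < Im w < Y2 -> G (w + 1) = G w by move=> _; rewrite /G e2pii_add1.
pose y := circle_height rho; have yY : Y1 < y by rewrite ltr_circle_height.
have [w wx] : exists w, e2pii w = x by apply: e2pii_surj; rewrite -normc_gt0.
have wY : Y1 < Im w by rewrite -lt_circle_height// wx.
pose Y2 := Num.max y (Im w) + 1.
have yY2 : Y1 < y < Y2 by rewrite yY /Y2 ltr_pwDr// le_max lexx.
have wY2 : Y1 < Im w < Y2 by rewrite wY /Y2 ltr_pwDr// le_max lexx orbT.
have neg0 (k : nat) : fcoef G y (- k.+1%:Z) = 0.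
  apply/eqP; rewrite -normc_eq0 eq_le normc_ge0 andbT.
  apply/ler_addgt0Pr => t t0; rewrite add0r.
  have [d d0 hd] := f0 _ (divr_gt0 t0 (ltr0n R 2)).
  pose rho' := Num.min (d / 2) (Num.min rho 1 / 2).
  have rho'0 : 0 < rho' by rewrite /rho' lt_min !divr_gt0// lt_min rho0 ltr01.
  have [rho'd rho'r rho'1] : [/\ rho' < d, rho' < r & rho' <= 1].
    rewrite /rho'; case: (leP (d / 2) (Num.min rho 1 / 2)); case: (leP rho 1);
      move=> *; split; lra.
  pose y' := circle_height rho'.
  have y'Y : Y1 < y' by rewrite ltr_circle_height.
  pose Y3 := Num.max y y' + 1.
  rewrite (@fcoef_indep _ G Y1 Y3 (hG _) (pG _) y y'); first last.
  - by rewrite y'Y /Y3 ltr_pwDr// le_max lexx orbT.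
  - by rewrite yY /Y3 ltr_pwDr// le_max lexx.
  have on_circle s : N (e2pii (s +i* y')%C) = rho'.
    by rewrite normc_e2pii /= circle_heightK.
  apply: le_trans (@fcoef_le _ G y' _ (t / 2 / rho') _ _) _.
  - move=> s; apply/holo_continuous/(hG (y' + 1)).
    by rewrite /= y'Y ltrDl ltr01.
  - move=> s _; rewrite ler_pdivlMr// mulrC -{1}(on_circle s) -Normc.normcM.
    by apply: hd; rewrite on_circle rho'0.
  have -> : expR (2 * pi * ((- k.+1%:Z)%:~R * y')) = rho' ^+ k.+1.
    have := circle_heightK rho'0; rewrite -/y' => <-; rewrite -expRM_natl; congr expR.
    by rewrite mulrNz -[k.+1%:Z%:~R]/(k.+1%:R); ring.
  rewrite exprS (_ : 2 * _ = t * rho' ^+ k); last by field; rewrite gt_eqF.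
  have : rho' ^+ k <= 1 by rewrite exprn_ile1// ltW.
  by move=> h; rewrite -[leRHS]mulr1 ler_pM2l.
have [n0 hn0] := laurent (hG Y2) (pG Y2) wY2 yY2 e0.
exists n0 => K hK; have := hn0 K n0 hK (leqnn _).
rewrite [X in _ + X - _]big1 ?addr0; last by move=> k _; rewrite neg0 mul0r.
rewrite {2}/G wx; congr (N (_ - _) <= e); apply: eq_bigr => k _.
by rewrite e2piiMn wx.
Qed.

Lemma tcoef_is_power_series f r rho : 0 < rho < r ->
  (forall x, 0 < N x < r -> holo f x) ->
  (forall e, 0 < e -> exists2 d, 0 < d & forall x, 0 < N x < d -> N (x * f x) <= e) ->
  exists2 s, 0 < s & forall x, 0 < N x < s -> forall e, 0 < e ->
    exists n0, forall K : nat, (n0 <= K)%N ->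
    N (\sum_(k < K) tcoef f rho k * x ^+ k - f x) <= e.
Proof.
move=> hr hf f0; exists r; last exact: (taylor hr hf f0).
by case/andP: hr; exact: lt_trans.
Qed.

Definition has_power_series (f : C -> C) (c : nat -> C) :=
  exists2 r, 0 < r & forall x, 0 < N x < r -> forall e, 0 < e ->
    exists n0, forall K : nat, (n0 <= K)%N ->
    N (\sum_(k < K) c k * x ^+ k - f x) <= e.

(** A convergent power series is also an asymptotic expansion; sums, products
    and substitutions are easier to read off in the latter form. *)
Lemma power_series_truncation f c : has_power_series f c -> forall n,
  exists M r, [/\ 0 <= M, 0 < r & forall x, 0 < N x < r ->
    N (f x - \sum_(k < n) c k * x ^+ k) <= M * N x ^+ n].
Proof.
move=> [r r0 hf] n; have [s sE] : exists s, s = r / 2 by exists (r / 2).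
have s0 : 0 < s by rewrite sE divr_gt0.
have Ns : N s%:C%C = s by rewrite normc_real gtr0_norm.
have s_in : 0 < N s%:C%C < r by rewrite Ns s0 sE; move: r0; clear; lra.
have [n0 hn0] := hf _ s_in 1 ltr01.
pose M0 := 2 + \sum_(k < n0) N (c k) * s ^+ k.
have M0sum : 0 <= \sum_(k < n0) N (c k) * s ^+ k.
  by apply: sumr_ge0 => k _; rewrite mulr_ge0 ?normc_ge0// exprn_ge0// ltW.
have M00 : 0 <= M0 by rewrite /M0; move: M0sum; clear; lra.
have bnd k : N (c k) * s ^+ k <= M0.
  have [kn|nk] := ltnP k n0.
    rewrite /M0 (bigD1 (Ordinal kn))//=.
    have : 0 <= \sum_(i < n0 | i != Ordinal kn) N (c i) * s ^+ i.
      by apply: sumr_ge0 => i _; rewrite mulr_ge0 ?normc_ge0// exprn_ge0// ltW.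
    set A := \sum_(i < n0 | _) _; set B := N (c k) * _; clear; lra.
  have h1 := hn0 k nk; have h2 := hn0 k.+1 (leqW nk).
  have := normcBD (\sum_(i < k.+1) c i * s%:C%C ^+ i - f s%:C%C) (\sum_(i < k) c i * s%:C%C ^+ i - f s%:C%C).
  rewrite big_ord_recr /= (_ : _ - _ = c k * s%:C%C ^+ k); last by ring.
  rewrite big_ord_recr /= in h2.
  rewrite Normc.normcM normcX Ns; move: h1 h2 M0sum; rewrite /M0.
  set A := \sum_(i < n0) _; set B := N (c k) * _; clear; lra.
exists (2 * M0 / s ^+ n), (s / 2); split.
- by rewrite divr_ge0 ?mulr_ge0// exprn_ge0// ltW.
- by rewrite divr_gt0.
move=> x /andP[x0 xs]; pose t := N x / s.
have t0 : 0 <= t by rewrite divr_ge0 ?ltW.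
have t1 : 2 * t <= 1 by rewrite /t mulrA ler_pdivrMr// mul1r; move: xs; clear; lra.
have xE : N x = t * s by rewrite /t divfK// gt_eqF.
clearbody t.
have tail j : N (\sum_(k < n + j) c k * x ^+ k - \sum_(k < n) c k * x ^+ k)
    <= M0 * (2 * t ^+ n - 2 * t ^+ (n + j)).
  elim: j => [|j IHj]; first by rewrite addn0 !subrr Normc.normc0 mulr0.
  rewrite addnS big_ord_recr /= addrAC; apply: le_trans (normcD _ _) _.
  apply: le_trans (lerD IHj (lexx _)) _.
  rewrite Normc.normcM normcX xE exprMn mulrCA exprS.
  have h1 : t ^+ (n + j) * (N (c (n + j)%N) * s ^+ (n + j)) <= t ^+ (n + j) * M0.
    by rewrite ler_wpM2l// exprn_ge0.
  have h2 : M0 * t ^+ (n + j) * (2 * t) <= M0 * t ^+ (n + j) * 1.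
    by rewrite ler_wpM2l// mulr_ge0// exprn_ge0.
  move: h1 h2; set A := t ^+ (n + j); set B := t ^+ n; set D := A * (_ * _).
  by clear; lra.
apply/ler_addgt0Pr => e e0.
have x_in : 0 < N x < r.
  by rewrite x0 /=; apply: lt_trans xs _; rewrite sE; move: r0; clear; lra.
have [n1 hn1] := hf x x_in e e0.
have h1 := hn1 (n + n1)%N (leq_addl _ _); have h2 := tail n1.
have := normcBD (\sum_(k < n + n1) c k * x ^+ k - \sum_(k < n) c k * x ^+ k)
  (\sum_(k < n + n1) c k * x ^+ k - f x).
rewrite (_ : _ - _ = f x - \sum_(k < n) c k * x ^+ k); last by ring.
move=> h3; apply: le_trans h3 _; rewrite lerD//.
apply: le_trans h2 _; rewrite xE exprMn.
have -> : 2 * M0 / s ^+ n * (t ^+ n * s ^+ n) = M0 * (2 * t ^+ n).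
  by field; rewrite expf_neq0// gt_eqF.
by rewrite ler_wpM2l// gerDl oppr_le0 mulr_ge0// exprn_ge0.
Qed.

Lemma normc_horner_le (q : {poly C}) (x : C) : N x <= 1 ->
  N q.[x] <= \sum_(i < size q) N q`_i.
Proof.
move=> x1; rewrite horner_coef; apply: le_trans (normc_sum _ _ _) _.
apply: ler_sum => i _; rewrite Normc.normcM normcX.
by rewrite ler_piMr ?normc_ge0// exprn_ile1// normc_ge0.
Qed.

(** Dividing out [x], the coefficients are seen to vanish one after the other. *)
Lemma poly_coef_small (p : {poly C}) n M d : 0 < d ->
  (forall x, 0 < N x < d -> N p.[x] <= M * N x ^+ n) ->
  forall i, (i < n)%N -> p`_i = 0.
Proof.
elim: n p M d => [//|n IHn] p M d d0 hp.
pose q := \poly_(i < (size p).-1) p`_i.+1.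
have pE : p = q * 'X + (p`_0)%:P.
  apply/polyP => -[|i]; rewrite coefD coefMX coefC /= ?add0r ?addr0//.
  rewrite coef_poly; case: ltnP => // ip.
  by rewrite nth_default//; move: ip; case: (size p).
pose B := \sum_(i < size q) N q`_i.
have B0 : 0 <= B by apply: sumr_ge0 => i _; exact: normc_ge0.
have p0 : p`_0 = 0.
  apply/eqP; rewrite -normc_eq0 eq_le normc_ge0 andbT.
  apply/ler_addgt0Pr => e e0; rewrite add0r.
  have L0 : 0 < `|M| + B + 1 by rewrite ltr_wpDl// addr_ge0.
  pose x := Num.min (Num.min (d / 2) 1) (e / (`|M| + B + 1)).
  have x0 : 0 < x by rewrite /x !lt_min divr_gt0//= ltr01 divr_gt0.
  have [xd x1 xe] : [/\ x < d, x <= 1 & x <= e / (`|M| + B + 1)].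
    rewrite /x; split; last by rewrite ge_min lexx orbT.
      by rewrite !gt_min; apply/orP; left; apply/orP; left; move: d0; clear; lra.
    by rewrite !ge_min lexx orbT.
  have Nx : N x%:C%C = x by rewrite normc_real gtr0_norm.
  have := hp x%:C%C; rewrite Nx x0 xd => /(_ isT) hpx.
  have := @normc_horner_le q x%:C%C; rewrite Nx => /(_ x1) hq.
  have := normcBD p.[x%:C%C] (q.[x%:C%C] * x%:C%C).
  rewrite {1}pE !hornerE (_ : _ - _ = p`_0); last by rewrite addrC addKr.
  rewrite Normc.normcM Nx => h; apply: le_trans h _.
  have h1 : M * x ^+ n.+1 <= `|M| * x.
    apply: le_trans (_ : _ <= `|M| * x ^+ n.+1) _.
      by rewrite ler_wpM2r ?ler_norm// exprn_ge0// ltW.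
    by rewrite ler_wpM2l// exprS ler_piMr ?exprn_ile1// ltW.
  have h2 : N q.[x%:C%C] * x <= B * x by rewrite ler_wpM2r// ltW.
  have h3 : (`|M| + B + 1) * x <= e by rewrite mulrC -ler_pdivlMr.
  by move: hpx h1 h2 h3 x0; clear; lra.
move=> [_//|i]; rewrite ltnS => ni.
rewrite pE coefD coefMX coefC /= addr0.
apply: (IHn q M d d0) ni => x /andP[x0 xd].
have := hp x; rewrite x0 xd => /(_ isT).
by rewrite pE p0 !hornerE Normc.normcM exprSr mulrA ler_pM2r.
Qed.

Lemma power_series_unique f c c' :
  has_power_series f c -> has_power_series f c' -> c = c'.
Proof.
move=> hc hc'; apply/funext => n.
have [M [r [M0 r0 h]]] := power_series_truncation hc n.+1.
have [M' [r' [M'0 r'0 h']]] := power_series_truncation hc' n.+1.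
pose p := \poly_(k < n.+1) (c k - c' k).
have : p`_n = 0.
  apply: (@poly_coef_small p n.+1 (M + M') (Num.min r r')) => //.
    by rewrite lt_min r0.
  move=> x; rewrite lt_min => /andP[x0 /andP[xr xr']].
  rewrite /p horner_poly.
  have -> : \sum_(i < n.+1) (c i - c' i) * x ^+ i =
      (f x - \sum_(i < n.+1) c' i * x ^+ i) - (f x - \sum_(i < n.+1) c i * x ^+ i).
    by under eq_bigr do rewrite mulrBl; rewrite sumrB; ring.
  apply: le_trans (normcBD _ _) _; rewrite mulrDl addrC.
  by rewrite lerD// ?h ?h'// x0.
by rewrite coef_poly ltnSn => /eqP; rewrite subr_eq0 => /eqP.
Qed.

Lemma has_power_seriesP f c : has_power_series f c <->
  \forall x \near (0 : C^o)^', series (fun k => c k * x ^+ k : C^o) @ \oo --> (f x : C^o).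
Proof.
have E x (c0 : nat -> C) : series (fun k => c0 k * x ^+ k : C^o) @ \oo --> (f x : C^o) <->
    (forall e, 0 < e -> exists n0, forall K : nat, (n0 <= K)%N ->
      N (\sum_(k < K) c0 k * x ^+ k - f x) <= e).
  split=> [h e e0|h].
    have [n0 _ hn0] := (@cvg_normcP _ _ \oo _ _ _).1 h e e0.
    by exists n0 => K hK; have := hn0 K hK; rewrite /series /= big_mkord.
  apply/(@cvg_normcP _ _ \oo _ _ _) => e e0; have [n0 hn0] := h e e0.
  by exists n0 => // K hK; rewrite /series /= big_mkord; exact: hn0.
split=> [[r r0 h]|/(dnbhs_normcP 0)[r r0 h]].
  apply/(dnbhs_normcP 0); exists r => // x; rewrite subr0 => xr.
  by apply/E; exact: h.
by exists r => // x xr; apply/E; apply: h; rewrite subr0.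
Qed.

Lemma power_series_at0_eq f c : has_power_series f c -> power_series_at0 f = c.
Proof.
move=> hc; apply: (@power_series_unique f) => //; apply/has_power_seriesP.
rewrite /power_series_at0; set S := [set c | _].
by apply: (@xgetPex _ _ S); exists c; exact: (has_power_seriesP f c).1.
Qed.

End Taylor.

(** * Theta functions near the cusp *)

Section ThetaAsymptotics.
Variable R : realType.
Local Notation C := R[i].
Local Notation N := (@Normc.normc R).
Local Notation Im := (@complex.Im R).

Lemma e2pii_half : e2pii (2^-1 : C) = -1.
Proof.
have -> : (2^-1 : C) = ((2^-1 : R) +i* 0)%C by rewrite -[RHS]/((2^-1 : R)%:C%C) fmorphV rmorph_nat.
rewrite e2piiE mulr0 expR0 mul1r [2 * pi]mulrC mulfK ?pnatr_eq0// cospi sinpi.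
by rewrite -(rmorphN1 (real_complex R)).
Qed.

(** The Laurent mode of index [k + 1] pairs with the one of index [- k]; the
    pair is divisible by [X - 1], and the quotient has [2 k + 1 <= 3 ^ k] terms of
    size at most [b ^ k]. *)
Lemma mode_pair (X : C) (k : nat) (b : R) : X != 0 -> 1 <= b -> N X <= b -> N X^-1 <= b ->
  exists U : C, X ^+ k.+1 - X ^- k = (X - 1) * U /\ N U <= 3 ^+ k * b ^+ k.
Proof.
move=> X0 b1 Xb Xb'.
exists (X ^- k * \sum_(j < (2 * k).+1) X ^+ j); split.
  rewrite mulrCA -subrX1 mulrBr mulr1; congr (_ - _).
  have -> : (2 * k).+1 = (k + k.+1)%N by rewrite mul2n -addnn addnS.
  by rewrite exprD mulKf// expf_neq0.
rewrite mulr_sumr; apply: le_trans (normc_sum _ _ _) _.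
apply: le_trans (_ : _ <= \sum_(j < (2 * k).+1) b ^+ k) _.
  apply: ler_sum => j _; rewrite Normc.normcM -exprVn !normcX.
  move: (nat_of_ord j) (ltn_ord j) => {}j jlt.
  have b0 : 0 <= b := le_trans ler01 b1.
  have XX : N X * N X^-1 = 1 by rewrite -Normc.normcM mulfV// Normc.normc1.
  have [kj|jk] := leqP k j.
    rewrite -(subnKC kj) exprD mulrA -exprMn [N _ * N X]mulrC XX expr1n mul1r.
    apply: le_trans (_ : _ <= b ^+ (j - k)) _.
      by apply: lerXn2r; rewrite ?nnegrE ?normc_ge0.
    apply: ler_weXn2l => //; rewrite leq_subLR addnn -mul2n; by rewrite -ltnS.
  rewrite -(subnK (ltnW jk)) exprD -mulrA -exprMn [N _ * N X]mulrC XX expr1n mulr1.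
  apply: le_trans (_ : _ <= b ^+ (k - j)) _.
    by apply: lerXn2r; rewrite ?nnegrE ?normc_ge0.
  by apply: ler_weXn2l => //; rewrite leq_addr.
rewrite sumr_const card_ord -[leLHS]mulr_natl ler_wpM2r ?exprn_ge0 ?(le_trans ler01)//.
rewrite -natrX ler_nat; elim: k => // k IHk.
rewrite expnS; apply: leq_trans (leq_mul (leqnn 3) IHk).
by rewrite mulnS (mulnS 3) -addSn leq_add2l leq_pmull.
Qed.

Lemma geometric_tail (t : R) m : 0 <= t -> 2 * t <= 1 ->
  \sum_(k < m) t ^+ k.+1 <= 2 * t.
Proof.
move=> t0 t1; suff : \sum_(k < m) t ^+ k.+1 <= 2 * t - 2 * t ^+ m.+1.
  by move=> h; apply: le_trans h _; rewrite gerDl oppr_le0 mulr_ge0// exprn_ge0.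
elim: m => [|m IHm]; first by rewrite big_ord0 expr1 subrr.
rewrite big_ord_recr /=; apply: le_trans (lerD IHm (lexx _)) _.
have : t ^+ m.+1 * (2 * t) <= t ^+ m.+1 * 1 by rewrite ler_wpM2l// exprn_ge0.
by rewrite [t ^+ m.+2]exprS; move: (t ^+ m.+1) => A; clear; lra.
Qed.

Variable theta : C -> C -> C.
Hypothesis htheta : theta_function theta.
Variable tau : C.
Hypothesis tau0 : 0 < Im tau.

(* the factor [e2pii (w / 2)] turns the sign under [w -> w + 1] into periodicity *)
Let g (w : C) : C := e2pii (w / 2) * theta w tau.

Let hg w : holo g w.
Proof.
have h1 : holo (fun w : C => w / 2) w := holoM (holo_id w) (holo_cst 2^-1 w).
refine (holoM (holo_e2pii_comp h1) _).
by apply: (theta_holomorphic htheta).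
Qed.

Let g1 w : g (w + 1) = g w.
Proof.
by rewrite /g (theta_add1 htheta)// mulrDl mul1r e2piiD e2pii_half; ring.
Qed.

Let gtau w : g (w + tau) = - (e2pii (- w) * g w).
Proof.
rewrite /g (theta_addtau htheta)// mulrDl e2piiD.
have -> : e2pii (- tau / 2) = (e2pii (tau / 2))^-1 by rewrite mulNr e2piiN.
by field; exact: e2pii_neq0.
Qed.

Let a (m : int) : C := fcoef g 0 m.

Let a_line y m : fcoef g y m = a m.
Proof.
apply: (@fcoef_indep _ g (- (`|y| + 1)) (`|y| + 1)); first by move=> *; exact: hg.
- by move=> *; exact: g1.
- by rewrite -ltr_norml ltrDl ltr01.
- by rewrite -ltr_norml normr0 ltr_pwDr.
Qed.

(** Moving the line of integration by [tau] turns the quasi-periodicity into a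
    recurrence on the Fourier coefficients. *)
Let a_rec (m : int) : a (m + 1) = - (e2pii (m%:~R * tau) * a m).
Proof.
suff : a m = - (e2pii (- (m%:~R * tau)) * a (m + 1)).
  by move=> ->; rewrite e2piiN; field; exact: e2pii_neq0.
pose F (v : R) := g (v%:C%C + tau) * e2pii (- (m%:~R * (v%:C%C + tau))).
have FE v : F v = - e2pii (- (m%:~R * tau)) *
    hline (fun w => g w * e2pii (- ((m + 1)%:~R * w))) 0 v.
  rewrite /F gtau /hline; have -> : (v +i* 0)%C = v%:C%C by [].
  have -> : e2pii (- (m%:~R * (v%:C%C + tau))) = e2pii (- (m%:~R * v%:C%C)) * e2pii (- (m%:~R * tau)).
    by rewrite -e2piiD mulrDr opprD.
  have -> : e2pii (- ((m + 1)%:~R * v%:C%C)) = e2pii (- (m%:~R * v%:C%C)) * e2pii (- v%:C%C).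
    by rewrite -e2piiD; congr e2pii; rewrite intrD; ring.
  by ring.
have c0 : continuousC (hline (fun w => g w * e2pii (- ((m + 1)%:~R * w))) 0).
  by apply: hline_continuous => x; exact/continuous_mode/holo_continuous/hg.
have cL : continuousC (hline (fun w => g w * e2pii (- (m%:~R * w))) (Im tau)).
  by apply: hline_continuous => x; exact/continuous_mode/holo_continuous/hg.
have shiftE : F = fun v => hline (fun w => g w * e2pii (- (m%:~R * w))) (Im tau) (v + complex.Re tau).
  apply/funext => v; rewrite /F /hline.
  have -> // : (v%:C%C + tau) = ((v + complex.Re tau)%R +i* Im tau)%C.
  by case: tau => s t; apply/eqP; rewrite eq_complex /= add0r !eqxx.
rewrite -(a_line (Im tau)) /fcoef -(mean_shift (complex.Re tau) cL); last first.
  move=> x; rewrite /hline; have -> : ((x + 1)%R +i* Im tau)%C = (x +i* Im tau)%C + 1 :> C.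
    by apply/eqP; rewrite eq_complex /= addr0 !eqxx.
  by apply: periodic_mode; exact: g1.
by rewrite -shiftE (funext FE) meanZ// mulNr.
Qed.

Let a_neg (k : nat) : a (- k%:Z) = - a k.+1%:Z.
Proof.
have aS j : a j.+1%:Z = - (e2pii (j%:R * tau) * a j%:Z).
  by rewrite -[j%:R]/(j%:Z%:~R) -a_rec -PoszD addn1.
elim: k => [|k IHk]; first by rewrite oppr0 (aS 0%N) mul0r e2pii0 mul1r opprK.
have := a_rec (- k.+1%:Z).
have -> : - k.+1%:Z + 1 = - k%:Z by rewrite -addn1 PoszD opprD subrK.
rewrite IHk (aS k.+1) mulrNz mulNr e2piiN -[k.+1%:Z%:~R]/(k.+1%:R) opprK => /eqP.
rewrite eqr_opp => /eqP ->.
by rewrite mulrA mulfV ?mul1r// e2pii_neq0.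
Qed.

Let Q : R := expR (- (2 * pi) * Im tau).

Let a_pos (k : nat) : exists u : C, a k.+1%:Z = a 1 * u /\ N u <= Q ^+ k.
Proof.
elim: k => [|k [u [uE uQ]]]; first by exists 1; rewrite mulr1 Normc.normc1.
exists (- e2pii (k.+1%:R * tau) * u); split.
  have -> : k.+2%:Z = k.+1%:Z + 1 by rewrite -PoszD addn1.
  by rewrite a_rec uE -[k.+1%:Z%:~R]/(k.+1%:R); ring.
rewrite Normc.normcM normcN e2piiMn normcX normc_e2pii -/Q exprS.
have Q0 : 0 <= Q by exact: expR_ge0.
have Q1 : Q <= 1.
  by rewrite expR_le1 mulNr oppr_le0 mulr_ge0 ?mulr_ge0 ?ltW// ?pi_gt0.
apply: ler_pM => //; rewrite ?mulr_ge0 ?exprn_ge0 ?normc_ge0//.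
by rewrite ler_piMr// exprn_ile1.
Qed.

(** The leading two modes [1] and [0] of [e2pii (z / 2) * theta z] already
    form a multiple of [e2pii z - 1]; the others are relatively small. *)
Lemma theta_approx (B : R) : 0 <= B -> 6 * (Q * expR (2 * pi * B)) <= 1 ->
  exists c : C, forall z : C, `|Im z| <= B ->
    N (e2pii (z / 2) * theta z tau - c * (e2pii z - 1)) <=
    6 * (Q * expR (2 * pi * B)) * N (c * (e2pii z - 1)).
Proof.
move=> B0 small; set b := expR _ in small *; exists (a 1) => z zB.
have p0 : 0 < 2 * pi :> R by rewrite mulr_gt0// pi_gt0.
have b1 : 1 <= b by rewrite -expR0 ler_expR mulr_ge0// ltW.
have Q0 : 0 <= Q by exact: expR_ge0.
have b0 : 0 <= b by exact: expR_ge0.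
set X := e2pii z; have X0 : X != 0 by exact: e2pii_neq0.
move: zB; rewrite ler_norml => /andP[zB1 zB2].
have Xb : N X <= b.
  by rewrite normc_e2pii ler_expR mulNr -mulrN ler_pM2l// lerNl.
have Xb' : N X^-1 <= b.
  by rewrite -e2piiN normc_e2pii ler_expR ImN mulrNN ler_pM2l.
pose t := 3 * (Q * b); have t0 : 0 <= t by rewrite !mulr_ge0.
have t1 : 2 * t <= 1 by rewrite /t; move: small; lra.
apply/ler_addgt0Pr => e e0.
have [n0 hn0] : exists n0 : nat, forall K L : nat, (n0 <= K)%N -> (n0 <= L)%N ->
    N (\sum_(k < K) fcoef g 0 k%:Z * e2pii (k%:R * z)
     + \sum_(k < L) fcoef g 0 (- k.+1%:Z) * e2pii (- (k.+1%:R * z)) - g z) <= e.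
  apply: (@laurent _ g (- (`|Im z| + 1)) (`|Im z| + 1)) => //.
  - by rewrite -ltr_norml ltrDl ltr01.
  - by rewrite -ltr_norml normr0 ltr_pwDr.
have := hn0 n0.+2 n0 (leqW (leqnSn _)) (leqnn _).
rewrite -/(g z).
have -> : \sum_(k < n0.+2) fcoef g 0 k%:Z * e2pii (k%:R * z) +
    \sum_(k < n0) fcoef g 0 (- k.+1%:Z) * e2pii (- (k.+1%:R * z)) =
    \sum_(k < n0.+1) a k.+1%:Z * (X ^+ k.+1 - X ^- k).
  rewrite [RHS](eq_bigr (fun k : 'I_ _ => a k.+1%:Z * X ^+ k.+1 + a (- k%:Z) * X ^- k)); last first.
    by move=> k _; rewrite a_neg; ring.
  rewrite big_split /= big_ord_recl [X in _ = _ + X]big_ord_recl /=.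
  rewrite oppr0 expr0 invr1 mulr1 mul0r e2pii0 mulr1 [fcoef _ _ _ + _]addrC -addrA.
  congr (_ + (_ + _)); apply: eq_bigr => k _; first by rewrite -e2piiMn.
  by rewrite e2piiN e2piiMn.
set S := \sum_(k < _) _ => hS.
have {}hS' : N (S - a 1 * (X - 1)) <= 6 * (Q * b) * N (a 1 * (X - 1)).
  rewrite /S big_ord_recl /= expr0 invr1 expr1 addrAC subrr add0r.
  apply: le_trans (normc_sum _ _ _) _.
  apply: le_trans (_ : _ <= \sum_(k < n0) N (a 1 * (X - 1)) * t ^+ k.+1) _.
    apply: ler_sum => k _; have [u [-> uQ]] := a_pos (lift ord0 k).
    have [U [-> UB]] := mode_pair (lift ord0 k) X0 b1 Xb Xb'.
    rewrite (_ : _ * _ = a 1 * (X - 1) * (u * U)); last by ring.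
    rewrite Normc.normcM ler_wpM2l ?normc_ge0// Normc.normcM /t.
    rewrite (_ : (3 * (Q * b)) ^+ k.+1 = Q ^+ k.+1 * (3 ^+ k.+1 * b ^+ k.+1)); last by rewrite !exprMn; ring.
    by apply: ler_pM; rewrite ?normc_ge0.
  rewrite -mulr_sumr mulrC ler_wpM2r ?normc_ge0//.
  by apply: le_trans (geometric_tail _ t0 t1) _; rewrite /t; lra.
have := normcBD (S - a 1 * (X - 1)) (S - g z).
rewrite (_ : _ - _ - _ = g z - a 1 * (X - 1)); last by ring.
by move=> h; apply: le_trans h _; rewrite lerD.
Qed.

End ThetaAsymptotics.

(** * Asymptotics of normalised theta functions *)

Section KernelLimit.
Variable R : realType.
Local Notation C := R[i].
Local Notation N := (@Normc.normc R).
Local Notation Im := (@complex.Im R).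
Local Notation T := (two_pi_i R).

(** A function with a simple pole of residue 1 differs from [x^-1] by less
    than a pole. *)
Lemma simple_pole (u v : C -> C) : continuousCC u 0 -> u 0 = 1 ->
  (forall e, 0 < e -> exists2 d, 0 < d & forall x, N x < d -> N (v x - x) <= e * N x) ->
  forall e, 0 < e -> exists2 d, 0 < d & forall x, 0 < N x < d ->
    N (x * (u x / v x - x^-1)) <= e.
Proof.
move=> cu u0 hv e e0; pose t := Num.min (1 / 2) (e / 4).
have t0 : 0 < t by rewrite lt_min !divr_gt0.
have [t1 t2] : t <= 1 / 2 /\ t <= e / 4 by rewrite /t; split; rewrite ge_min lexx ?orbT.
clearbody t.
have [d1 d10 h1] := cu t t0; have [d2 d20 h2] := hv t t0.
exists (Num.min d1 d2) => [|x]; first by rewrite lt_min d10.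
rewrite lt_min => /andP[x0 /andP[xd1 xd2]].
have := h1 x; rewrite subr0 u0 => /(_ xd1) {}h1; have {}h2 := h2 x xd2.
have xn : x != 0 by rewrite -normc_gt0.
have vlow : N x / 2 <= N (v x).
  have := normc_sub x (x - v x); rewrite (_ : x - (x - v x) = v x); last by ring.
  rewrite (normcB x); have : t * N x <= 1 / 2 * N x by rewrite ler_wpM2r// ltW.
  by move: h2; clear; lra.
have v0 : 0 < N (v x) by apply: lt_le_trans vlow; rewrite divr_gt0.
have vn : v x != 0 by rewrite -normc_gt0.
have -> : x * (u x / v x - x^-1) = (x * (u x - 1) - (v x - x)) / v x.
  by field; apply/andP.
rewrite Normc.normcM Normc.normcV ler_pdivrMr//.
apply: le_trans (normcBD _ _) _; rewrite Normc.normcM.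
have : N x * N (u x - 1) <= N x * t by rewrite ler_wpM2l// ltW.
have : t * N x <= e / 4 * N x by rewrite ler_wpM2r// ltW.
have : e * (N x / 2) <= e * N (v x) by rewrite ler_pM2l.
by move: h2; clear; lra.
Qed.

Lemma relative_error (A1 A2 A3 P1 P2 P3 : C) (h : R) : 0 <= h -> h <= 1 / 4 ->
  P1 != 0 -> P2 != 0 -> A1 != 0 -> A2 != 0 ->
  N (A1 - P1) <= h * N P1 -> N (A2 - P2) <= h * N P2 -> N (A3 - P3) <= h * N P3 ->
  N (A3 / (A1 * A2) - P3 / (P1 * P2)) <= 6 * h * N (P3 / (P1 * P2)).
Proof.
move=> h0 h4 P10 P20 A10 A20 e1 e2 e3.
have n1 : 0 < N P1 by rewrite normc_gt0.
have n2 : 0 < N P2 by rewrite normc_gt0.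
have low A P : N (A - P) <= h * N P -> 3 / 4 * N P <= N A.
  move=> e; have := normc_sub P (P - A); rewrite (_ : P - (P - A) = A); last by ring.
  rewrite (normcB P); have : h * N P <= 1 / 4 * N P by rewrite ler_wpM2r ?normc_ge0.
  by move: e; clear; lra.
have l1 := low _ _ e1; have l2 := low _ _ e2.
have a1 : 0 < N A1 by rewrite normc_gt0.
have a2 : 0 < N A2 by rewrite normc_gt0.
have -> : A3 / (A1 * A2) - P3 / (P1 * P2) =
    ((A3 - P3) * (P1 * P2) - P3 * ((A1 - P1) * P2 + A1 * (A2 - P2))) / (A1 * A2 * (P1 * P2)).
  by field; rewrite A10 A20 P10 P20.
rewrite !(Normc.normcM, Normc.normcV) ler_pdivrMr ?mulr_gt0//.
rewrite (_ : 6 * h * (N P3 / (N P1 * N P2)) * (N A1 * N A2 * (N P1 * N P2)) =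
  6 * h * N P3 * (N A1 * N A2)); last by field; rewrite !gt_eqF.
apply: le_trans (normcBD _ _) _; rewrite !Normc.normcM.
have p3 := normc_ge0 P3.
have u1 : N A1 <= 5 / 4 * N P1.
  have := normcD (A1 - P1) P1; rewrite subrK.
  have : h * N P1 <= 1 / 4 * N P1 by rewrite ler_wpM2r ?normc_ge0.
  by move: e1; clear; lra.
have s : N ((A1 - P1) * P2 + A1 * (A2 - P2)) <= 9 / 4 * h * (N P1 * N P2).
  apply: le_trans (normcD _ _) _; rewrite !Normc.normcM.
  have : N (A1 - P1) * N P2 <= h * N P1 * N P2 by rewrite ler_wpM2r ?normc_ge0.
  have : N A1 * N (A2 - P2) <= 5 / 4 * N P1 * (h * N P2).
    by apply: ler_pM => //; rewrite normc_ge0.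
  by clear; lra.
have b1 : N (A3 - P3) * (N P1 * N P2) <= h * N P3 * (N P1 * N P2).
  by rewrite ler_wpM2r// mulr_ge0 ?ltW.
have b2 : N P3 * N ((A1 - P1) * P2 + A1 * (A2 - P2)) <= N P3 * (9 / 4 * h * (N P1 * N P2)).
  by rewrite ler_wpM2l.
have b3 : 6 * h * N P3 * (3 / 4 * N P1 * (3 / 4 * N P2)) <= 6 * h * N P3 * (N A1 * N A2).
  rewrite ler_wpM2l ?mulr_ge0//; apply: ler_pM => //; rewrite mulr_ge0 ?divr_ge0 ?ltW//.
have b4 : 0 <= h * N P3 * (N P1 * N P2) by rewrite !mulr_ge0// ltW.
by move: b1 b2 b3 b4; clear; lra.
Qed.

Variable theta : C -> C -> C.
Hypothesis htheta : theta_function theta.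

Lemma theta0 tau : 0 < Im tau -> theta 0 tau = 0.
Proof.
move=> t0; have := theta_opp htheta 0 t0; rewrite oppr0 => /eqP.
rewrite -subr_eq0 opprK -mulr2n -mulr_natl mulf_eq0 pnatr_eq0 /=.
by move=> /eqP.
Qed.

Lemma theta_holo tau z : 0 < Im tau -> holo (fun x => theta x tau) z.
Proof. by move=> t0; apply: (theta_holomorphic htheta). Qed.

Lemma theta_expansion0 tau : 0 < Im tau -> forall e, 0 < e ->
  exists2 d, 0 < d & forall x, N x < d -> N (theta x tau - x) <= e * N x.
Proof.
move=> t0 e e0; have h := @theta_holo tau 0 t0.
have [c hc] := holo_expansion h.
have := holo_of_expansion hc; case=> _ dc.
have c1 : c = 1 by rewrite -dc; apply: (theta_derive0 htheta).
have [d d0 hd] := hc e e0; exists d => // x xd.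
by have := hd x; rewrite subr0 theta0// subr0 c1 mul1r; exact.
Qed.

(** The relative error of [theta_approx] on the strip of half-width [B]. *)
Definition theta_error (tau : C) (B : R) : R :=
  6 * (expR (- (2 * pi) * Im tau) * expR (2 * pi * B)).

Lemma e2pii_expansion0 e : 0 < e -> exists2 d, 0 < d & forall x : C, N x < d ->
  N (e2pii x - 1 - T * x) <= e * N x.
Proof.
move=> e0; have [d d0 hd] := e2pii_expansion (0 : C) e0; exists d => // x xd.
by have := hd x; rewrite subr0 e2pii0 mulr1; exact.
Qed.

(** The normalisation [theta' 0 = 1] determines the constant. *)
Lemma theta_asymptotics tau B : 0 < Im tau -> 0 <= B -> theta_error tau B <= 1 ->
  exists c : C, N (1 - c * T) <= theta_error tau B * N (c * T) /\
    forall z : C, `|Im z| <= B ->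
    N (e2pii (z / 2) * theta z tau - c * (e2pii z - 1)) <=
    theta_error tau B * N (c * (e2pii z - 1)).
Proof.
move=> t0 B0 small; have [c hc] := theta_approx htheta t0 B0 small.
exists c; split => //; set h := theta_error tau B.
have h0 : 0 <= h by rewrite !mulr_ge0// expR_ge0.
apply/ler_addgt0Pr => e e0.
pose L := h * N c + N c + 3.
have L0 : 0 < L by rewrite /L ltr_wpDl ?addr_ge0 ?mulr_ge0 ?normc_ge0.
pose t := Num.min 1 (e / L).
have t_gt0 : 0 < t by rewrite lt_min ltr01 divr_gt0.
have [t1 t2] : t <= 1 /\ t * L <= e.
  by rewrite -ler_pdivlMr// /t; split; rewrite ge_min lexx ?orbT.
clearbody t.
have [d1 d10 h1] := theta_expansion0 t0 t_gt0.
have [d2 d20 h2] := e2pii_expansion0 t_gt0.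
have ch : continuousCC (fun w : C => e2pii (w / 2)) 0.
  apply/holo_continuous/holo_e2pii_comp.
  exact: holoM (holo_id 0) (holo_cst 2^-1 0).
have [d3 d30 h3] := ch t t_gt0.
have dB : 0 < Num.min (Num.min d1 d2) (Num.min d3 1) by rewrite !lt_min d10 d20 d30 ltr01.
pose d := Num.min (Num.min d1 d2) (Num.min d3 1) / 2.
have d0 : 0 < d by rewrite divr_gt0.
have : d < Num.min (Num.min d1 d2) (Num.min d3 1) by rewrite /d; move: dB; clear; lra.
rewrite !lt_min => /andP[/andP[dd1 dd2] /andP[dd3 _]].
clearbody d; pose x : C := d%:C%C.
have Nx : N x = d by rewrite normc_real gtr0_norm.
have := h1 x; have := h2 x; have := h3 x.
rewrite subr0 mul0r e2pii0 Nx => /(_ dd3) {}h3 /(_ dd2) {}h2 /(_ dd1) {}h1.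
have {}hc : N (e2pii (x / 2) * theta x tau - c * (e2pii x - 1)) <= h * N (c * (e2pii x - 1)).
  by apply: hc; rewrite /= normr0.
rewrite -(ler_pM2r d0) -{1}Nx -Normc.normcM.
have tx : N (theta x tau) <= 2 * d.
  have := normcD (theta x tau - x) x; rewrite subrK Nx.
  have : t * d <= 1 * d by rewrite ler_wpM2r// ltW.
  by move: h1; clear; lra.
have E1 : N (c * (e2pii x - 1)) <= N (c * T) * d + N c * t * d.
  rewrite (_ : c * _ = c * T * x + c * (e2pii x - 1 - T * x)); last by ring.
  apply: le_trans (normcD _ _) _; rewrite Normc.normcM Nx lerD2l Normc.normcM -mulrA.
  by rewrite ler_wpM2l ?normc_ge0.
have E2 : N ((e2pii (x / 2) - 1) * theta x tau) <= t * (2 * d).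
  by rewrite Normc.normcM; apply: ler_pM; rewrite ?normc_ge0.
have E3 : N (c * (e2pii x - 1 - T * x)) <= N c * (t * d).
  by rewrite Normc.normcM ler_wpM2l ?normc_ge0.
have -> : (1 - c * T) * x = (e2pii (x / 2) * theta x tau - c * (e2pii x - 1))
    - (theta x tau - x) - ((e2pii (x / 2) - 1) * theta x tau) + c * (e2pii x - 1 - T * x).
  by ring.
apply: le_trans (normcD _ _) _; apply: le_trans (lerD (normcBD _ _) (lexx _)) _.
apply: le_trans (lerD (lerD (normcBD _ _) (lexx _)) (lexx _)) _.
have E4 : h * N (c * (e2pii x - 1)) <= h * (N (c * T) * d + N c * t * d) by rewrite ler_wpM2l.
have E5 : t * L * d <= e * d by rewrite ler_wpM2r// ltW.
by move: hc h1 E2 E3 E4 E5; rewrite /L; clear; lra.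
Qed.

Lemma theta_error_small B e : 0 < e -> exists M : R, forall tau : C, M < Im tau ->
  theta_error tau B <= e.
Proof.
move=> e0; have p0 : 0 < 2 * pi :> R by rewrite mulr_gt0// pi_gt0.
exists (B - ln (e / 6) / (2 * pi)) => tau.
move=> h; have h6 : 0 < e / 6 by rewrite divr_gt0.
rewrite /theta_error -expRD mulrC -ler_pdivlMr// -[leRHS]lnK ?posrE// ler_expR.
move: (2 * pi) p0 h => q q0; rewrite ltrBlDr => h.
have : q * B < q * (Im tau + ln (e / 6) / q) by rewrite ltr_pM2l.
rewrite mulrDr [q * (_ / _)]mulrC divfK ?gt_eqF//; clear; lra.
Qed.

End KernelLimit.

(** * Convergence of the coefficients of the kernel *)

Section KernelCoefficients.
Variable R : realType.
Local Notation C := R[i].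
Local Notation N := (@Normc.normc R).
Local Notation Im := (@complex.Im R).
Local Notation T := (two_pi_i R).
Local Notation kappa := (@kzb_kernel_limit R).

Lemma intr_small_eq0 (k : int) : `|k%:~R : R| < 1 -> k = 0.
Proof.
rewrite -intr_norm -[1]/(1%:~R) ltr_int => h.
by apply/eqP; rewrite -normr_le0 -ltzD1.
Qed.

Lemma e2pii_neq1 (x : C) : 0 < N x < 1 -> e2pii x != 1.
Proof.
move=> /andP[x0 x1]; apply/eqP => /e2pii_eq1[k xk].
have Nx : N x = `|k%:~R| by rewrite xk -(rmorph_int (real_complex R)) normc_real.
have k0 : k = 0 by apply: intr_small_eq0; rewrite -Nx.
by rewrite Nx k0 normr0 ltxx in x0.
Qed.

Lemma kappa_holo x : 0 < N x < 1 -> holo kappa x.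
Proof.
move=> x01; have x0 : x != 0 by case/andP: x01; rewrite normc_gt0.
have e1 := e2pii_neq1 x01.
have hE := @holo_e2pii R x.
have h1 : holo (fun w : C => T * e2pii w) x := holoM (holo_cst T x) hE.
have h2 : holo (fun w : C => (e2pii w - 1)^-1) x.
  by apply: (holoV _ (holoB hE (holo_cst 1 x))); rewrite subr_eq0.
have h3 : holo (fun w : C => w^-1) x by apply: (holoV _ (holo_id x)).
refine (holoB (holoM h1 h2) h3).
Qed.

Lemma kappa_pole e : 0 < e -> exists2 d, 0 < d & forall x, 0 < N x < d ->
  N (x * kappa x) <= e.
Proof.
move=> e0.
have hv t : 0 < t -> exists2 d, 0 < d & forall x : C, N x < d ->
    N ((e2pii x - 1) / T - x) <= t * N x.
  move=> t0; have T0 : 0 < N T by rewrite normc_gt0 two_pi_i_neq0.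
  have [d d0 hd] := e2pii_expansion0 (mulr_gt0 t0 T0).
  exists d => // x /hd h.
  rewrite (_ : _ - x = (e2pii x - 1 - T * x) / T); last by field; exact: two_pi_i_neq0.
  by rewrite Normc.normcM Normc.normcV ler_pdivrMr// mulrAC.
have [d d0 hd] := @simple_pole R (@e2pii R) (fun x => (e2pii x - 1) / T)
  (holo_continuous (holo_e2pii 0)) (e2pii0 R) hv e e0.
exists d => // x /hd; rewrite /kzb_kernel_limit invf_div.
by rewrite (_ : e2pii x * (T / (e2pii x - 1)) = T * e2pii x / (e2pii x - 1)) // mulrCA mulrA.
Qed.

Variable theta : C -> C -> C.
Hypothesis htheta : theta_function theta.
Variable zeta : C.
Hypothesis zeta1 : e2pii zeta <> 1.

(** As [Im tau] grows, the kernel tends to the limit kernel shifted by this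
    constant, which gives the rational part of the trigonometric connection. *)
Definition kernel_shift : C := T / (e2pii zeta - 1).

Let Finf (x : C) : C := T * (e2pii (zeta + x) - 1) / ((e2pii zeta - 1) * (e2pii x - 1)).

Let FinfE x : 0 < N x < 1 -> Finf x = kappa x + kernel_shift + x^-1.
Proof.
move=> x01; have x0 : x != 0 by case/andP: x01; rewrite normc_gt0.
have e1 := e2pii_neq1 x01.
rewrite /Finf /kernel_shift /kzb_kernel_limit e2piiD.
move: zeta1 e1 => /eqP; move: (e2pii zeta) (e2pii x) T => Z X t Z1 X1; field.
by rewrite x0 !subr_eq0 Z1 X1.
Qed.

Section LargeTau.
Variable tau : C.
Hypotheses (tau1 : 1 <= Im tau) (tauz : `|Im zeta| < Im tau).

Let tau0 : 0 < Im tau. Proof. exact: lt_le_trans tau1. Qed.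

Let Im_lattice (m n : int) : Im (m%:~R + n%:~R * tau) = n%:~R * Im tau.
Proof. by rewrite ImD Im_intM -(rmorph_int (real_complex R)) /= add0r. Qed.

Let lattice_real z m n : z = m%:~R + n%:~R * tau -> `|Im z| < Im tau -> z = m%:~R.
Proof.
move=> -> ; rewrite Im_lattice normrM (gtr0_norm tau0) gtr_pMl// => /intr_small_eq0 ->.
by rewrite mul0r addr0.
Qed.

Let theta_eq0 z : theta z tau = 0 -> `|Im z| < Im tau -> exists m : int, z = m%:~R.
Proof.
move=> z0 zt; have : [set z | theta z tau = 0] z by [].
by rewrite (theta_zeros htheta)// => -[m [n E]]; exists m; exact: (lattice_real E).
Qed.

Lemma theta_zeta_neq0 : theta zeta tau != 0.
Proof.
apply/eqP => /theta_eq0/(_ tauz)[m zm].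
by apply: zeta1; rewrite zm e2pii_int.
Qed.

Lemma theta_small_neq0 x : 0 < N x < 1 -> theta x tau != 0.
Proof.
move=> x01; apply/eqP => /theta_eq0[|m xm].
  apply: le_lt_trans (ler_normc_Im _) _; case/andP: x01 => _ h.
  exact: lt_le_trans h tau1.
by have := e2pii_neq1 x01; rewrite xm e2pii_int eqxx.
Qed.

Let num_holo x : holo (fun x => theta (zeta + x) tau) x.
Proof.
have h1 : holo (fun x : C => zeta + x) x := holoD (holo_cst zeta x) (holo_id x).
refine (@holo_comp R (fun w => theta w tau) _ x h1 _).
exact: (theta_holo htheta).
Qed.

Lemma kernel_holo x : 0 < N x < 1 -> holo (fun x => kzb_kernel theta zeta x tau) x.
Proof.
move=> x01; have x0 : x != 0 by case/andP: x01; rewrite normc_gt0.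
have h2 : holo (fun x => (theta zeta tau * theta x tau)^-1) x.
  have h1 : holo (fun x => theta zeta tau * theta x tau) x.
    refine (holoM (holo_cst (theta zeta tau) x) (@theta_holo _ _ htheta tau x tau0)).
  refine (holoV _ h1).
  by rewrite mulf_neq0 ?theta_zeta_neq0 ?theta_small_neq0.
have h3 : holo (fun w : C => w^-1) x by apply: (holoV _ (holo_id x)).
refine (holoB (holoM (@num_holo x) h2) h3).
Qed.

Lemma kernel_pole e : 0 < e -> exists2 d, 0 < d & forall x, 0 < N x < d ->
  N (x * kzb_kernel theta zeta x tau) <= e.
Proof.
move=> e0.
have cu : continuousCC (fun x => theta (zeta + x) tau / theta zeta tau) 0.
  by apply: holo_continuous; refine (holoM (@num_holo 0) (holo_cst _ 0)).
have u0 : theta (zeta + 0) tau / theta zeta tau = 1 by rewrite addr0 divff// theta_zeta_neq0.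
have [d d0 hd] := simple_pole cu u0 (theta_expansion0 htheta tau0) e0.
exists d => // x /hd; rewrite /kzb_kernel.
by rewrite -mulrA -invfM.
Qed.

(** The exponential prefactors cancel in the ratio of theta functions. *)
Lemma kernel_approx x : theta_error tau (`|Im zeta| + 1) <= 1 / 4 -> 0 < N x < 1 ->
  N (kzb_kernel theta zeta x tau - (kappa x + kernel_shift)) <=
  9 * theta_error tau (`|Im zeta| + 1) * N (kappa x + kernel_shift + x^-1).
Proof.
set B := `|Im zeta| + 1; set h := theta_error tau B => h4 x01.
have B0 : 0 <= B by rewrite addr_ge0.
have h0 : 0 <= h by rewrite !mulr_ge0// expR_ge0.
have h1 : h <= 1 by move: h4; lra.
have [c [cT hc]] := theta_asymptotics htheta tau0 B0 h1.
have x1 : `|Im x| <= 1 by apply: le_trans (ler_normc_Im _) _; case/andP: x01 => _ /ltW.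
have c0 : c != 0.
  apply/eqP => c0; move: cT; rewrite c0 mul0r subr0 Normc.normc0 mulr0 Normc.normc1.
  by rewrite ler10.
have cT45 : 4 / 5 <= N (c * T).
  have := normcD (1 - c * T) (c * T); rewrite subrK Normc.normc1.
  have : h * N (c * T) <= 1 / 4 * N (c * T) by rewrite ler_wpM2r ?normc_ge0.
  by move: cT; rewrite -/h; lra.
have ex1 := e2pii_neq1 x01; have ez1 : e2pii zeta != 1 by apply/eqP.
rewrite -FinfE//; set A1 := e2pii (zeta / 2) * theta zeta tau.
set A2 := e2pii (x / 2) * theta x tau.
set A3 := e2pii ((zeta + x) / 2) * theta (zeta + x) tau.
set P1 := c * (e2pii zeta - 1); set P2 := c * (e2pii x - 1).
set P3 := c * (e2pii (zeta + x) - 1).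
have p10 : P1 != 0 by rewrite mulf_neq0// subr_eq0.
have p20 : P2 != 0 by rewrite mulf_neq0// subr_eq0.
have tz0 := theta_zeta_neq0; have tx0 := theta_small_neq0 x01.
have a10 : A1 != 0 by rewrite mulf_neq0// e2pii_neq0.
have a20 : A2 != 0 by rewrite mulf_neq0// e2pii_neq0.
have e1 : N (A1 - P1) <= h * N P1 by apply: hc; rewrite lerDl.
have e2 : N (A2 - P2) <= h * N P2 by apply: hc; apply: le_trans x1 _; rewrite lerDr.
have e3 : N (A3 - P3) <= h * N P3.
  by apply: hc; rewrite ImD; apply: le_trans (ler_normD _ _) _; rewrite lerD2l.
have := relative_error h0 h4 p10 p20 a10 a20 e1 e2 e3.
have FE : kzb_kernel theta zeta x tau = A3 / (A1 * A2) - x^-1.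
  rewrite /kzb_kernel /A1 /A2 /A3 mulrDl e2piiD; congr (_ - _).
  by field; rewrite !e2pii_neq0 tz0 tx0.
have FiE : Finf x = c * T * (P3 / (P1 * P2)).
  rewrite /Finf /P1 /P2 /P3; field.
  by rewrite c0 !subr_eq0 ex1 ez1.
have kE : kappa x + kernel_shift = Finf x - x^-1 by rewrite FinfE// addrK.
rewrite FE kE FiE.
set p := P3 / (P1 * P2); set F := A3 / (A1 * A2) => Fp.
rewrite (_ : F - x^-1 - (c * T * p - x^-1) = (F - p) + (1 - c * T) * p); last by ring.
apply: le_trans (normcD _ _) _; rewrite !(Normc.normcM _ p).
have pp := normc_ge0 p.
have : N (1 - c * T) * N p <= h * N (c * T) * N p by rewrite ler_wpM2r.
have : 6 * h * N p * (4 / 5) <= 6 * h * N p * N (c * T) by rewrite ler_wpM2l// !mulr_ge0.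
have : 0 <= h * N p * N (c * T) by rewrite !mulr_ge0 ?normc_ge0.
by move: Fp; lra.
Qed.

End LargeTau.

Lemma kappa_power_series : has_power_series kappa (tcoef kappa (1 / 2)).
Proof.
apply: (@tcoef_is_power_series _ _ 1); first by rewrite divr_gt0//=; lra.
  exact: kappa_holo.
exact: kappa_pole.
Qed.

Lemma has_power_seriesD_cst f c s : has_power_series f c ->
  has_power_series (fun x => f x + s) (fun k => c k + if k == 0%N then s else 0 : C).
Proof.
move=> [r r0 hf]; exists r => // x xr e e0; have [n0 hn0] := hf x xr e e0.
exists (maxn n0 1) => K; rewrite geq_max => /andP[/hn0 h K1].
rewrite (_ : _ - _ = \sum_(k < K) c k * x ^+ k - f x)//.
under eq_bigr do rewrite mulrDl; rewrite big_split /=.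
case: K K1 {h} => // K _; rewrite [X in _ + X - _]big_ord_recl /= expr0 mulr1.
rewrite [X in _ + (_ + X) - _]big1 => [|k _]; last by rewrite mul0r.
by rewrite addr0; ring.
Qed.

(** Coefficients are means over the circle of radius 1/2, on which the kernel
    converges uniformly. *)
Theorem kernel_coef_cvg k e : 0 < e -> exists M : R, forall tau : C, M < Im tau ->
  N (power_series_at0 (fun x => kzb_kernel theta zeta x tau) k -
     (power_series_at0 kappa k + if k == 0%N then kernel_shift else 0)) <= e.
Proof.
move=> e0; pose F x := kappa x + kernel_shift.
have half01 : 0 < (1 / 2 : R) < 1 by rewrite divr_gt0//=; lra.
have onc (x : C) : N x = 1 / 2 -> 0 < N x < 1 by move=> ->.
have hF x : N x = 1 / 2 -> holo F x.
  by move=> /onc x01; refine (holoD (kappa_holo x01) (holo_cst _ x)).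
pose y : R := circle_height (1 / 2).
have on_circle t : N (e2pii (t +i* y)%C) = 1 / 2.
  by rewrite normc_e2pii /= circle_heightK// divr_gt0.
pose G (w : C) := F (e2pii w) + (e2pii w)^-1.
have [K K0 hK] : exists2 K, 0 <= K & forall t, 0 <= t <= 1 -> N (G (t +i* y)%C) <= K.
  apply: (@continuousC_bounded _ (hline G y)); apply: hline_continuous => t.
  apply: holo_continuous; set w := (t +i* y)%C.
  have h1 : holo (fun w => F (e2pii w)) w.
    by refine (@holo_comp R F (@e2pii R) w (holo_e2pii w) (hF _ (on_circle t))).
  refine (holoD h1 (holoV (e2pii_neq0 w) (holo_e2pii w))).
pose L := 18 * K * 2 ^+ k + 1.
have L0 : 0 < L by rewrite /L ltr_wpDl// !mulr_ge0// exprn_ge0.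
pose h0 := Num.min (1 / 4) (e / L).
have h00 : 0 < h0 by rewrite lt_min !divr_gt0.
have [M0 hM0] := theta_error_small (`|Im zeta| + 1) h00.
exists (Num.max M0 (Num.max 1 `|Im zeta|)) => tau; rewrite !gt_max => /andP[/hM0 he /andP[/ltW t1 tz]].
have [he1 he2] : theta_error tau (`|Im zeta| + 1) <= 1 / 4 /\ theta_error tau (`|Im zeta| + 1) <= e / L.
  by move: he; rewrite le_min => /andP[].
have hk := kernel_holo t1 tz.
have half : 0 < (1 / 2 : R) < 1 by [].
have ps : has_power_series (fun x => kzb_kernel theta zeta x tau)
    (tcoef (fun x => kzb_kernel theta zeta x tau) (1 / 2)).
  by apply: (@tcoef_is_power_series _ _ 1 _ half hk); exact: kernel_pole.
rewrite (power_series_at0_eq ps) (power_series_at0_eq kappa_power_series).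
have psF : has_power_series F (tcoef F (1 / 2)).
  apply: (@tcoef_is_power_series _ _ 1 _ half).
    by move=> x x01; refine (holoD (kappa_holo x01) (holo_cst _ x)).
  move=> t t0; have [d d0 hd] := kappa_pole (divr_gt0 t0 (ltr0n R 2)).
  have s1 : 0 < N kernel_shift + 1 by rewrite ltr_wpDl ?normc_ge0.
  exists (Num.min d (t / 2 / (N kernel_shift + 1))) => [|x]; first by rewrite lt_min d0 !divr_gt0.
  rewrite lt_min => /andP[x0 /andP[xd]]; rewrite ltr_pdivlMr// => xs.
  have := hd x; rewrite x0 xd => /(_ isT) {}hd.
  rewrite /F mulrDr; apply: le_trans (normcD _ _) _.
  rewrite [N (x * kernel_shift)]Normc.normcM.
  by move: xs hd (ltW x0); rewrite mulrDr mulr1; lra.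
have /(congr1 (@^~ k))/= -> :=
  power_series_unique (has_power_seriesD_cst kernel_shift kappa_power_series) psF.
have diff_le t : 0 <= t <= 1 -> let x := e2pii (t +i* circle_height (1 / 2))%C in
    N (kzb_kernel theta zeta x tau - F x) <= e / L * 9 * K.
  move=> t01 /=; apply: le_trans (kernel_approx t1 tz he1 (onc _ (on_circle t))) _.
  rewrite [9 * _]mulrC; apply: ler_pM; rewrite ?mulr_ge0 ?normc_ge0 ?expR_ge0//.
    by rewrite ler_wpM2r.
  exact: hK.
have half0 : 0 < 1 / 2 :> R by case/andP: half.
apply: le_trans (tcoef_diff_le k half0 (fun x xc => hk x (onc x xc)) hF diff_le) _.
rewrite div1r invrK (_ : _ * _ = 18 * K * 2 ^+ k / L * e); last by ring.
by rewrite ler_piMl ?(ltW e0)// ler_pdivrMr// mul1r /L lerDl ler01.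
Qed.

End KernelCoefficients.

(** * Parity and addition theorem for the limit kernel *)

Section KernelIdentities.
Variable R : realType.
Local Notation C := R[i].
Local Notation N := (@Normc.normc R).
Local Notation T := (two_pi_i R).
Local Notation kappa := (@kzb_kernel_limit R).

Definition kcoef : nat -> C := power_series_at0 kappa.

Lemma kcoef_power_series : has_power_series kappa kcoef.
Proof. by rewrite /kcoef (power_series_at0_eq (kappa_power_series R)); exact: kappa_power_series. Qed.

Lemma has_power_series_oppV f c : has_power_series f c ->
  has_power_series (fun x => - f (- x)) (fun k => - ((-1) ^+ k * c k) : C).
Proof.
move=> [r r0 hf]; exists r => // x xr e e0.
have xr' : 0 < N (- x) < r by rewrite normcN.
have [n0 hn0] := hf (- x) xr' e e0; exists n0 => K /hn0.
rewrite -normcN opprB addrC; congr (N (_ + _) <= e).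
  rewrite -sumrN; apply: eq_bigr => k _.
  by rewrite [in LHS]exprNn [RHS]mulNr [in LHS]mulrCA mulrA.
by rewrite opprK.
Qed.

Lemma has_power_series_ext f g c : (forall x, 0 < N x < 1 -> f x = g x) ->
  has_power_series f c -> has_power_series g c.
Proof.
move=> fg [r r0 hf]; exists (Num.min r 1) => [|x]; first by rewrite lt_min r0 ltr01.
rewrite lt_min => /andP[x0 /andP[xr x1]] e e0.
rewrite -fg ?x0//; apply: hf => //; by rewrite x0.
Qed.

(** The kernel is [pi i] plus an odd function. *)
Lemma kcoef_parity k : kcoef k = - ((-1) ^+ k * kcoef k) + if k == 0%N then T else 0.
Proof.
have h := has_power_seriesD_cst T (has_power_series_oppV kcoef_power_series).
have h2 : has_power_series (fun x => - kappa (- x) + T) kcoef.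
  apply: has_power_series_ext kcoef_power_series => x x01.
  have e1 := e2pii_neq1 x01; have E0 := e2pii_neq0 x.
  have x0 : x != 0 by case/andP: x01; rewrite normc_gt0.
  rewrite /kzb_kernel_limit e2piiN; move: (e2pii x) T e1 E0 => E t e1 E0; field.
  by rewrite x0 E0 mulN1r !subr_eq0 [1 == _]eq_sym e1.
by have /(congr1 (@^~ k)) := power_series_unique h2 h.
Qed.

Lemma kcoef0 : kcoef 0 = T / 2.
Proof.
have := kcoef_parity 0; rewrite expr0 mul1r /= => h.
have h2 : kcoef 0 * 2 = T by rewrite mulr_natr mulr2n {1}h addrAC addNr add0r.
by rewrite -h2 mulfK// pnatr_eq0.
Qed.

Lemma kcoef_even k : ~~ odd k -> k != 0%N -> kcoef k = 0.
Proof.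
move=> ek k0; have := kcoef_parity k; rewrite (negPf k0) addr0 -signr_odd (negPf ek) mul1r.
move=> /eqP; rewrite -subr_eq0 opprK -mulr2n -mulr_natr mulf_eq0 pnatr_eq0 orbF.
by move=> /eqP.
Qed.

(** [f x = O (x ^ n)] at the origin. *)
Definition small_order n (f : C -> C) := exists M r, [/\ 0 <= M, 0 < r &
  forall x, 0 < N x < r -> N (f x) <= M * N x ^+ n].

Lemma small_orderD n f g : small_order n f -> small_order n g ->
  small_order n (fun x => f x + g x).
Proof.
move=> [M [r [M0 r0 hf]]] [M' [r' [M'0 r'0 hg]]]; exists (M + M'), (Num.min r r').
split; [exact: addr_ge0|by rewrite lt_min r0|move=> x].
rewrite lt_min => /andP[x0 /andP[xr xr']]; apply: le_trans (normcD _ _) _.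
by rewrite mulrDl lerD// ?hf ?hg// x0.
Qed.

Lemma small_orderM m n f g : small_order m f -> small_order n g ->
  small_order (m + n) (fun x => f x * g x).
Proof.
move=> [M [r [M0 r0 hf]]] [M' [r' [M'0 r'0 hg]]]; exists (M * M'), (Num.min r r').
split; [exact: mulr_ge0|by rewrite lt_min r0|move=> x].
rewrite lt_min => /andP[x0 /andP[xr xr']]; rewrite Normc.normcM exprD mulrACA.
by apply: ler_pM; rewrite ?normc_ge0// ?hf ?hg// x0.
Qed.

Lemma small_order_horner (p : {poly C}) : small_order 0 (fun x => p.[x]).
Proof.
exists (\sum_(i < size p) N p`_i), 1; split => //.
  by apply: sumr_ge0 => i _; exact: normc_ge0.
by move=> x /andP[_ x1]; rewrite expr0 mulr1 normc_horner_le// ltW.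
Qed.

Lemma small_order_cst c : small_order 0 (fun=> c : C).
Proof. by exists (N c), 1; split => // [|x _]; rewrite ?normc_ge0// expr0 mulr1. Qed.

Lemma small_order_id : small_order 1 id.
Proof. by exists 1, 1; split => // x _; rewrite mul1r expr1. Qed.

Lemma small_orderN n f : small_order n f -> small_order n (fun x => - f x).
Proof. by move=> [M [r [M0 r0 hf]]]; exists M, r; split => // x /hf; rewrite normcN. Qed.

Lemma small_orderB n f g : small_order n f -> small_order n g ->
  small_order n (fun x => f x - g x).
Proof. by move=> hf /small_orderN; exact: small_orderD. Qed.

Lemma small_order_ext n f g r : 0 < r -> (forall x, 0 < N x < r -> f x = g x) ->
  small_order n f -> small_order n g.
Proof.
move=> r0 fg [M [r' [M0 r'0 hf]]]; exists M, (Num.min r r'); split=> //.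
  by rewrite lt_min r0.
by move=> x; rewrite lt_min => /andP[x0 /andP[xr xr']]; rewrite -fg ?hf// x0.
Qed.

Lemma small_orderZ n c f : small_order n f -> small_order n (fun x => f x * c).
Proof. by move=> hf; have := small_orderM hf (small_order_cst c); rewrite addn0. Qed.

Lemma small_order_lower n f : small_order n f -> small_order 0 f.
Proof.
move=> [M [r [M0 r0 hf]]]; exists M, (Num.min r 1); split=> //.
  by rewrite lt_min r0 ltr01.
move=> x; rewrite lt_min => /andP[x0 /andP[xr x1]]; rewrite expr0.
have /le_trans : N (f x) <= M * N x ^+ n by apply: hf; rewrite x0.
by apply; rewrite ler_wpM2l// exprn_ile1// ltW.
Qed.

(** Truncations in [lambda] of [kappa (lambda * A)]. *)
Definition ktrunc n (A : C) : {poly C} := \poly_(i < n) (kcoef i * A ^+ i).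

Lemma ktrunc_order n (A : C) : A != 0 ->
  small_order n (fun x => kappa (x * A) - (ktrunc n A).[x]).
Proof.
move=> A0; have a0 : 0 < N A by rewrite normc_gt0.
have [M [r [M0 r0 h]]] := power_series_truncation kcoef_power_series n.
exists (M * N A ^+ n), (r / N A); split.
- by rewrite mulr_ge0// exprn_ge0// ltW.
- by rewrite divr_gt0.
move=> x /andP[x0]; rewrite ltr_pdivlMr// -Normc.normcM => xr.
have := h (x * A); rewrite xr normc_gt0 mulf_neq0 -?normc_gt0// => /(_ isT).
rewrite Normc.normcM exprMn mulrA mulrAC; congr (N (_ - _) <= _).
by rewrite horner_poly; apply: eq_bigr => i _; rewrite exprMn; ring.
Qed.

Lemma e2pii_near1 (A : C) : A != 0 ->
  exists2 r, 0 < r & forall x, 0 < N x < r -> e2pii (x * A) != 1.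
Proof.
move=> A0; have a0 : 0 < N A by rewrite normc_gt0.
exists (1 / N A) => [|x /andP[x0]]; first by rewrite divr_gt0.
rewrite ltr_pdivlMr// -Normc.normcM => h; apply: e2pii_neq1.
by rewrite h normc_gt0 mulf_neq0 -?normc_gt0.
Qed.

(** The cotangent addition theorem, in the form
    [p A * p B = p (A - B) * p B + p A * p (B - A)] with
    [p x = kappa x + x^-1]. *)
Lemma kappa_addition (A B : C) : A != 0 -> B != 0 -> A != B ->
  e2pii A != 1 -> e2pii B != 1 -> e2pii (A - B) != 1 ->
  kappa A * kappa B + kappa B / A + kappa A / B =
  kappa (A - B) * kappa B + kappa B / (A - B) + kappa (A - B) / B +
  (kappa A * kappa (B - A) + kappa (B - A) / A + kappa A / (B - A)).
Proof.
move=> A0 B0 AB; rewrite /kzb_kernel_limit -(opprB A B) !e2piiN !e2piiD !e2piiN.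
move: (e2pii_neq0 A) (e2pii_neq0 B); move: (e2pii A) (e2pii B) T => a b t a0 b0 a1 b1 ab1.
have ab : a - b != 0.
  by apply: contraNneq ab1 => /eqP; rewrite subr_eq0 => /eqP ->; rewrite divff.
have AB0 : A - B != 0 by rewrite subr_eq0.
field; rewrite AB0 A0 B0 a0 b0 !mulN1r ab (_ : b - a != 0) ?subr_eq0 ?a1 ?b1//.
by rewrite eq_sym -subr_eq0.
Qed.

(** The coefficient of [lambda ^ n] in the addition theorem at [lambda * A],
    [lambda * B]; the series are replaced by their truncations, the error being
    of higher order in [lambda]. *)
Lemma kcoef_addition n (A B : C) : A != 0 -> B != 0 -> A != B ->
  \sum_(i < n.+1) kcoef i * kcoef (n - i) *
    (A ^+ i * B ^+ (n - i) - (A - B) ^+ i * B ^+ (n - i) - A ^+ i * (B - A) ^+ (n - i))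
  + kcoef n.+1 * (B ^+ n.+1 / A + A ^+ n.+1 / B - B ^+ n.+1 / (A - B)
      - (A - B) ^+ n.+1 / B - (B - A) ^+ n.+1 / A - A ^+ n.+1 / (B - A)) = 0.
Proof.
move=> A0 B0 AB; have AB0 : A - B != 0 by rewrite subr_eq0.
have BA0 : B - A != 0 by rewrite -opprB oppr_eq0.
pose m := n.+2; pose P := ktrunc m; pose D A x := kappa (x * A) - (P A).[x].
have dO X : X != 0 -> small_order m (D X) by exact: ktrunc_order.
have coefP X i : (i < m)%N -> (P X)`_i = kcoef i * X ^+ i.
  by move=> im; rewrite coef_poly im.
have pO X : small_order 0 (fun x => (P X).[x]) := small_order_horner _.
have kO X : X != 0 -> small_order 0 (fun x => kappa (x * X)).
  move=> X0; have := small_orderD (small_order_lower (dO X X0)) (pO X).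
  by apply: (@small_order_ext _ _ _ 1) => // x _; rewrite /D subrK.
clearbody P.
pose W : {poly C} := 'X * (P A * P B - P (A - B) * P B - P A * P (B - A))
  + (A^-1 *: P B + B^-1 *: P A - (A - B)^-1 *: P B - B^-1 *: P (A - B)
     - A^-1 *: P (B - A) - (B - A)^-1 *: P A).
have WE x : W.[x] = x * ((P A).[x] * (P B).[x] - (P (A - B)).[x] * (P B).[x] - (P A).[x] * (P (B - A)).[x])
  + (A^-1 * (P B).[x] + B^-1 * (P A).[x] - (A - B)^-1 * (P B).[x] - B^-1 * (P (A - B)).[x]
     - A^-1 * (P (B - A)).[x] - (B - A)^-1 * (P A).[x]).
  by rewrite /W !hornerE.
have prodO X Y : X != 0 -> Y != 0 ->
    small_order m (fun x => kappa (x * X) * kappa (x * Y) - (P X).[x] * (P Y).[x]).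
  move=> X0 Y0.
  have h1 := small_orderM (dO X X0) (kO Y Y0); rewrite addn0 in h1.
  have h := small_orderD h1 (small_orderM (pO X) (dO Y Y0)).
  by apply: (@small_order_ext _ _ _ 1) h => // x _; rewrite /D; ring.
have WO : small_order m (fun x => - W.[x]).
  have h1 := small_orderB (small_orderB (prodO A B A0 B0) (prodO (A - B) B AB0 B0)) (prodO A (B - A) A0 BA0).
  have h2 := small_orderB (small_orderB (small_orderB (small_orderB (small_orderD
    (small_orderZ A^-1 (dO B B0)) (small_orderZ B^-1 (dO A A0))) (small_orderZ (A - B)^-1 (dO B B0)))
    (small_orderZ B^-1 (dO _ AB0))) (small_orderZ A^-1 (dO _ BA0))) (small_orderZ (B - A)^-1 (dO A A0)).
  have := small_orderD (small_orderM (small_order_lower small_order_id) h1) h2.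
  have [r1 r10 e1] := e2pii_near1 A0; have [r2 r20 e2] := e2pii_near1 B0.
  have [r3 r30 e3] := e2pii_near1 AB0.
  apply: (@small_order_ext _ _ _ (Num.min r1 (Num.min r2 r3))); first by rewrite !lt_min r10 r20.
  move=> x; rewrite !lt_min => /andP[x0 /andP[xr1 /andP[xr2 xr3]]].
  have {}e1 := e1 x; have {}e2 := e2 x; have {}e3 := e3 x.
  rewrite x0 ?xr1 ?xr2 ?xr3 in e1 e2 e3.
  have xn : x != 0 by rewrite -normc_gt0.
  have := @kappa_addition (x * A) (x * B) (mulf_neq0 xn A0) (mulf_neq0 xn B0).
  rewrite (inj_eq (mulfI xn)) -!mulrBr => /(_ AB (e1 isT) (e2 isT) (e3 isT)).
  rewrite /D WE.
  move: (kappa (x * A)) (kappa (x * B)) (kappa (x * (A - B))) (kappa (x * (B - A))) => a b ab ba E.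
  set pA := (P A).[x]; set pB := (P B).[x]; set pAB := (P (A - B)).[x]; set pBA := (P (B - A)).[x].
  have {}E : x * (a * b - ab * b - a * ba) + (b / A + a / B - b / (A - B) - ab / B - ba / A - a / (B - A)) = 0.
    have dv u Y : x * (u / (x * Y)) = u / Y.
      by rewrite invfM mulrCA (mulrA x) divff// mul1r.
    transitivity (x * ((a * b + b / (x * A) + a / (x * B)) -
          (ab * b + b / (x * (A - B)) + ab / (x * B) +
            (a * ba + ba / (x * A) + a / (x * (B - A)))))); last by rewrite E subrr mulr0.
    rewrite -(dv b A) -(dv a B) -(dv b (A - B)) -(dv ab B) -(dv ba A) -(dv a (B - A)).
    move: (_ / (x * A)) (_ / (x * B)) (_ / (x * (A - B))) (_ / (x * A)) (_ / (x * B)) (_ / (x * (B - A))).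
    by move=> *; ring.
  by rewrite -[RHS]add0r -E /=; ring.
have [M [r [M0 r0 hW]]] := WO.
have : W`_n.+1 = 0.
  apply: (@poly_coef_small _ W m M r) => // x xr.
  by rewrite -normcN; exact: hW.
rewrite /W coefD coefXM /= !(coefB, coefD, coefZ) !coefM !coefP//.
move=> E; rewrite -[RHS]E; congr (_ + _); last by ring.
rewrite -!sumrB; apply: eq_bigr => i _.
have im : (i < m)%N by rewrite ltnS ltnW.
have nim : (n - i < m)%N by rewrite ltnS (leq_trans (leq_subr _ _)).
by rewrite !coefP//; ring.
Qed.

End KernelIdentities.

(** * Universal property of presented Lie algebras *)

Section UniversalProperty.
Variables (K : comNzRingType) (G : Type) (L : lieAlgType K) (f : G -> L).

Fixpoint eval_word (s : lie_word K G) : L :=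
  match s with
  | WGen g => f g
  | WZero => 0
  | WAdd s t => eval_word s + eval_word t
  | WScale a s => a *: eval_word s
  | WLie s t => lie (eval_word s) (eval_word t)
  end.

Lemma eval_word_eq s t : word_eq s t -> eval_word s = eval_word t.
Proof.
elim=> {s t} /=.
- by [].
- by move=> s t _ ->.
- by move=> t s u _ -> _ ->.
- by move=> s s' t t' _ -> _ ->.
- by move=> a s s' _ ->.
- by move=> s s' t t' _ -> _ ->.
- by move=> s t u; rewrite addrA.
- by move=> s t; rewrite addrC.
- by move=> s; rewrite add0r.
- by move=> s; rewrite scaleN1r addNr.
- by move=> a b s; rewrite scalerA.
- by move=> s; rewrite scale1r.
- by move=> a s t; rewrite scalerDr.
- by move=> s a b; rewrite scalerDl.
- by move=> a s t u; rewrite lie_linearl.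
- by move=> a s t u; rewrite lie_linearr.
- by move=> s; rewrite lie_alt.
- by move=> s t u; rewrite lie_jacobi.
Qed.

Local Open Scope quotient_scope.

Definition free_lie_map (x : free_lie K G) : L := eval_word (repr x).

Let piE s : free_lie_map (\pi_(free_lie K G) s) = eval_word s.
Proof.
apply: eval_word_eq; apply/asboolP.
by apply/(@eqquotP _ (@word_eqb K G) (free_lie K G)); rewrite reprK.
Qed.

Lemma free_lie_map_gen g : free_lie_map (free_gen K g) = f g.
Proof. exact: piE. Qed.

Lemma free_lie_map_morphism : lie_morphism free_lie_map.
Proof.
split=> [c x y|x y].
  rewrite -[c *: x + y]/(free_add (free_scale c x) y); unlock free_add free_scale.
  by etransitivity; [exact: piE|congr (_ + _); exact: piE].
by rewrite -[lie x y]/(free_br x y); unlock free_br; exact: piE.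
Qed.

Section Morphism.
Variables (M N : lieAlgType K) (h : M -> N).
Hypothesis hM : lie_morphism h.

Lemma lie_morphism0 : h 0 = 0.
Proof.
have := hM.1 1 0 0; rewrite scaler0 addr0 scale1r => /eqP.
by rewrite -subr_eq0 opprD addNKr oppr_eq0 => /eqP.
Qed.

Lemma lie_morphismZ c x : h (c *: x) = c *: h x.
Proof. by have := hM.1 c x 0; rewrite lie_morphism0 !addr0. Qed.

Lemma lie_morphismD x y : h (x + y) = h x + h y.
Proof. by have := hM.1 1 x y; rewrite !scale1r. Qed.

Lemma lie_morphismN x : h (- x) = - h x.
Proof. by rewrite -scaleN1r lie_morphismZ scaleN1r. Qed.

Lemma lie_morphism_sum (I : Type) (r : seq I) (P : pred I) (F : I -> M) :
  h (\sum_(i <- r | P i) F i) = \sum_(i <- r | P i) h (F i).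
Proof. by apply: (big_morph h) => [x y|]; rewrite ?lie_morphismD ?lie_morphism0. Qed.

End Morphism.

Variable S : set (free_lie K G).
Hypothesis fS : forall x, S x -> free_lie_map x = 0.

Lemma free_lie_map_ideal x : in_lie_ideal S x -> free_lie_map x = 0.
Proof.
have [lin br] := free_lie_map_morphism.
elim=> {x} [x|c x y _ hx _ hy||x y _ hy].
- exact: fS.
- by rewrite lin hx hy scaler0 addr0.
- exact: lie_morphism0 free_lie_map_morphism.
- by rewrite br hy lie0r.
Qed.

Definition pres_map (x : lie_pres S) : L := free_lie_map (repr x).

Let pi_mapE (x : free_lie K G) : pres_map (quot_proj S x) = free_lie_map x.
Proof.
rewrite /pres_map; set y := repr _.
have : y - x \in lie_ideal S by rewrite (Quotient.idealrBE (lie_ideal S)) reprK.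
move=> /asboolP/free_lie_map_ideal.
rewrite (lie_morphismD free_lie_map_morphism) (lie_morphismN free_lie_map_morphism).
by move=> /eqP; rewrite subr_eq0 => /eqP.
Qed.

Lemma pres_map_gen g : pres_map (pres_gen S g) = f g.
Proof. by rewrite /pres_gen pi_mapE free_lie_map_gen. Qed.

Lemma pres_map_morphism : lie_morphism pres_map.
Proof.
have [linq brq] := quot_proj_lie_morphism S.
have [lin br] := free_lie_map_morphism.
have pre (x : lie_pres S) : x = quot_proj S (repr x) by rewrite /quot_proj reprK.
split=> [c x y|x y]; rewrite {1}(pre x) {1}(pre y).
  by rewrite -linq pi_mapE lin.
by rewrite -brq pi_mapE br.
Qed.

End UniversalProperty.

(** * Root systems *)

Local Close Scope classical_set_scope.

Section Roots.
Variables (R : realType) (E : vectType R) (ip : {dot E for idfun}).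
Local Notation dualE := 'Hom(E, R^o).
Variable Phi : {fset dualE}.
Hypothesis hPhi : root_system ip Phi.

Lemma root_in (a : Phi) : val a \in Phi. Proof. exact: fsvalP. Qed.

Let g (a b : dualE) : R := ip (sharp ip a) (sharp ip b).

Let gE a b : g a b = a (sharp ip b). Proof. exact: sharpP. Qed.

Let gC a b : g a b = g b a.
Proof. by rewrite /g hermC /= expr0 mul1r. Qed.

Let sharp_neq0 (a : Phi) : sharp ip (val a) != 0.
Proof.
apply/eqP => s0; have := root_neq0 hPhi; rewrite (_ : 0 = val a) ?root_in//.
by apply/lfunP => v; rewrite zero_lfunE -(sharpP ip) s0 linear0l.
Qed.

Let g_gt0 (a : Phi) : 0 < g (val a) (val a).
Proof. exact: neq0_dnorm_gt0 (sharp_neq0 a). Qed.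

Definition pairing (b a : dualE) : R := b (coroot ip a).

Let pairingE b a : pairing b a = 2 * g b a / g a a.
Proof. by rewrite /pairing /coroot linearZ /= -gE mulrAC. Qed.

Lemma pairing_root (a : Phi) : pairing (val a) (val a) = 2.
Proof. by rewrite pairingE mulfK// gt_eqF. Qed.

Lemma pairingDl b c a : pairing (b + c) a = pairing b a + pairing c a.
Proof. by rewrite /pairing add_lfunE. Qed.

Lemma pairing_int (a b : Phi) : pairing (val b) (val a) \is a Num.int.
Proof. exact: (root_crystallographic hPhi) (root_in a) (root_in b). Qed.

Lemma root_opp (a : Phi) : - val a \in Phi.
Proof.
have := root_reflection hPhi (root_in a) (root_in a).
rewrite reflectionE -/(pairing _ _) pairing_root scaler_nat mulr2n opprD addrA subrr sub0r.
by [].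
Qed.

Definition oppR (a : Phi) : Phi := FSetSub (root_opp a).

Lemma val_oppR a : val (oppR a) = - val a. Proof. by []. Qed.

Lemma oppRK : involutive oppR.
Proof. by move=> a; apply: val_inj; rewrite /= opprK. Qed.

Lemma root_val_neq0 (a : Phi) : val a != 0.
Proof. by apply: contraNneq (root_neq0 hPhi) => <-; exact: root_in. Qed.

Definition indep (a b : dualE) := (b != a) && (b != - a).

Lemma indep_scale (a b : Phi) (c : R) : indep (val a) (val b) -> val b != c *: val a.
Proof.
move=> /andP[ba bNa]; apply/eqP => bc.
have := root_in b; rewrite bc => /(root_reduced hPhi (root_in a))[c1|c1].
  by move: ba; rewrite bc c1 scale1r eqxx.
by move: bNa; rewrite bc c1 scaleN1r eqxx.
Qed.

(** In a reduced system proportional roots are equal or opposite. *)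
Lemma indep_lin (a b : Phi) (c d : R) : indep (val a) (val b) ->
  c *: val a + d *: val b = 0 -> c = 0 /\ d = 0.
Proof.
move=> ab cd0; have [d0|d0] := eqVneq d 0.
  split=> //; move: cd0; rewrite d0 scale0r addr0 => /eqP.
  by rewrite scaler_eq0 (negPf (root_val_neq0 a)) orbF => /eqP.
have db : d *: val b = - (c *: val a) by apply/eqP; rewrite -addr_eq0 addrC cd0.
have /eqP[] := indep_scale (- (d^-1 * c)) ab.
by rewrite scaleNr -scalerA -scalerN -db scalerA mulVf// scale1r.
Qed.

(** The strict Cauchy-Schwarz inequality. *)
Lemma pairing_prod_lt4 (a b : Phi) : indep (val a) (val b) ->
  pairing (val b) (val a) * pairing (val a) (val b) < 4.
Proof.
move=> ab; set A := val a; set B := val b.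
pose z := g A A *: sharp ip B - g A B *: sharp ip A.
have z0 : z != 0.
  apply/eqP => z0; have /negP := indep_scale (g A B / g A A) ab; apply.
  apply/eqP/lfunP => v; rewrite scale_lfunE -!(sharpP ip).
  have : ip z v = 0 by rewrite z0 linear0l.
  rewrite /z linearBl 2!linearZl_LR /=.
  rewrite -/A -/B => /eqP; rewrite subr_eq0 => /eqP h.
  apply: (mulfI (lt0r_neq0 (g_gt0 a))); rewrite -/A; rewrite /GRing.scale /= in h *.
  by rewrite h mulrA mulrCA divff ?mulr1 ?lt0r_neq0 ?g_gt0.
have : 0 < ip z z by exact: neq0_dnorm_gt0.
have -> : ip z z = g A A * (g A A * g B B - g A B ^+ 2).
  rewrite /z linearBl 2!linearZl_LR !linearBr !linearZr_LR /= -!/(g _ _) [g B A]gC.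
  by rewrite /GRing.scale /=; ring.
rewrite pmulr_rgt0 ?g_gt0// subr_gt0 => h.
rewrite !pairingE [g B A]gC mulf_div ltr_pdivrMr ?mulr_gt0 ?g_gt0//.
rewrite (_ : 2 * g A B * (2 * g A B) = 4 * g A B ^+ 2); last by ring.
by rewrite ltr_pM2l.
Qed.

Lemma pairing_pos_sym (a b : Phi) : 0 < pairing (val b) (val a) -> 0 < pairing (val a) (val b).
Proof.
have e b' (a' : Phi) : (0 < pairing b' (val a')) = (0 < g b' (val a')).
  by rewrite pairingE pmulr_lgt0 ?invr_gt0 ?g_gt0// pmulr_rgt0.
by rewrite !e gC.
Qed.

(** Both pairings are positive integers and their product is less than 4, so one
    of them is 1 and the corresponding reflection is a subtraction. *)
Lemma root_sub (a b : Phi) : indep (val a) (val b) -> 0 < pairing (val b) (val a) ->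
  val b - val a \in Phi.
Proof.
move=> ab ba0; have ab0 := pairing_pos_sym ba0.
have h4 := pairing_prod_lt4 ab.
have /intrP[m mE] := pairing_int a b; have /intrP[n nE] := pairing_int b a.
move: ba0 ab0 h4; rewrite mE nE !ltr0z => m0 n0.
rewrite -intrM -[4]/(4%:~R) ltr_int => mn.
have : (m == 1) || (n == 1).
  have m1 : 1 <= m by rewrite -gtz0_ge1. have n1 : 1 <= n by rewrite -gtz0_ge1.
  rewrite !eq_le m1 n1 !andbT -[m <= 1]negbK -[n <= 1]negbK -negb_and -!ltNge.
  apply/negP => /andP[m2 n2].
  have : 2 * 2 <= m * n by apply: ler_pM; rewrite // ?lez1D.
  by rewrite leNgt mn.
case/orP => /eqP one.
  have := root_reflection hPhi (root_in a) (root_in b).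
  by rewrite reflectionE -/(pairing _ _) mE one scale1r.
have := root_reflection hPhi (root_in b) (root_in a).
rewrite reflectionE -/(pairing _ _) nE one scale1r => h.
by have := root_opp (FSetSub h); rewrite /= opprB.
Qed.

Lemma pairing_le3 (a b : Phi) : indep (val a) (val b) -> `|pairing (val b) (val a)| <= 3.
Proof.
wlog pos : b / 0 <= pairing (val b) (val a).
  move=> H ab; case: (lerP 0 (pairing (val b) (val a))) => h; first exact: H.
  have := H (oppR b); rewrite /pairing /= opp_lfunE normrN; apply.
    by rewrite oppr_ge0 ltW.
  by move: ab; rewrite /indep eqr_oppLR (inj_eq oppr_inj) andbC.
move=> ab; rewrite ger0_norm//; have [->|p0] := eqVneq (pairing (val b) (val a)) 0; first by [].
have {}pos : 0 < pairing (val b) (val a) by rewrite lt_def p0.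
have ab0 := pairing_pos_sym pos; have h4 := pairing_prod_lt4 ab.
have /intrP[m mE] := pairing_int a b; have /intrP[n nE] := pairing_int b a.
move: pos ab0 h4; rewrite mE nE !ltr0z => m0 n0.
rewrite -intrM -[4]/(4%:~R) -[3]/(3%:~R) ltr_int ler_int => mn.
rewrite -ltzD1; apply: le_lt_trans mn; rewrite ler_peMr ?(ltW m0)//.
Qed.

End Roots.

(** * Relations along root strings *)

Section RootStrings.
Variables (R : realType) (E : vectType R) (ip : {dot E for idfun}).
Local Notation dualE := 'Hom(E, R^o).
Variable Phi : {fset dualE}.
Hypothesis hPhi : root_system ip Phi.
Local Notation opp := (oppR hPhi).

Definition in_string (a b c : Phi) : bool := `[< exists n : int, val c = val b + val a *~ n >].

(** Integral rather than real combinations: only these are certain to be closed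
    in the sense of root subsystems, and the subsystem may be smaller than the
    set of all roots in the plane. *)
Definition span2 (a b : Phi) : {set Phi} :=
  [set c | `[< exists m k : int, val c = val a *~ m + val b *~ k >]].

Lemma in_span2P a b c : reflect (exists m k : int, val c = val a *~ m + val b *~ k)
  (c \in span2 a b).
Proof. by rewrite inE; exact: asboolP. Qed.

Lemma in_span2l a b : a \in span2 a b.
Proof. by apply/in_span2P; exists 1, 0; rewrite mulr1z mulr0z addr0. Qed.

Lemma in_span2r a b : b \in span2 a b.
Proof. by apply/in_span2P; exists 0, 1; rewrite mulr1z mulr0z add0r. Qed.

Lemma span2_opp a b c : (opp c \in span2 a b) = (c \in span2 a b).
Proof.
suff h c' : c' \in span2 a b -> opp c' \in span2 a b.
  by apply/idP/idP => [/h|/h//]; rewrite oppRK.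
move=> /in_span2P[m [k E1]]; apply/in_span2P; exists (- m), (- k).
by rewrite val_oppR E1 !mulrNz -opprD.
Qed.

Lemma span2_root_subsystem a b : root_subsystem (span2 a b).
Proof.
move=> c; set s := in_tuple _; split=> [[f cE]|cab].
  apply/in_span2P; rewrite cE.
  apply: (big_ind (fun x : dualE => exists m k : int, x = val a *~ m + val b *~ k)).
  - by exists 0, 0; rewrite !mulr0z addr0.
  - move=> x y [m [k ->]] [m' [k' ->]].
    by exists (m + m'), (k + k'); rewrite !mulrzDr addrACA.
  move=> i _; have : s`_i \in [seq val b0 | b0 in span2 a b] by apply: mem_nth; exact: ltn_ord.
  move=> /mapP[b0]; rewrite mem_enum => /in_span2P[m [k E1]] E2.
  exists (m * f i), (k * f i); rewrite [s`_i]E2 [\val b0]E1.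
  by rewrite mulrzDl !mulrzA.
have cs : val c \in [seq val b0 | b0 in span2 a b] by apply: map_f; rewrite mem_enum.
have ic : (index (val c) [seq val b0 | b0 in span2 a b] <
  size [seq val b0 | b0 in span2 a b])%N by rewrite index_mem.
exists [ffun i => (i == Ordinal ic)%:Z].
rewrite (bigD1 (Ordinal ic)) //= big1 => [|i ni]; last by rewrite ffunE (negPf ni) mulr0z.
by rewrite ffunE eqxx addr0 mulr1z nth_index.
Qed.

Lemma indep_coord (a b : Phi) (m k m' k' : int) : indep (val a) (val b) ->
  val a *~ m + val b *~ k = val a *~ m' + val b *~ k' -> m = m' /\ k = k'.
Proof.
move=> ab /eqP; rewrite -subr_eq0 opprD addrACA -!mulrzBr -[val a *~ _]scaler_int -[val b *~ _]scaler_int => /eqP.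
move=> /(indep_lin hPhi ab)[/eqP + /eqP]; rewrite !intr_eq0 !subr_eq0.
by move=> /eqP-> /eqP->.
Qed.

Lemma span2_rank a b : indep (val a) (val b) -> subsystem_rank (span2 a b) = 2%N.
Proof.
move=> ab; rewrite /subsystem_rank.
have -> : (<<[seq val b0 | b0 in span2 a b]>> = <<[:: val a; val b]>>)%VS.
  apply/eqP; rewrite eqEsubv; apply/andP; split; apply/span_subvP => v.
    move=> /mapP[c]; rewrite mem_enum => /in_span2P[m [k E1]] ->; rewrite [val c]E1.
    by rewrite rpredD// rpredMz// memv_span// !inE eqxx ?orbT.
  rewrite !inE => /orP[] /eqP ->; apply/memv_span/map_f; rewrite mem_enum.
    exact: in_span2l.
  exact: in_span2r.
apply/eqP; rewrite -[_ == _]/(free [:: val a; val b]).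
rewrite free_cons seq1_free (root_val_neq0 hPhi) andbT.
rewrite span_seq1; apply/vlineP => -[c ac].
have E1 : 1 *: val a + (- c) *: val b = 0 by rewrite scale1r scaleNr ac subrr.
by have [/eqP + _] := indep_lin hPhi ab E1; rewrite oner_eq0.
Qed.

Lemma in_string_refl a b : in_string a b b.
Proof. by apply/asboolP; exists 0; rewrite mulr0z addr0. Qed.

Section PositiveSystem.
Variable Phip : {set Phi}.
Hypothesis hPhip : positive_system Phip.

Lemma opp_pos a : (opp a \in Phip) = (a \notin Phip).
Proof.
have [v hv] := hPhip; have [_ ->] := hv (opp a); have [a0 ->] := hv a.
by rewrite val_oppR opp_lfunE oppr_gt0 -leNgt le_eqVlt (negPf a0).
Qed.

Lemma sum_pos_half (V : zmodType) (P : pred Phi) (F : Phi -> V) :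
  (forall c, P (opp c) = P c) -> (forall c, F (opp c) = F c) ->
  \sum_(c | P c) F c = (\sum_(c | P c && (c \in Phip)) F c) *+ 2.
Proof.
move=> PN FN; rewrite (bigID (mem Phip)) /= mulr2n; congr (_ + _).
rewrite (reindex_inj (inv_inj (@oppRK _ _ _ _ hPhi))) /=.
by apply: eq_big => [c|c _]; rewrite ?PN ?opp_pos ?negbK ?FN.
Qed.

Section StringRelation.
Variables (K : numFieldType) (L : lieAlgType K) (t : Phi -> L).
Hypothesis tN : forall a, t (opp a) = t a.
Hypothesis tt : forall (Psi : {set Phi}) (a : Phi),
  root_subsystem Psi -> subsystem_rank Psi = 2%N -> a \in Psi ->
  lie (t a) (\sum_(b in Psi :&: Phip) t b) = 0.

Let span2_relation a b : indep (val a) (val b) ->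
  \sum_(c in span2 a b) lie (t a) (t c) = 0.
Proof.
move=> ab; rewrite sum_pos_half => [|c|c]; rewrite ?span2_opp ?tN//.
have := tt (@span2_root_subsystem a b) (span2_rank ab) (in_span2l a b).
rewrite lie_sumr => h; rewrite (eq_bigl (fun c => c \in span2 a b :&: Phip)).
  by rewrite h mul0rn.
by move=> c; rewrite finset.in_setI.
Qed.

Let bcoord (a b c : Phi) : int := xget 0 [set k | exists m : int, val c = val a *~ m + val b *~ k]%classic.

Let bcoordE a b c m k : indep (val a) (val b) ->
  val c = val a *~ m + val b *~ k -> bcoord a b c = k.
Proof.
move=> ab ck; rewrite /bcoord.
have [m' cm'] := @xgetPex _ 0 [set k | exists m : int, val c = val a *~ m + val b *~ k]%classic
  (ex_intro _ k (ex_intro _ m ck)).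
by have [_ /esym] := indep_coord ab (etrans (esym ck) cm').
Qed.

(** The defining relations are indexed by rank 2 subsystems, but already hold
    string by string: the subsystem generated by [a] and [b] is a union of
    [a]-strings, all but [b + Z a] and [- b + Z a] of which generate smaller
    subsystems together with [a]. *)
Theorem string_relation a b : indep (val a) (val b) ->
  \sum_(c | in_string a b c) lie (t a) (t c) = 0.
Proof.
have [n] := ubnP #|span2 a b|; elim: n a b => // n IHn a b; rewrite ltnS => hn ab.
pose F c := lie (t a) (t c); pose k c := bcoord a b c.
pose S k0 := \sum_(c | (c \in span2 a b) && (k c == k0)) F c.
have FN c : F (opp c) = F c by rewrite /F tN.
have kN c : c \in span2 a b -> k (opp c) = - k c.
  move=> /in_span2P[m [k0 ck]]; rewrite /k (bcoordE ab ck).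
  by apply: (bcoordE (m := - m) ab); rewrite val_oppR ck opprD !mulrNz.
have S1E : S 1 = \sum_(c | in_string a b c) F c.
  apply: eq_bigl => c; apply/andP/asboolP => [[/in_span2P[m [k0 ck]]]|[m cm]].
    by rewrite /k (bcoordE ab ck) => /eqP k1; exists m; rewrite ck k1 mulr1z addrC.
  have cm' : val c = val a *~ m + val b *~ 1 by rewrite cm mulr1z addrC.
  by split; [apply/in_span2P; exists m, 1|rewrite /k (bcoordE ab cm')].
have SN1 : S (-1) = S 1.
  rewrite /S (reindex_inj (inv_inj (@oppRK _ _ _ _ hPhi))) /=.
  apply: eq_big => [c|c _]; rewrite ?FN// span2_opp.
  by case: (boolP (c \in span2 a b)) => // /kN ->; rewrite eqr_opp.
have S0 : S 0 = 0.
  rewrite /S big1// => c /andP[/in_span2P[m [k0 ck]]].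
  rewrite /k (bcoordE ab ck) => /eqP k00; move: ck; rewrite k00 mulr0z addr0 => cm.
  have := root_in c; rewrite cm -scaler_int => /(root_reduced hPhi (root_in a))[] m1.
    by rewrite /F (_ : c = a) ?lie_alt//; apply/val_inj; rewrite /= cm -scaler_int m1 scale1r.
  rewrite /F (_ : c = opp a) ?tN ?lie_alt//.
  by apply/val_inj; rewrite val_oppR /= cm -scaler_int m1 scaleN1r.
have Sbig k0 : k0 != 0 -> k0 != 1 -> k0 != -1 -> S k0 = 0.
  move=> k00 k01 k0N1.
  have [c0 /andP[c0s /eqP c0k]|none] := pickP (fun c => (c \in span2 a b) && (k c == k0)); last first.
    by rewrite /S big_pred0.
  have /in_span2P[m0 [k1 c0E]] := c0s.
  have k1E : k1 = k0 by rewrite -c0k /k (bcoordE ab c0E).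
  subst k1.
  have ac0 : indep (val a) (val c0).
    apply/andP; split; apply: contraNneq k00 => E1; apply/eqP.
      have : val a *~ 1 + val b *~ 0 = val a *~ m0 + val b *~ k0.
        by rewrite -c0E E1 mulr1z mulr0z addr0.
      by case/(indep_coord ab).
    have : val a *~ (-1) + val b *~ 0 = val a *~ m0 + val b *~ k0.
      by rewrite -c0E E1 mulrN1z mulr0z addr0.
    by case/(indep_coord ab).
  have sub : (#|span2 a c0| < n)%N.
    apply: leq_trans hn; apply/proper_card/properP; split.
      apply/fintype.subsetP => c /in_span2P[m [j cE]]; apply/in_span2P.
      exists (m + m0 * j), (k0 * j).
      by rewrite cE c0E mulrzDl mulrzDr -!mulrzA addrA.
    exists b; first exact: in_span2r.
    apply/negP => /in_span2P[m [j bE]].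
    have : val a *~ 0 + val b *~ 1 = val a *~ (m + m0 * j) + val b *~ (k0 * j).
      by rewrite mulr0z add0r mulr1z {1}bE c0E mulrzDl mulrzDr -!mulrzA addrA.
    move=> /(indep_coord ab)[_ k0j].
    have /eqP : absz (k0 * j) = 1%N by rewrite -k0j.
    rewrite abszM muln_eq1 => /andP[/eqP k01' _].
    have unit_int (z : int) : absz z = 1%N -> z = 1 \/ z = -1.
      by case: z => [[|[|?]]|[|?]] //= _; [left|right].
    by have [/eqP|/eqP] := unit_int _ k01'; [exact/negP|exact/negP].
  rewrite -[RHS](IHn a c0 sub ac0) /S; apply: eq_bigl => c.
  apply/andP/asboolP => [[/in_span2P[m [k1 cE]]]|[m cm]].
    rewrite /k (bcoordE ab cE) => /eqP k1E; exists (m - m0).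
    by rewrite cE c0E k1E mulrzBr [RHS]addrC addrA subrK.
  have cE : val c = val a *~ (m0 + m) + val b *~ k0 by rewrite cm c0E mulrzDr addrAC.
  by split; [apply/in_span2P; exists (m0 + m), k0|rewrite /k (bcoordE ab cE)].
pose s := undup [seq k c | c <- enum {: Phi}].
have us : uniq s by exact: undup_uniq.
have inS c : k c \in s by rewrite mem_undup map_f// mem_enum.
have total : \sum_(c in span2 a b) F c = \sum_(k0 <- s) S k0.
  rewrite /S; under [RHS]eq_bigr do rewrite big_mkcondr.
  rewrite exchange_big /=; apply: eq_bigr => c _.
  rewrite -big_mkcond /= (big_rem (k c)) ?inS//= eqxx big_seq_cond big1 ?addr0// => k0.
  by rewrite (mem_rem_uniq _ us) inE => /andP[/andP[/negPf k0k _] /eqP kk]; rewrite kk eqxx in k0k.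
have one_in : 1 \in s.
  by rewrite -(_ : k b = 1) ?inS// /k (@bcoordE a b b 0 1)// mulr0z add0r mulr1z.
have oneN_in : -1 \in s.
  by rewrite -(_ : k (opp b) = -1) ?inS// /k (@bcoordE a b (opp b) 0 (-1))// mulr0z add0r mulrN1z.
have : \sum_(k0 <- s) S k0 = S 1 + S (-1).
  rewrite (big_rem 1)//= (big_rem (-1)) /=; last by rewrite (mem_rem_uniq _ us) inE oneN_in.
  rewrite big_seq big1 ?addr0// => k0.
  rewrite (mem_rem_uniq _ (rem_uniq _ us)) inE => /andP[k0N1].
  rewrite (mem_rem_uniq _ us) inE => /andP[k01 _].
  by have [->//|k00] := eqVneq k0 0; exact: Sbig.
rewrite -total span2_relation// SN1 S1E -mulr2n -scaler_nat => /esym/eqP.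
by rewrite scaler_eq0 pnatr_eq0 /= => /eqP.
Qed.

End StringRelation.
End PositiveSystem.
End RootStrings.

(** * Sums over pairs of positive roots *)

Section EdgeSums.
Variables (R : realType) (E : vectType R) (ip : {dot E for idfun}).
Local Notation dualE := 'Hom(E, R^o).
Variable Phi : {fset dualE}.
Hypothesis hPhi : root_system ip Phi.
Local Notation opp := (oppR hPhi).
Variable Phip : {set Phi}.
Hypothesis hPhip : positive_system Phip.

Lemma pos_indep (a b : Phi) : a \in Phip -> b \in Phip -> a != b -> indep (val a) (val b).
Proof.
move=> ap bp ab; apply/andP; split; first by rewrite (inj_eq val_inj) eq_sym.
apply/eqP => h; have := opp_pos hPhi hPhip a.
by rewrite (_ : opp a = b) ?bp ?ap//; apply/val_inj.
Qed.

(** When only positive roots are kept, the [a]-strings through [b] and through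
    [- b] contribute to the same sum. *)
Definition in_class (a b c : Phi) : bool := in_string a b c || in_string a (opp b) c.

Lemma in_class_shift (a b c d : Phi) : val d = val a + val c -> in_class a b c -> in_class a b d.
Proof.
move=> dE /orP[] /asboolP[n cE]; apply/orP; [left|right]; apply/asboolP;
  by exists (n + 1); rewrite dE cE mulrzDr mulr1z addrC addrA.
Qed.

Lemma in_class_unshift (a b c d : Phi) : val d = val a + val c -> in_class a b d -> in_class a b c.
Proof.
move=> dE /orP[] /asboolP[n cE]; apply/orP; [left|right]; apply/asboolP;
  exists (n - 1); by rewrite mulrzBr mulr1z addrA -cE dE addrAC subrr add0r.
Qed.

(** Comparing heights leaves, besides [w] and [v - w], only [2 v - w]; in that case
    [w] and [c] both have the height of [v], [w] makes an acute angle with [v], and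
    [w - v] is a root of height 0, which is absurd. *)
Lemma in_class_max (l : E) (v w c : Phi) :
  (forall a : Phi, val a l != 0 /\ (a \in Phip) = (0 < val a l)) ->
  v \in Phip -> w \in Phip -> c \in Phip -> w != v ->
  val w l <= val v l -> val c l <= val v l ->
  in_class v w c -> c = w \/ val c = val v - val w.
Proof.
move=> hl vp wp cp wv wl cl.
have [v0 w0 c0] : [/\ 0 < val v l, 0 < val w l & 0 < val c l].
  by move: vp wp cp; rewrite !(hl _).2.
have evz (n : int) : (val v *~ n) l = n%:~R * val v l.
  by rewrite -scaler_int scale_lfunE.
case/orP => /asboolP[n cE].
  left; have nl : val c l = val w l + n%:~R * val v l by rewrite cE add_lfunE evz.
  have n1 : n%:~R < 1 :> R.
    by rewrite -(ltr_pM2r v0) mul1r; move: nl cl w0; clear; lra.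
  have n2 : -1 < n%:~R :> R.
    by rewrite -(ltr_pM2r v0) mulN1r; move: nl wl c0; clear; lra.
  have n0 : n = 0.
    move: n1 n2; rewrite -[1]/(1%:~R) -intrN !ltr_int; clear.
    by case: n => [[|n]|n].
  by apply: val_inj; rewrite /= cE n0 mulr0z addr0.
right; have nl : val c l = - val w l + n%:~R * val v l by rewrite cE add_lfunE val_oppR opp_lfunE evz.
have n1 : n%:~R <= 2%:~R :> R.
  by rewrite -(ler_pM2r v0); move: nl cl wl; clear; lra.
have n2 : 0 < n%:~R :> R.
  by rewrite -(pmulr_lgt0 _ v0); move: nl w0 c0; clear; lra.
have [n12|n12] : n = 1 \/ n = 2.
  move: n1 n2; rewrite ler_int ltr0z.
  by case: n {cE nl} => [[|[|[|n]]]|n] //; [left|right].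
  by rewrite cE n12 mulr1z addrC.
(* the pairings of [w] and [c] with [v] add up to 4, and that of [c] is at most 3 *)
exfalso; have vw : indep (val v) (val w) by apply: pos_indep => //; rewrite eq_sym.
have cv : c != v.
  apply: contraNneq wv => cv; apply/eqP/val_inj.
  have -> : val w = val v *~ 2 - val c.
    by rewrite cE n12 val_oppR opprD opprK addrCA subrr addr0.
  by rewrite cv mulrz_nat mulr2n addrK.
have vc : indep (val v) (val c) by apply: pos_indep => //; rewrite eq_sym.
have psum : pairing ip (val w) (val v) + pairing ip (val c) (val v) = 4.
  rewrite -pairingDl cE val_oppR addrA subrr add0r n12 -scaler_int /pairing scale_lfunE.
  rewrite -/(pairing ip _ _) (pairing_root hPhi) -[LHS]/(2%:R * 2%:R).
  by rewrite -natrM.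
have := pairing_le3 hPhi vc; rewrite ler_norml => /andP[_ p3].
have wpos : 0 < pairing ip (val w) (val v) by move: psum p3; clear; lra.
have wvr := root_sub hPhi vw wpos.
have := (hl (FSetSub wvr)).1; rewrite /= add_lfunE opp_lfunE => /eqP; apply.
have : n%:~R = 2 :> R by rewrite n12.
by move=> n2R; move: nl wl cl; rewrite n2R; clear; lra.
Qed.

(** A discrete Stokes argument: [e a b] is a current along the edge [a -- b],
    subject to Kirchhoff's law on every class at every vertex, and [F] is a
    potential difference that is consistent around the triangles
    [a, b, a + b].  A vertex [v] of maximal height meets, in each class, only
    the edges of a triangle [a, v - a, v]; the current through [v] may be
    rerouted along [a -- v - a] without changing the sum, and [v] removed. *)
Theorem edge_sum_zero (M : zmodType) (F : Phi -> Phi -> M -> M) (e : Phi -> Phi -> M) :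
  (forall a b x y, F a b (x + y) = F a b x + F a b y) ->
  (forall a b x, F b a x = - F a b x) ->
  (forall a x, F a a x = 0) ->
  (forall a b c x, a \in Phip -> b \in Phip -> c \in Phip -> val c = val a + val b ->
    F a b x = F a c x + F c b x) ->
  (forall a b, e b a = - e a b) ->
  (forall a b, a \in Phip -> b \in Phip -> a != b ->
    \sum_(c in Phip | in_class a b c) e a c = 0) ->
  \sum_(a in Phip) \sum_(b in Phip) F a b (e a b) = 0.
Proof.
move=> FD FC F0 Ftri eC erel.
have [l hl] := hPhip.
have F_0 a b : F a b 0 = 0 by apply: (addIr (F a b 0)); rewrite -FD !add0r.
have FN a b x : F a b (- x) = - F a b x.
  by apply/eqP; rewrite -addr_eq0 -FD addNr F_0.
suff main (S : {set Phi}) e' : S \subset Phip ->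
    (forall a b, a \in S -> b \in S -> e' b a = - e' a b) ->
    (forall a b, a \in S -> b \in S -> a != b ->
      \sum_(c in S | in_class a b c) e' a c = 0) ->
    \sum_(a in S) \sum_(b in S) F a b (e' a b) = 0.
  by apply: main => // a b *; exact: eC.
have [n] := ubnP #|S|; elim: n S e' {e eC erel} => // n IHn S e; rewrite ltnS => hn SP eC erel.
have [S0|[v0 v0S]] := set_0Vmem S; first by rewrite S0 big_set0.
pose v := [arg max_(v > v0 in S) (val v l)]%O.
have [vS vmax] : v \in S /\ forall w, w \in S -> val w l <= val v l.
  by rewrite /v; case: arg_maxP.
clearbody v; pose S' := S :\ v.
have S'S a : a \in S' -> a \in S by rewrite !inE => /andP[].
have S'v a : a \in S' -> a != v by rewrite !inE => /andP[].
have SPi a : a \in S -> a \in Phip by move/(fintype.subsetP SP).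
(* the class of [a] at [v] is reduced to [a] and [v - a]: the currents cancel *)
have at_v (a b : Phi) : a \in S' -> val a + val b = val v -> b \in S' -> e a v = - e b v.
  move=> aS ab bS; have va : v != a by rewrite eq_sym S'v.
  have := erel v a vS (S'S _ aS) va.
  have bE : val b = val v - val a by rewrite -ab addrAC subrr add0r.
  have ab_neq : a != b.
    apply/eqP => E1; have aa : (2 : R) *: val a = val v by rewrite scaler_nat mulr2n {2}E1.
    have := root_in v; rewrite -aa => /(root_reduced hPhi (root_in a)).
    by case=> /eqP; [rewrite (eqr_nat R 2 1)|rewrite -subr_eq0 opprK -(natrD R 2 1) pnatr_eq0].
  rewrite (bigD1 a) /=; last by rewrite S'S//= /in_class in_string_refl.
  rewrite (bigD1 b) /=; last first.
    rewrite S'S//= eq_sym ab_neq andbT; apply/orP; right; apply/asboolP; exists 1.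
    by rewrite mulr1z val_oppR bE addrC.
  rewrite big1 ?addr0 => [|c /andP[/andP[/andP[cS cl] ca] cb]].
    rewrite (eC a v (S'S _ aS) vS) (eC b v (S'S _ bS) vS) => /eqP; rewrite -opprD oppr_eq0 addr_eq0.
    by move=> /eqP.
  have [cE|cE] := in_class_max hl (SPi _ vS) (SPi _ (S'S _ aS)) (SPi _ cS) (S'v _ aS)
    (vmax _ (S'S _ aS)) (vmax _ cS) cl; first by rewrite cE eqxx in ca.
  by case/eqP: cb; apply: val_inj; rewrite /= cE bE.
have alone a : a \in S' -> (forall b, b \in S' -> val a + val b != val v) -> e a v = 0.
  move=> aS nob; have va : v != a by rewrite eq_sym S'v.
  have := erel v a vS (S'S _ aS) va.
  rewrite (bigD1 a) /=; last by rewrite S'S//= /in_class in_string_refl.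
  rewrite big1 ?addr0 => [|c /andP[/andP[cS cl] ca]].
    by rewrite (eC a v (S'S _ aS) vS) => /eqP; rewrite oppr_eq0 => /eqP.
  have [cE|cE] := in_class_max hl (SPi _ vS) (SPi _ (S'S _ aS)) (SPi _ cS) (S'v _ aS)
    (vmax _ (S'S _ aS)) (vmax _ cS) cl; first by rewrite cE eqxx in ca.
  have cv : c != v.
    apply/eqP => cv; have /eqP := root_val_neq0 hPhi a; apply.
    move: cE; rewrite cv => /eqP; rewrite eq_sym subr_eq -subr_eq0 opprD addNKr oppr_eq0.
    by move=> /eqP.
  have cS' : c \in S' by rewrite !inE cv.
  by have := nob c cS'; rewrite cE addrC subrK eqxx.
pose mate (a b : Phi) := val a + val b == val v.
pose e' (a b : Phi) := e a b + if mate a b then e a v else 0.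
have mateC (a b : Phi) : mate a b = mate b a by rewrite /mate addrC.
have mate_uniq (a b c : Phi) : mate a b -> mate a c -> b = c.
  by move=> /eqP h1 /eqP h2; apply/val_inj/(addrI (val a)); rewrite h1 h2.
have mate_sum (G : Phi -> M) a : a \in S' ->
    \sum_(b in S' | mate a b) G a = if [exists b in S', mate a b] then G a else 0.
  move=> aS; case: existsP => [[b /andP[bS ab]]|nob].
    rewrite (big_pred1 b)// => c; apply/andP/eqP => [[_ ac]|->//].
    exact: mate_uniq ac ab.
  by rewrite big1// => b /andP[bS ab]; case: nob; exists b; rewrite bS.
have IH : \sum_(a in S') \sum_(b in S') F a b (e' a b) = 0.
  apply: IHn.
  - by apply: leq_trans hn; rewrite [X in (_ < X)%N](cardsD1 v) vS.
  - by apply/fintype.subsetP => a /S'S/SPi.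
  - move=> a b aS bS; rewrite /e' mateC opprD; congr (_ + _); first by apply: eC; exact: S'S.
    by case: ifP => [/eqP ab|_]; rewrite ?oppr0// (at_v b a)// addrC.
  move=> a b aS bS ab; rewrite big_split /=.
  have := erel a b (S'S _ aS) (S'S _ bS) ab.
  rewrite (bigID (pred1 v)) /= => h; rewrite -[RHS]h addrC; congr (_ + _); last first.
    by apply: eq_bigl => c; rewrite !inE; case: (c == v); rewrite ?andbF ?andbT.
  rewrite -big_mkcondr /=.
  have -> : \sum_(c | (c \in S') && in_class a b c && mate a c) e a v =
      \sum_(c in S' | mate a c && in_class a b v) e a v.
    apply: eq_bigl => c; case: (c \in S') => //=; rewrite andbC.
    case: (boolP (mate a c)) => //= /eqP ac.
    by apply/idP/idP; [apply: in_class_shift|apply: in_class_unshift].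
  have -> : \sum_(c | (c \in S) && in_class a b c && (c == v)) e a c = if in_class a b v then e a v else 0.
    case: ifP => [cl|cl].
      rewrite (big_pred1 v)// => c /=; case: eqP => [->|_]; last by rewrite andbF.
      by rewrite vS cl.
    by rewrite big1// => c /andP[/andP[_ clc] /eqP cv]; rewrite -cv clc in cl.
  case: ifP => [cl|_]; last by rewrite big1// => c; rewrite andbF andbF.
  under eq_bigl do rewrite andbT.
  rewrite (mate_sum (fun a => e a v))//; case: ifP => // /negbT nob.
  rewrite alone// => c cS; apply: contraNN nob => ac.
  by apply/existsP; exists c; rewrite cS.
have split_v (G : Phi -> M) : \sum_(a in S) G a = G v + \sum_(a in S') G a.
  by rewrite (big_setD1 v).
have cross a : F v a (e v a) = F a v (e a v) \/ a \notin S.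
  have [aS|] := boolP (a \in S); [left|by right].
  by rewrite FC (eC a v aS vS) FN opprK.
rewrite split_v (split_v (fun b => F v b (e v b))) F0 add0r.
under [X in _ + X]eq_bigr do rewrite split_v.
rewrite big_split /=.
rewrite [X in X + _](eq_bigr (fun a => F a v (e a v))); last first.
  by move=> a /S'S aS; have [//|] := cross a; rewrite aS.
have {}IH : \sum_(a in S') \sum_(b in S') F a b (e a b) +
    \sum_(a in S') \sum_(b in S') F a b (if mate a b then e a v else 0) = 0.
  rewrite -big_split -[RHS]IH; apply: eq_bigr => a _.
  by rewrite -big_split; apply: eq_bigr => b _; rewrite /e' FD.
rewrite -[RHS]IH addrA addrC; congr (_ + _).
have pairs : \sum_(a in S') F a v (e a v) =
    \sum_(a in S') \sum_(b in S' | mate a b) F a v (e a v).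
  apply: eq_bigr => a aS; rewrite (mate_sum (fun a => F a v (e a v)))//.
  case: ifP => // /negbT nob; rewrite alone ?F_0// => c cS; apply: contraNN nob => ac.
  by apply/existsP; exists c; rewrite cS.
transitivity (\sum_(a in S') \sum_(b in S' | mate a b) (F a v (e a v) + F b v (e b v))).
  under [RHS]eq_bigr do rewrite big_split /=.
  rewrite big_split /= -pairs; congr (_ + _).
  rewrite pairs (exchange_big_dep (mem S')) /=; last by move=> a b _ /andP[].
  apply: eq_bigr => a aS; apply: eq_bigl => b.
  by rewrite aS /= mateC.
apply: eq_bigr => a aS; rewrite [RHS](bigID (mate a)) /=.
rewrite [X in _ = _ + X]big1 ?addr0 => [|b /andP[_ /negPf ->]]; last by rewrite F_0.
apply: eq_bigr => b /andP[bS ab]; rewrite ab.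
have [ai bi] := (SPi _ (S'S _ aS), SPi _ (S'S _ bS)).
rewrite (Ftri a b v _ ai bi (SPi _ vS) (esym (eqP ab))) (FC b v).
by rewrite [in X in _ = _ + X](at_v a b aS (eqP ab) bS) FN opprK.
Qed.

End EdgeSums.

(** * Adjoint powers and the linear relations *)

Lemma lie_lieD (K : comNzRingType) (L : lieAlgType K) (a b c : L) :
  lie a (lie b c) = lie (lie a b) c + lie b (lie a c).
Proof.
have := lie_jacobi a b c; rewrite [lie c a]lieC lieNr [lie c (lie a b)]lieC.
by move=> /eqP; rewrite subr_eq0 subr_eq addrC => /eqP ->.
Qed.

Section FormEval.
Variables (R : realType) (E : vectType R).
Local Notation h := (complexification E).
Implicit Types (a : 'Hom(E, R^o)) (u v : h).

Lemma form_evalD a u v : form_eval a (u + v) = form_eval a u + form_eval a v.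
Proof. by rewrite -[u]scale1r form_eval_linear mul1r scale1r. Qed.

Lemma form_eval0 a : form_eval a 0 = 0.
Proof. by apply: (addIr (form_eval a 0)); rewrite -form_evalD !add0r. Qed.

Lemma form_evalZ a c u : form_eval a (c *: u) = c * form_eval a u.
Proof. by rewrite -[c *: u]addr0 form_eval_linear form_eval0 addr0. Qed.

Lemma form_evalB a u v : form_eval a (u - v) = form_eval a u - form_eval a v.
Proof. by rewrite form_evalD -scaleN1r form_evalZ mulN1r. Qed.

Lemma form_eval_formD a b u : form_eval (a + b) u = form_eval a u + form_eval b u.
Proof. by rewrite /form_eval !add_lfunE. Qed.

Lemma form_eval_formN a u : form_eval (- a) u = - form_eval a u.
Proof. by rewrite /form_eval !opp_lfunE. Qed.

Lemma form_eval_formMz a (n : int) u : form_eval (a *~ n) u = n%:~R * form_eval a u.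
Proof.
rewrite /form_eval -scaler_int !scale_lfunE -(rmorph_int (real_complex R)) /=.
by apply/eqP; rewrite eq_complex /= !mul0r subr0 addr0 !eqxx.
Qed.

Lemma form_eval_real a (v : E) : form_eval a (real_vec v) = (a v)%:C%C.
Proof. by rewrite /form_eval /= linear0. Qed.

End FormEval.

Section EllipticRelations.
Variables (R : realType) (E : vectType R) (ip : {dot E for idfun}).
Local Notation dualE := 'Hom(E, R^o).
Local Notation C := R[i].
Local Notation h := (complexification E).
Variable Phi : {fset dualE}.
Hypothesis hPhi : root_system ip Phi.
Local Notation opp := (oppR hPhi).
Variable Phip : {set Phi}.
Hypothesis hPhip : positive_system Phip.
Local Notation "a \@ u" := (form_eval (val a) u) (at level 38).

Variables (L : lieAlgType C) (t : Phi -> L) (x y : h -> L).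
Hypothesis tN : forall a, t (opp a) = t a.
Hypothesis tt : forall (Psi : {set Phi}) (a : Phi),
  root_subsystem Psi -> subsystem_rank Psi = 2%N -> a \in Psi ->
  lie (t a) (\sum_(b in Psi :&: Phip) t b) = 0.
Hypothesis xl : forall c u v, x (c *: u + v) = c *: x u + x v.
Hypothesis yl : forall c u v, y (c *: u + v) = c *: y u + y v.
Hypothesis xx : forall u v, lie (x u) (x v) = 0.
Hypothesis yx : forall u v,
  lie (y u) (x v) = \sum_(g in Phip) (g \@ v * g \@ u) *: t g.
Hypothesis tx : forall a u, a \@ u = 0 -> lie (t a) (x u) = 0.
Hypothesis ty : forall a u, a \@ u = 0 -> lie (t a) (y u) = 0.

(** [hx a] is the element [x (a^vee) / 2] whose adjoint powers enter the
    connection, and [adt N a] its [N]-th adjoint power applied to [t_a]. *)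
Definition cor (a : Phi) : h := real_vec (coroot ip (val a)).
Definition hx (a : Phi) : L := 2^-1 *: x (cor a).
Definition adt (N : nat) (a : Phi) : L := iter N (lie (hx a)) (t a).

Lemma x0 : x 0 = 0.
Proof. by apply: (addIr (x 0)); rewrite -{1}[x 0]scale1r -xl scale1r !add0r. Qed.

Lemma xZ c u : x (c *: u) = c *: x u.
Proof. by rewrite -[c *: u]addr0 xl x0 addr0. Qed.

Lemma xD u v : x (u + v) = x u + x v.
Proof. by rewrite -[u]scale1r xl !scale1r. Qed.

Lemma form_cor (a b : Phi) : a \@ (cor b) = (pairing ip (val a) (val b))%:C%C.
Proof. by rewrite /cor form_eval_real. Qed.

Lemma form_cor_self (a : Phi) : a \@ (cor a) = 2.
Proof. by rewrite form_cor (pairing_root hPhi) -(rmorph_nat (real_complex R) 2). Qed.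

Lemma hxE a : hx a = x (2^-1 *: cor a).
Proof. by rewrite xZ. Qed.

Lemma two_neq0 : 2 != 0 :> C. Proof. by rewrite pnatr_eq0. Qed.

Lemma x_comm u v z : lie (x u) (lie (x v) z) = lie (x v) (lie (x u) z).
Proof. by rewrite lie_lieD xx lie0l add0r. Qed.

Lemma x_iter_comm u v N z :
  lie (x u) (iter N (lie (x v)) z) = iter N (lie (x v)) (lie (x u) z).
Proof. by elim: N => //= N <-; exact: x_comm. Qed.

(** [u - a u * cor a / 2] is in the kernel of [a], and its [x] commutes with
    [t_a]. *)
Lemma lie_x_t a u : lie (x u) (t a) = a \@ u *: lie (hx a) (t a).
Proof.
rewrite hxE; set v := 2^-1 *: _; set c := a \@ u.
rewrite -lieZl -xZ -[u](subrK (c *: v)) xD lieDl lieC tx ?oppr0 ?add0r//.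
by rewrite form_evalB !form_evalZ form_cor_self mulVf ?two_neq0// mulr1 subrr.
Qed.

Lemma lie_x_adt a u N : lie (x u) (adt N a) = a \@ u *: adt N.+1 a.
Proof.
rewrite /adt hxE x_iter_comm lie_x_t hxE.
elim: N => // N IHN; by rewrite [LHS]/= [in LHS]IHN lieZr.
Qed.

Lemma iter_x_adt a u N k : iter k (lie (x u)) (adt N a) = (a \@ u) ^+ k *: adt (k + N) a.
Proof.
elim: k => [|k IHk]; first by rewrite expr0 scale1r.
by rewrite [LHS]/= IHk lieZr lie_x_adt scalerA exprSr.
Qed.

Lemma cor_opp a : cor (opp a) = - cor a.
Proof.
rewrite /cor val_oppR /real_vec.
have -> : coroot ip (- val a) = - coroot ip (val a).
  rewrite /coroot linearN /=.
  have gN u v : ip u (- v) = - ip u v by rewrite linearNr.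
  have gNl u v : ip (- u) v = - ip u v by rewrite linearNl.
  by rewrite gN gNl opprK scalerN.
by rewrite -[RHS]/(- coroot ip (val a), - 0) oppr0.
Qed.

Lemma adt_opp a N : adt N (opp a) = (-1) ^+ N *: adt N a.
Proof.
have hxo : hx (opp a) = - hx a by rewrite /hx cor_opp -scaleN1r xZ scalerA mulrN1 scaleNr.
rewrite /adt tN; elim: N => [|N IHN]; first by rewrite expr0 scale1r.
by rewrite [LHS]/= IHN hxo lieNl lieZr exprS mulN1r scaleNr.
Qed.

Let form_opp a u : (opp a) \@ u = - (a \@ u).
Proof. by rewrite val_oppR form_eval_formN. Qed.

(** For [u] with [a u = 0] and [b u <> 0], the operator [ad (x u)] commutes with
    [ad t_a], and acts on the whole [a]-string of [b] with the single weight
    [b u]; so its powers can be applied to [string_relation]. *)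
Lemma string_relation_adt (a b : Phi) N : indep (val a) (val b) ->
  \sum_(c | in_string a b c) lie (t a) (adt N c) = 0.
Proof.
move=> ab; pose u : h := 2 *: cor b - (a \@ (cor b)) *: cor a.
have au : a \@ u = 0.
  by rewrite /u form_evalB !form_evalZ form_cor_self mulrC subrr.
have bu : b \@ u != 0.
  rewrite /u form_evalB !form_evalZ form_cor_self !form_cor.
  rewrite -(rmorph_nat (real_complex R) 2) -!rmorphM -rmorphB /=.
  rewrite -[0]/(0%:C%C) (inj_eq (@complexI R)) subr_eq0 gt_eqF//.
  by rewrite mulrC (lt_le_trans (pairing_prod_lt4 hPhi ab))// -natrM.
have iter_t c : iter N (lie (x u)) (lie (t a) (t c)) = lie (t a) (iter N (lie (x u)) (t c)).
  elim: N => // N IHN; rewrite [LHS]/= IHN lie_lieD [lie (x u) (t a)]lieC tx//.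
  by rewrite oppr0 lie0l add0r.
have /(congr1 (iter N (lie (x u)))) := string_relation hPhip tN tt ab.
have -> : iter N (lie (x u)) 0 = 0 by elim: N {iter_t} => //= N ->; rewrite lie0r.
have -> : iter N (lie (x u)) (\sum_(c | in_string a b c) lie (t a) (t c)) =
    \sum_(c | in_string a b c) iter N (lie (x u)) (lie (t a) (t c)).
  by elim: N {iter_t} => //= N ->; rewrite lie_sumr.
rewrite (eq_bigr (fun c => (b \@ u) ^+ N *: lie (t a) (adt N c))) => [|c /asboolP[n cE]].
  by rewrite -scaler_sumr => /eqP; rewrite scaler_eq0 expf_eq0 (negPf bu) andbF /= => /eqP.
rewrite iter_t (iter_x_adt c u 0 N) lieZr addn0.
by rewrite cE form_eval_formD form_eval_formMz au mulr0 addr0.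
Qed.

Lemma in_stringC (a b c : Phi) : in_string a b c = in_string a c b.
Proof.
by apply/asboolP/asboolP => -[n e]; exists (- n); rewrite e mulrNz addrK.
Qed.

Lemma in_string_trans (a b c d : Phi) : in_string a b c -> in_string a b d = in_string a c d.
Proof.
move=> /asboolP[n cE]; apply/asboolP/asboolP => -[m dE].
  by exists (m - n); rewrite dE cE mulrzBr addrACA subrr addr0.
by exists (n + m); rewrite dE cE mulrzDr addrA.
Qed.

Lemma indep_string (a b c : Phi) : in_string a b c -> indep (val a) (val b) -> indep (val a) (val c).
Proof.
move=> /asboolP[n cE] ab; apply/andP; split; apply/eqP => e.
  have : val b = (1 - n%:~R) *: val a.
    by rewrite scalerBl scale1r scaler_int -{1}e cE addrK.
  by apply/eqP; apply: (indep_scale hPhi).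
have : val b = (-1 - n%:~R) *: val a.
  by rewrite scalerBl scaleN1r scaler_int -{1}e cE addrK.
by apply/eqP; apply: (indep_scale hPhi).
Qed.

(** Every sum over a union of strings vanishes; multiples of [a] do not
    contribute when [a u = 0]. *)
Lemma strings_sum_adt (a : Phi) u N (P : pred Phi) : a \@ u = 0 ->
  (forall b c, P b -> indep (val a) (val b) -> in_string a b c -> P c) ->
  \sum_(c | P c) c \@ u *: lie (t a) (adt N c) = 0.
Proof.
move=> au Pstr; rewrite (bigID (fun c => indep (val a) (val c))) /=.
rewrite [X in _ + X]big1 ?addr0; last first.
  move=> c /andP[_]; rewrite /indep negb_and !negbK => /orP[] /eqP ->.
    by rewrite au scale0r.
  by rewrite form_eval_formN au oppr0 scale0r.
pose F (c : Phi) := c \@ u *: lie (t a) (adt N c).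
pose m (b : Phi) : C := #|[pred c | in_string a b c]|%:R.
have m0 b : m b != 0.
  rewrite pnatr_eq0 -lt0n; apply/card_gt0P; exists b.
  exact: in_string_refl.
have mE (b c : Phi) : in_string a b c -> m b = m c.
  by move=> bc; congr (_%:R); apply: eq_card => d; rewrite !inE (in_string_trans _ bc).
have Fm c : F c = \sum_(b | in_string a c b) (m c)^-1 *: F c.
  by rewrite sumr_const -scaler_nat scalerA mulfV ?m0// scale1r.
pose P' (c : Phi) := P c && indep (val a) (val c).
(* each term is spread evenly over its string *)
rewrite -[LHS]/(\sum_(c | P' c) F c) (eq_bigr _ (fun c _ => Fm c)).
rewrite (exchange_big_dep P') /= => [|c b /andP[Pc ac] cb]; last first.
  by rewrite /P' (Pstr c b)// (indep_string cb).
apply: big1 => b /andP[Pb ab].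
rewrite (eq_bigl (fun c => in_string a b c)) => [|c]; last first.
  rewrite in_stringC andbC; case: (boolP (in_string a b c)) => //= bc.
  by rewrite /P' (Pstr b c)// (indep_string bc).
rewrite (eq_bigr (fun c => (m b)^-1 *: (b \@ u *: lie (t a) (adt N c)))).
  by rewrite -!scaler_sumr string_relation_adt// !scaler0.
move=> c bc; rewrite -(mE b c bc) /F; have /asboolP[n cE] := bc.
by rewrite cE form_eval_formD form_eval_formMz au mulr0 addr0.
Qed.

(** For odd [N] the summand is even in [c], so that the sum over the positive roots
    is half of the sum over all roots. *)
Lemma odd_sum_adt a u N : a \@ u = 0 -> odd N ->
  \sum_(c in Phip) c \@ u *: lie (t a) (adt N c) = 0.
Proof.
move=> au oN; have := @strings_sum_adt a u N predT au (fun _ _ _ _ _ => erefl).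
rewrite (sum_pos_half (hPhi:=hPhi) hPhip) //= => [|c]; last first.
  by rewrite adt_opp form_opp lieZr scalerA mulNr -signr_odd oN mulrN1 opprK.
rewrite -scaler_nat => /eqP; rewrite scaler_eq0 (negPf two_neq0) /= => /eqP.
by [].
Qed.

Section Weyl.
Variable w : 'End(dualE).
Hypothesis hw : weyl_group ip Phi w.

Lemma weyl_bij : exists w' : 'End(dualE),
  [/\ forall l, w (w' l) = l, forall l, w' (w l) = l,
      forall b : Phi, w (val b) \in Phi & forall b : Phi, w' (val b) \in Phi].
Proof.
have refl_inv (b : Phi) l : reflection ip (val b) (reflection ip (val b) l) = l.
  rewrite !reflectionE add_lfunE opp_lfunE scale_lfunE -!/(pairing ip _ _).
  rewrite (pairing_root hPhi) -addrA -opprD -scalerDl.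
  set k := (X in X *: _); have -> : k = 0; last by rewrite scale0r subr0.
  by rewrite /k /GRing.scale /=; ring.
have refl_in (b : Phi) l : l \in Phi -> reflection ip (val b) l \in Phi.
  by move=> lP; exact: (root_reflection hPhi) (root_in b) lP.
elim: hw => [|b w1 _ [w' [h1 h2 h3 h4]]].
  by exists \1%VF; split=> *; rewrite !id_lfunE// root_in.
exists (w' \o reflection ip (val b))%VF; split=> l; rewrite ?comp_lfunE ?h1 ?refl_inv ?h2//.
  exact/refl_in/h3.
by have := h4 (FSetSub (refl_in b _ (root_in l))).
Qed.

Let pos_w (b : Phi) : bool := [exists g in Phip, val b == w (val g)].

Let w_pre (b : Phi) : exists g : Phi, val b = w (val g).
Proof.
have [w' [h1 _ _ h4]] := weyl_bij.
by exists (FSetSub (h4 b)); rewrite /= h1.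
Qed.

Let w_inj : injective w.
Proof. by have [w' [_ h2 _ _]] := weyl_bij; exact: can_inj h2. Qed.

Let pos_wE (b g : Phi) : val b = w (val g) -> pos_w b = (g \in Phip).
Proof.
move=> bE; apply/existsP/idP => [[g' /andP[g'p /eqP]]|gp]; last by exists g; rewrite gp bE eqxx.
by rewrite bE => /w_inj/val_inj ->.
Qed.

Let pos_w_opp b : pos_w (opp b) = ~~ pos_w b.
Proof.
have [g bE] := w_pre b; rewrite (pos_wE bE) -(opp_pos hPhi hPhip).
by apply: pos_wE; rewrite !val_oppR bE linearN.
Qed.

Let inversionE b : inversion_root Phip w b = (b \in Phip) && ~~ pos_w b.
Proof.
rewrite /inversion_root -pos_w_opp; congr (_ && _); apply: eq_existsb => g.
by rewrite linearN val_oppR eqr_oppLR.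
Qed.

(** An odd function changes sign on the inversion roots, so subtracting them
    twice turns the sum over [Phip] into the sum over [w Phip]. *)
Lemma sum_inversion (F : Phi -> L) : (forall b, F (opp b) = - F b) ->
  \sum_(b in Phip) F b - (\sum_(b | inversion_root Phip w b) F b) *+ 2 = \sum_(b | pos_w b) F b.
Proof.
move=> FN; rewrite (eq_bigl _ _ inversionE) (bigID pos_w) /= mulr2n opprD addrA addrK.
rewrite [RHS](bigID (mem Phip)) /=; congr (_ + _).
  by apply: eq_bigl => b; rewrite andbC.
rewrite [RHS](reindex_inj (inv_inj (@oppRK _ _ _ _ hPhi))) /= -sumrN.
apply: eq_big => [b|b _]; last by rewrite FN.
by rewrite pos_w_opp (opp_pos hPhi hPhip) negbK andbC.
Qed.

(** This keeps the strings of a simple root [s] through the other positive roots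
    positive.  If [g + k] is a multiple of [s], one of [g] and [k] makes an
    acute angle with [s]; subtracting [s] from it leaves a root, positive since
    [s] is simple, and decreases the multiple. *)
Lemma simple_not_sum (s g k : Phi) (n : nat) : simple_root Phip (val s) ->
  s \in Phip -> g \in Phip -> k \in Phip -> g != s -> val g + val k <> val s *~ n.
Proof.
move=> [s' [_ /val_inj s'E simp]] sp; subst s'.
have [l hl] := hPhip.
elim: n g k => [|n IHn] g k gp kp gs E1.
  have : (val g + val k) l = 0 by rewrite E1 mulr0z zero_lfunE.
  move: gp kp; rewrite !(hl _).2 add_lfunE => g0 k0.
  by apply/eqP; rewrite gt_eqF// addr_gt0.
have sg : indep (val s) (val g) by apply: (pos_indep hPhi hPhip) => //; rewrite eq_sym.
have ks : k != s.
  apply/eqP => ks; have : val g = (n%:~R : R) *: val s.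
    by rewrite scaler_int; apply: (addIr (val s)); rewrite -{1}ks E1 intS addrC mulrzDr mulr1z.
  by apply/eqP; apply: (indep_scale hPhi).
have sk : indep (val s) (val k) by apply: (pos_indep hPhi hPhip) => //; rewrite eq_sym.
have sub (g' k' : Phi) : g' \in Phip -> k' \in Phip -> g' != s -> indep (val s) (val g') ->
    val g' + val k' = val s *~ n.+1 -> 0 < pairing ip (val g') (val s) -> False.
  move=> g'p k'p g's sg' E2 pos; pose d : Phi := FSetSub (root_sub hPhi sg' pos).
  have dE : val d = val g' - val s by [].
  have dp : d \in Phip.
    rewrite -[d \in _]negbK -(opp_pos hPhi hPhip); apply/negP => dp.
    by apply: (simp g' (opp d)) => //; rewrite val_oppR dE opprB addrC subrK.
  apply: (IHn d k') => //.
    apply/eqP => ds; have : val g' = (2 : R) *: val s.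
      by rewrite scaler_nat mulr2n -{2}ds dE addrC subrK.
    by apply/eqP; apply: (indep_scale hPhi).
  by rewrite dE addrAC E2 intS mulrzDr mulr1z addrC addKr.
have : pairing ip (val g) (val s) + pairing ip (val k) (val s) = n.+1%:R * 2.
  rewrite -pairingDl E1 -scaler_int /pairing scale_lfunE -/(pairing ip _ _).
  by rewrite (pairing_root hPhi).
case: (ltrP 0 (pairing ip (val g) (val s))) => [pos _|neg sumE].
  by apply: sub gp kp gs sg E1 pos.
apply: (sub k g) => //; first by rewrite addrC.
have : 0 < n.+1%:R * 2 :> R by rewrite mulr_gt0 ?ltr0n.
by rewrite -sumE; apply: contraTT; rewrite -!leNgt => h0; rewrite -[0]addr0 lerD.
Qed.

Lemma simple_string_pos (a b c : Phi) : simple_root Phip ((w^-1)%VF (val a)) ->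
  pos_w b -> indep (val a) (val b) -> in_string a b c -> pos_w c.
Proof.
move=> simp pb ab /asboolP[n cE]; have [w' [h1 h2 h3 h4]] := weyl_bij.
have winv l : (w^-1)%VF l = w' l.
  have /lker0_lfunK : lker w == 0%VS by apply/lker0P; exact: w_inj.
  by move=> wK; rewrite -[l in LHS]h1 wK.
have [s [sp sE]] : exists s : Phi, s \in Phip /\ val s = w' (val a).
  by have [s [sp sE _]] := simp; exists s; rewrite sE winv.
have aE : val a = w (val s) by rewrite sE h1.
rewrite winv -sE in simp.
have [g bE] := w_pre b; have [k ckE] := w_pre c.
have kE : val k = val g + val s *~ n.
  have w'b : w' (val b) = val g by rewrite bE h2.
  by rewrite -[LHS]h2 -ckE cE linearD /= w'b -scaler_int linearZ /= -sE scaler_int.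
rewrite (pos_wE ckE); move: pb; rewrite (pos_wE bE) => gp.
have [l hl] := hPhip.
apply/negPn/negP; rewrite -(opp_pos hPhi hPhip) => okp.
have gs : g != s.
  apply/eqP => gs; move: ab; rewrite bE gs -aE => /andP[]; by rewrite eqxx.
case: n {cE} kE => [n|n] kE.
  move: okp; rewrite (opp_pos hPhi hPhip) (hl k).2 kE add_lfunE -scaler_int scale_lfunE.
  move: gp sp; rewrite !(hl _).2 => g0 s0 /negP; apply.
  by rewrite ltr_wpDr// mulr_ge0// ?ltW// ler0z.
apply: (simple_not_sum (n := n.+1) simp sp gp okp gs).
by rewrite val_oppR kE opprD addrA subrr add0r NegzE mulrNz opprK.
Qed.

(** In the positive system [w Phip] the root [a] is simple, so that [w Phip]
    without [a] is a union of [a]-strings. *)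
Lemma weyl_sum_t a u : simple_root Phip ((w^-1)%VF (val a)) -> a \@ u = 0 ->
  \sum_(b in Phip) b \@ u *: lie (t a) (t b) =
  2 *: \sum_(b | inversion_root Phip w b) b \@ u *: lie (t a) (t b).
Proof.
move=> simp au; apply/eqP; rewrite -subr_eq0 scaler_nat sum_inversion.
  by apply/eqP/(@strings_sum_adt a u 0 pos_w au) => b c pb ab; exact: simple_string_pos.
by move=> b; rewrite form_opp tN scaleNr.
Qed.

End Weyl.
End EllipticRelations.

(** * Binary forms in two commuting operators *)

Section IteratedBracket.
Variables (K : comNzRingType) (L : lieAlgType K).
Implicit Types X Y z : L.

Lemma iter_lieD X n z z' : iter n (lie X) (z + z') = iter n (lie X) z + iter n (lie X) z'.
Proof. by elim: n => //= n ->; rewrite lieDr. Qed.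

Lemma iter_lie0 X n : iter n (lie X) 0 = 0.
Proof. by elim: n => //= n ->; rewrite lie0r. Qed.

Lemma iter_lieZ X n c z : iter n (lie X) (c *: z) = c *: iter n (lie X) z.
Proof. by elim: n => //= n ->; rewrite lieZr. Qed.

Lemma iter_lieN X n z : iter n (lie X) (- z) = - iter n (lie X) z.
Proof. by elim: n => //= n ->; rewrite lieNr. Qed.

Lemma iter_lie_sum X n (I : Type) (r : seq I) (P : pred I) (F : I -> L) :
  iter n (lie X) (\sum_(i <- r | P i) F i) = \sum_(i <- r | P i) iter n (lie X) (F i).
Proof. by apply: big_morph => [z z'|]; rewrite ?iter_lieD ?iter_lie0. Qed.

Lemma lie_iter_lie Y X N z : lie Y (iter N (lie X) z) =
  \sum_(i < N) iter i (lie X) (lie (lie Y X) (iter (N.-1 - i) (lie X) z)) +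
  iter N (lie X) (lie Y z).
Proof.
elim: N => [|N IHN]; first by rewrite big_ord0 add0r.
rewrite [LHS]/= lie_lieD IHN lieDr addrA lie_sumr big_ord_recl /= subn0.
congr (_ + _ + _); apply: eq_bigr => i _ /=.
by rewrite /bump /= add1n -subn1 -subnDA add1n.
Qed.

End IteratedBracket.

(** A polynomial [p] of degree at most [n] encodes the binary form of degree
    [n] whose value at [(s, 1)] is [p s]; [act n p] is that form in the commuting
    operators [ad U] and [ad V]. *)
Section BinaryForms.
Variables (K : comNzRingType) (L : lieAlgType K) (U V : L).
Hypothesis UV : lie U V = 0.
Implicit Types (p q : {poly K}) (z w : L).

Definition act n p z := \sum_(k < n.+1) p`_k *: iter k (lie U) (iter (n - k) (lie V) z).

Lemma actD n p z w : act n p (z + w) = act n p z + act n p w.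
Proof. by rewrite /act -big_split; apply: eq_bigr => k _; rewrite !iter_lieD scalerDr. Qed.

Lemma act_polyZ n a p z : act n (a *: p) z = a *: act n p z.
Proof. by rewrite /act scaler_sumr; apply: eq_bigr => k _; rewrite coefZ scalerA. Qed.

Lemma act_poly0 n z : act n 0 z = 0.
Proof. by rewrite /act big1// => k _; rewrite coef0 scale0r. Qed.

Lemma act_polyD n p q z : act n (p + q) z = act n p z + act n q z.
Proof. by rewrite /act -big_split; apply: eq_bigr => k _; rewrite coefD scalerDl. Qed.

Lemma act_polyN n p z : act n (- p) z = - act n p z.
Proof. by rewrite -scaleN1r act_polyZ scaleN1r. Qed.

Lemma act_poly_sum n (I : Type) (r : seq I) (P : pred I) (F : I -> {poly K}) z :
  act n (\sum_(i <- r | P i) F i) z = \sum_(i <- r | P i) act n (F i) z.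
Proof.
by apply: (big_morph (fun p => act n p z)) => [p q|]; rewrite ?act_polyD ?act_poly0.
Qed.

Definition linp (a b : K) : {poly K} := a *: 'X + b%:P.

Definition act_to n p z w := (size p <= n.+1)%N /\ act n p z = w.

Lemma act_to1 z : act_to 0 1 z z.
Proof. by split; [rewrite size_polyC leq_b1|rewrite /act big_ord1 coef1 scale1r]. Qed.

Lemma act_to_lin n p z w a b :
  act_to n p z w -> act_to n.+1 (linp a b * p) z (lie (a *: U + b *: V) w).
Proof.
case=> pn <-; split.
  apply: leq_trans (size_polyMleq _ _) _.
  have l2 : (size (linp a b) <= 2)%N.
    rewrite /linp (leq_trans (size_polyD _ _))// geq_max.
    rewrite (leq_trans (size_scale_leq _ _)) ?size_polyX//=.
    by rewrite (leq_trans (size_polyC_leq1 _)).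
  by rewrite -subn1 leq_subLR add1n (leq_trans (leq_add l2 pn)).
have VU k w' : lie V (iter k (lie U) w') = iter k (lie U) (lie V w').
  by elim: k => //= k <-; rewrite lie_lieD [lie V U]lieC UV oppr0 lie0l add0r.
rewrite lieDl !lieZl /act !lie_sumr !scaler_sumr.
have cE k : (linp a b * p)`_k = a * (if k == 0%N then 0 else p`_k.-1) + b * p`_k.
  by rewrite /linp mulrDl coefD -scalerAl coefZ coefXM coefCM.
under eq_bigr do rewrite cE scalerDl.
rewrite big_split /=; congr (_ + _).
  rewrite big_ord_recl /= mulr0 scale0r add0r; apply: eq_bigr => k _.
  by rewrite lieZr scalerA.
rewrite big_ord_recr /= (nth_default _ pn) mulr0 scale0r addr0.
apply: eq_bigr => k _; rewrite lieZr scalerA VU; congr (_ *: iter _ _ _).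
by rewrite subSn ?leq_ord.
Qed.

End BinaryForms.

Lemma poly_eval0 (K : numFieldType) (p : {poly K}) : (forall s, p.[s] = 0) -> p = 0.
Proof.
move=> p0; apply: (@roots_geq_poly_eq0 _ _ [seq i%:R | i <- iota 0 (size p)]).
- by apply/allP => z _; rewrite rootE p0.
- by rewrite map_inj_uniq ?iota_uniq// => i j /eqP; rewrite eqr_nat => /eqP.
- by rewrite size_map size_iota.
Qed.

Section KernelIdentity.
Variables (K : fieldType) (c : nat -> K).
Hypothesis c_addition : forall n (A B : K), A != 0 -> B != 0 -> A != B ->
  \sum_(i < n.+1) c i * c (n - i) *
    (A ^+ i * B ^+ (n - i) - (A - B) ^+ i * B ^+ (n - i) - A ^+ i * (B - A) ^+ (n - i))
  + c n.+1 * (B ^+ n.+1 / A + A ^+ n.+1 / B - B ^+ n.+1 / (A - B)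
    - (A - B) ^+ n.+1 / B - (B - A) ^+ n.+1 / A - A ^+ n.+1 / (B - A)) = 0.

Definition hsum (M : pzRingType) n (P Q : M) := \sum_(i < n.+1) P ^+ i * Q ^+ (n - i).

Lemma hsumE n (P Q : K) : P ^+ n.+1 - Q ^+ n.+1 = (P - Q) * hsum n P Q.
Proof.
rewrite subrXX; congr (_ * _); rewrite /hsum (reindex_inj rev_ord_inj) /=.
by apply: eq_bigr => i _; rewrite subSS subnBA -1?ltnS// addKn.
Qed.

(** The weight of the edge [a -- b] in the quadratic relation, divided by
    [omega a b]. *)
Definition edge_kernel (M : algType K) n (ca cb : K) (A B : M) : M :=
  \sum_(i < n.+1) (c i * c (n - i)) *: (A ^+ i * B ^+ (n - i)) -
  c n.+1 *: (cb *: hsum n (cb *: A + B) B + ca *: hsum n (A + ca *: B) A).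

(** By [hsumE] each [hsum] term is a difference of two quotients.  The quotients
    with a power of [ca * B + A], [cb * A + B] or [g * (A - B) + B], which are
    the actions of [x_a], [x_b] and [x_(a+b)], cancel in pairs; the others are
    those of the addition formula. *)
Lemma edge_kernel_triangle n (ca cb g : K) (A B : K^o) : A != 0 -> B != 0 -> A != B ->
  edge_kernel n ca cb A B =
  edge_kernel n (1 + ca) g (A - B) B + edge_kernel n (1 - g) (1 + cb) A (B - A).
Proof.
move=> A0 B0 AB; have D0 : A - B != 0 by rewrite subr_eq0.
have hq (k : K) (P Q : K) : P != 0 -> k * hsum n (k * P + Q) Q = ((k * P + Q) ^+ n.+1 - Q ^+ n.+1) / P.
  by move=> P0; rewrite hsumE addrK; move: (hsum _ _ _) => S; field.
have ek (ka kb P Q : K) : P != 0 -> Q != 0 -> edge_kernel n ka kb (P : K^o) Q =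
    \sum_(i < n.+1) c i * c (n - i) * (P ^+ i * Q ^+ (n - i)) -
    c n.+1 * (((kb * P + Q) ^+ n.+1 - Q ^+ n.+1) / P + ((ka * Q + P) ^+ n.+1 - P ^+ n.+1) / Q).
  by move=> P0 Q0; rewrite -!hq// /edge_kernel [P + _]addrC.
rewrite !ek//; last by rewrite -opprB oppr_eq0.
have -> : (1 + ca) * B + (A - B) = ca * B + A by ring.
have -> : (1 + cb) * A + (B - A) = cb * A + B by ring.
have -> : (1 - g) * (B - A) + A = g * (A - B) + B by ring.
apply/eqP; rewrite -subr_eq0; apply/eqP; rewrite -[RHS](c_addition n A0 B0 AB).
have -> : \sum_(i < n.+1) c i * c (n - i) *
    (A ^+ i * B ^+ (n - i) - (A - B) ^+ i * B ^+ (n - i) - A ^+ i * (B - A) ^+ (n - i)) =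
    \sum_(i < n.+1) c i * c (n - i) * (A ^+ i * B ^+ (n - i))
    - \sum_(i < n.+1) c i * c (n - i) * ((A - B) ^+ i * B ^+ (n - i))
    - \sum_(i < n.+1) c i * c (n - i) * (A ^+ i * (B - A) ^+ (n - i)).
  by rewrite -!sumrB; apply: eq_bigr => i _; rewrite !mulrBr.
rewrite -[B - A]opprB invrN.
move: (\sum_(i < n.+1) _) (\sum_(i < n.+1) _) (\sum_(i < n.+1) _) => S1 S2 S3.
move: (c n.+1) (A ^+ _) (B ^+ _) ((A - B) ^+ _) ((- (A - B)) ^+ _)
  ((cb * A + B) ^+ _) ((ca * B + A) ^+ _) ((g * (A - B) + B) ^+ _)
  (A^-1) (B^-1) ((A - B)^-1) => *; ring.
Qed.

Lemma edge_kernelC (M : comAlgType K) n ca cb (A B : M) :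
  edge_kernel n cb ca B A = edge_kernel n ca cb A B.
Proof.
rewrite /edge_kernel; congr (_ - _ *: _); last first.
  by rewrite [LHS]addrC [ca *: B + A]addrC [B + cb *: A]addrC.
rewrite (reindex_inj rev_ord_inj) /=; apply: eq_bigr => i _.
by rewrite subSS subnBA -1?ltnS// addKn [A ^+ _ * _]mulrC [c i * _]mulrC.
Qed.

End KernelIdentity.

(** * The quadratic relations *)

Section QuadraticRelation.
Variables (R : realType) (E : vectType R) (ip : {dot E for idfun}).
Local Notation dualE := 'Hom(E, R^o).
Local Notation C := R[i].
Local Notation h := (complexification E).
Variable Phi : {fset dualE}.
Hypothesis hPhi : root_system ip Phi.
Local Notation opp := (oppR hPhi).
Variable Phip : {set Phi}.
Hypothesis hPhip : positive_system Phip.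
Local Notation "a \@ u" := (form_eval (val a) u) (at level 38).

Variables (L : lieAlgType C) (t : Phi -> L) (x y : h -> L).
Hypothesis tN : forall a, t (opp a) = t a.
Hypothesis tt : forall (Psi : {set Phi}) (a : Phi),
  root_subsystem Psi -> subsystem_rank Psi = 2%N -> a \in Psi ->
  lie (t a) (\sum_(b in Psi :&: Phip) t b) = 0.
Hypothesis xl : forall c u v, x (c *: u + v) = c *: x u + x v.
Hypothesis yl : forall c u v, y (c *: u + v) = c *: y u + y v.
Hypothesis xx : forall u v, lie (x u) (x v) = 0.
Hypothesis yx : forall u v,
  lie (y u) (x v) = \sum_(g in Phip) (g \@ v * g \@ u) *: t g.
Hypothesis tx : forall a u, a \@ u = 0 -> lie (t a) (x u) = 0.
Hypothesis ty : forall a u, a \@ u = 0 -> lie (t a) (y u) = 0.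

Variable c : nat -> C.
Hypothesis c_addition : forall n (A B : C), A != 0 -> B != 0 -> A != B ->
  \sum_(i < n.+1) c i * c (n - i) *
    (A ^+ i * B ^+ (n - i) - (A - B) ^+ i * B ^+ (n - i) - A ^+ i * (B - A) ^+ (n - i))
  + c n.+1 * (B ^+ n.+1 / A + A ^+ n.+1 / B - B ^+ n.+1 / (A - B)
    - (A - B) ^+ n.+1 / B - (B - A) ^+ n.+1 / A - A ^+ n.+1 / (B - A)) = 0.

Local Notation hx := (hx ip x).
Local Notation adt := (adt ip t x).
Local Notation cor := (@cor _ _ ip Phi).
Implicit Types a b g : Phi.

Definition half_pairing a b : C := a \@ (cor b) / 2.

Lemma lie_x_bracket w j k a b : lie (x w) (lie (adt j a) (adt k b)) =
  a \@ w *: lie (adt j.+1 a) (adt k b) + b \@ w *: lie (adt j a) (adt k.+1 b).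
Proof. by rewrite lie_lieD !(lie_x_adt hPhi xl xx tx) lieZl lieZr. Qed.

(** On the space spanned by the brackets of [(ad x_a)^j t_a] and
    [(ad x_b)^k t_b], the action of [x w] depends only on [a w] and [b w]. *)
Lemma lie_x_iter_eq w w' i g j k a b : a \@ w = a \@ w' -> b \@ w = b \@ w' ->
  lie (x w) (iter i (lie (hx g)) (lie (adt j a) (adt k b))) =
  lie (x w') (iter i (lie (hx g)) (lie (adt j a) (adt k b))).
Proof.
move=> aw bw; rewrite (hxE ip xl) !(x_iter_comm xx); congr (iter _ _ _).
by rewrite !lie_x_bracket aw bw.
Qed.

Section Pair.
Variables (u v : h).

Definition omega a b := a \@ u * b \@ v - a \@ v * b \@ u.

(** The binary form in [x u] and [x v] acting on the brackets of powers of
    [ad x_a] and [ad x_b] as [ad x_a] on the first factor. *)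
Definition left_form a b : {poly C} := linp (b \@ v / omega a b) (- (b \@ u / omega a b)).

Local Notation act_to n p z w := (act_to (x u) (x v) n p z w).
Local Notation act := (act (x u) (x v)).

Lemma omegaC a b : omega b a = - omega a b.
Proof. by rewrite /omega; ring. Qed.

Lemma act_to_form p z w n (w0 : h) (l : {poly C}) al be :
  act_to n p z w -> l = linp al be -> lie (x w0) w = lie (x (al *: u + be *: v)) w ->
  act_to n.+1 (l * p) z (lie (x w0) w).
Proof. by move=> pzw -> ->; rewrite xl (xZ xl); exact: act_to_lin. Qed.

Section Forms.
Variables a b : Phi.
Hypothesis om0 : omega a b != 0.
Let A := left_form a b.
Let B := left_form b a.
Let ab0 : lie (t a) (t b) = lie (adt 0 a) (adt 0 b). Proof. by []. Qed.

Let uA : h := (b \@ v / omega a b) *: u + (- (b \@ u / omega a b)) *: v.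
Let uB : h := (a \@ v / omega b a) *: u + (- (a \@ u / omega b a)) *: v.

Let om0' : a \@ u * b \@ v - a \@ v * b \@ u != 0. Proof. exact: om0. Qed.

Let uAa : a \@ uA = 1.
Proof.
rewrite form_evalD !form_evalZ /omega; move: om0'.
move: (a \@ u) (a \@ v) (b \@ u) (b \@ v) => p q r s e; field; exact: e.
Qed.
Let uAb : b \@ uA = 0.
Proof. by rewrite form_evalD !form_evalZ; move: (_^-1) (a \@ u) (b \@ u) (b \@ v) => *; ring. Qed.
Let uBa : a \@ uB = 0.
Proof. by rewrite form_evalD !form_evalZ; move: (_^-1) (a \@ u) (a \@ v) => *; ring. Qed.
Let uBb : b \@ uB = 1.
Proof.
rewrite form_evalD !form_evalZ omegaC /omega; move: om0'.
move: (a \@ u) (a \@ v) (b \@ u) (b \@ v) => p q r s e; rewrite invrN; field.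
exact: e.
Qed.

Lemma act_to_A p z n j k : act_to n p z (lie (adt j a) (adt k b)) ->
  act_to n.+1 (A * p) z (lie (adt j.+1 a) (adt k b)).
Proof.
have -> : lie (adt j.+1 a) (adt k b) = lie (x uA) (lie (adt j a) (adt k b)).
  by rewrite lie_x_bracket uAa uAb scale1r scale0r addr0.
by move=> /act_to_form; apply.
Qed.

Lemma act_to_B p z n j k : act_to n p z (lie (adt j a) (adt k b)) ->
  act_to n.+1 (B * p) z (lie (adt j a) (adt k.+1 b)).
Proof.
have -> : lie (adt j a) (adt k.+1 b) = lie (x uB) (lie (adt j a) (adt k b)).
  by rewrite lie_x_bracket uBa uBb scale1r scale0r add0r.
by move=> /act_to_form; apply.
Qed.

Lemma act_to_powers i j :
  act_to (i + j) (A ^+ i * B ^+ j) (lie (t a) (t b)) (lie (adt i a) (adt j b)).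
Proof.
elim: i => [|i IHi]; last by rewrite exprS -mulrA; exact: act_to_A.
rewrite mul1r; elim: j => [|j IHj]; first exact: act_to1.
by rewrite exprS; exact: act_to_B.
Qed.

Lemma linp_comb (p q r s k k' : C) :
  k *: linp p q + k' *: linp r s = linp (k * p + k' * r) (k * q + k' * s).
Proof.
by rewrite /linp !scalerDr !scalerA addrACA -scalerDl -!mul_polyC -!polyCM -polyCD.
Qed.

Lemma act_to_hx g p z n i j k :
  act_to n p z (iter i (lie (hx g)) (lie (adt j a) (adt k b))) ->
  act_to n.+1 ((half_pairing a g *: A + half_pairing b g *: B) * p) z
    (iter i.+1 (lie (hx g)) (lie (adt j a) (adt k b))).
Proof.
move=> pz; rewrite [iter i.+1 _ _]/= {1}(hxE ip xl).
apply: (act_to_form pz (linp_comb _ _ _ _ _ _)); apply: lie_x_iter_eq.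
  rewrite form_evalZ mulrC -/(half_pairing a g).
  transitivity (half_pairing a g * a \@ uA + half_pairing b g * a \@ uB).
    by rewrite uAa uBa mulr1 mulr0 addr0.
  by rewrite !form_evalD !form_evalZ; ring.
rewrite form_evalZ mulrC -/(half_pairing b g).
transitivity (half_pairing a g * b \@ uA + half_pairing b g * b \@ uB).
  by rewrite uAb uBb mulr1 mulr0 add0r.
by rewrite !form_evalD !form_evalZ; ring.
Qed.

Lemma act_to_hx_powers g p z n i j k : act_to n p z (lie (adt j a) (adt k b)) ->
  act_to (i + n) ((half_pairing a g *: A + half_pairing b g *: B) ^+ i * p) z
    (iter i (lie (hx g)) (lie (adt j a) (adt k b))).
Proof.
move=> pz; elim: i => [|i IHi]; first by rewrite mul1r.
by rewrite exprS -mulrA; exact: act_to_hx.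
Qed.

End Forms.

Lemma half_pairing_self a : half_pairing a a = 1.
Proof. by rewrite /half_pairing form_cor_self// mulfV// two_neq0. Qed.

Definition edge_form n a b : {poly C} :=
  omega a b *: edge_kernel c n (half_pairing b a) (half_pairing a b)
    (left_form a b) (left_form b a).

Definition powers_bracket n a b : L :=
  \sum_(i < n.+1) (c i * c (n - i)) *: lie (adt i a) (adt (n - i) b).

(** These brackets arise when [y] is moved past a power of [ad x_b]. *)
Definition mixed_bracket n a b : L :=
  \sum_(i < n.+1) iter i (lie (hx b)) (lie (t a) (adt (n - i) b)).

Lemma act_edge_form n a b : act n (edge_form n a b) (lie (t a) (t b)) =
  omega a b *: (powers_bracket n a b - c n.+1 *:
    (half_pairing a b *: mixed_bracket n a b - half_pairing b a *: mixed_bracket n b a)).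
Proof.
rewrite /edge_form act_polyZ; have [->|om0] := eqVneq (omega a b) 0; first by rewrite !scale0r.
congr (_ *: _); rewrite /edge_kernel act_polyD act_polyN act_polyZ act_polyD !act_polyZ.
rewrite /hsum !act_poly_sum.
congr (_ - _ *: (_ *: _ + _)).
- apply: eq_bigr => i _; rewrite act_polyZ; congr (_ *: _).
  by have [_] := act_to_powers om0 i (n - i); rewrite subnKC ?leq_ord.
- apply: eq_bigr => i _; have := act_to_hx_powers om0 b i (act_to_powers om0 0 (n - i)).
  rewrite half_pairing_self scale1r add0n mul1r => -[_].
  by rewrite subnKC ?leq_ord.
rewrite -scalerN; congr (_ *: _); rewrite /mixed_bracket -sumrN; apply: eq_bigr => i _.
have := act_to_hx_powers om0 a i (act_to_powers om0 (n - i) 0).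
rewrite half_pairing_self scale1r addn0 mulr1 => -[_].
by rewrite subnKC ?leq_ord// => ->; rewrite [lie (t b) _]lieC iter_lieN opprK.
Qed.

Lemma edge_formC n a b : edge_form n b a = - edge_form n a b.
Proof. by rewrite /edge_form omegaC scaleNr edge_kernelC. Qed.

Lemma horner_edge_kernel n ca cb (A B : {poly C}) (s : C) :
  (edge_kernel c n ca cb A B).[s] = edge_kernel c n ca cb (A.[s] : C^o) B.[s].
Proof.
rewrite /edge_kernel /hsum !(hornerE, horner_sum); congr (_ - _ * (_ * _ + _ * _)).
- by apply: eq_bigr => i _; rewrite hornerZ hornerM !horner_exp.
- by apply: eq_bigr => i _; rewrite hornerM !horner_exp hornerD hornerZ.
- by apply: eq_bigr => i _; rewrite hornerM !horner_exp hornerD hornerZ.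
Qed.

Lemma left_form_neq0 a b : omega a b != 0 -> left_form a b != 0.
Proof.
move=> om0; apply/eqP => l0; case/eqP: (om0).
have lc k : (left_form a b)`_k = 0 by rewrite l0 coef0.
have := lc 0%N; rewrite coefD coefZ coefX coefC mulr0 add0r /= => /eqP.
rewrite oppr_eq0 mulf_eq0 invr_eq0 (negPf om0) orbF => /eqP bu.
have := lc 1%N; rewrite coefD coefZ coefX coefC mulr1 addr0 /= => /eqP.
rewrite mulf_eq0 invr_eq0 (negPf om0) orbF => /eqP bv.
by rewrite /omega bu bv !mulr0 subrr.
Qed.

(** An identity of polynomials may be checked away from the zeros of [A], [B]
    and [A - B]. *)
Lemma edge_kernel_triangle_poly n (ca cb g : C) (A B : {poly C}) :
  A != 0 -> B != 0 -> A != B ->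
  edge_kernel c n ca cb A B =
  edge_kernel c n (1 + ca) g (A - B) B + edge_kernel c n (1 - g) (1 + cb) A (B - A).
Proof.
move=> A0 B0 AB; apply/eqP; rewrite -subr_eq0; set D := _ - _; apply/eqP.
have AB0 : A * B * (A - B) != 0 by rewrite !mulf_neq0// subr_eq0.
suff /eqP : A * B * (A - B) * D = 0 by rewrite mulf_eq0 (negPf AB0) => /eqP.
apply: poly_eval0 => s; rewrite hornerM; apply/eqP; rewrite mulf_eq0.
case: eqP => //= /eqP; rewrite !hornerM hornerD hornerN !mulf_eq0 !negb_or subr_eq0.
move=> /andP[/andP[As Bs] ABs].
have DE (X Y Z : {poly C}) : (X - (Y + Z)).[s] = X.[s] - (Y.[s] + Z.[s]).
  by rewrite hornerD hornerN hornerD.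
rewrite /D DE !horner_edge_kernel !(hornerD, hornerN) subr_eq0; apply/eqP.
exact: edge_kernel_triangle.
Qed.

Lemma edge_form_triangle n a b g : val g = val a + val b ->
  edge_form n a b = edge_form n a g + edge_form n g b.
Proof.
move=> gE; have ge w : g \@ w = a \@ w + b \@ w by rewrite gE form_eval_formD.
have oag : omega a g = omega a b by rewrite /omega !ge; ring.
have ogb : omega g b = omega a b by rewrite /omega !ge; ring.
rewrite /edge_form oag ogb; have [->|om0] := eqVneq (omega a b) 0.
  have s0 (p q r : {poly C}) : 0 *: p = 0 *: q + 0 *: r by rewrite !scale0r addr0.
  exact: s0.
rewrite -scalerDr; congr (_ *: _).
have lpE p q r s : linp p q - linp r s = linp (p - r) (q - s) :> {poly C}.
  by rewrite /linp scalerBl polyCB opprD addrACA.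
have Aag : left_form a g = left_form a b - left_form b a.
  rewrite /left_form lpE oag (omegaC a b) !ge invrN; congr linp; ring.
have Bag : left_form g a = left_form b a.
  by rewrite /left_form -[omega g a]opprK -omegaC oag -omegaC.
have Agb : left_form g b = left_form a b by rewrite /left_form ogb.
have Bgb : left_form b g = left_form b a - left_form a b.
  rewrite /left_form lpE (omegaC g b) ogb (omegaC a b) !ge invrN; congr linp; ring.
rewrite Aag Bag Agb Bgb.
have h1 w : half_pairing g w = half_pairing a w + half_pairing b w.
  by rewrite /half_pairing ge mulrDl.
have -> : half_pairing g a = 1 + half_pairing b a by rewrite h1 half_pairing_self.
have -> : half_pairing g b = 1 + half_pairing a b by rewrite h1 half_pairing_self addrC.
have -> : half_pairing b g = 1 - half_pairing a g.
  by apply/eqP; rewrite eq_sym subr_eq addrC -h1 half_pairing_self.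
apply: edge_kernel_triangle_poly.
- exact: left_form_neq0.
- by apply: left_form_neq0; rewrite omegaC oppr_eq0.
- by rewrite -subr_eq0 -Aag; apply: left_form_neq0; rewrite oag.
Qed.

Lemma in_string_opp a b g : in_string a b (opp g) = in_string a (opp b) g.
Proof.
apply/asboolP/asboolP => -[m gE]; exists (- m); rewrite mulrNz val_oppR.
  by rewrite -opprD -gE val_oppR opprK.
by rewrite gE val_oppR opprD opprK.
Qed.

(** Kirchhoff's law for the brackets of [t_a] and [t_b]: a class is made of one or
    two strings. *)
Lemma class_relation a b : a \in Phip -> b \in Phip -> a != b ->
  \sum_(c0 in Phip | in_class hPhi a b c0) lie (t a) (t c0) = 0.
Proof.
move=> ap bp ab; have iab := pos_indep hPhi hPhip ap bp ab.
have iaNb : indep (val a) (val (opp b)).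
  case/andP: iab => b1 b2; apply/andP; split; rewrite val_oppR.
    by rewrite eqr_oppLR.
  by rewrite eqr_opp; exact: b1.
have total : \sum_(c0 | in_class hPhi a b c0) lie (t a) (t c0) = 0.
  have [s1 s2] := (string_relation hPhip tN tt iab, string_relation hPhip tN tt iaNb).
  case: (boolP [exists c0, in_string a b c0 && in_string a (opp b) c0]).
    move=> /existsP[c0 /andP[bc Nbc]]; rewrite -[RHS]s1; apply: eq_bigl => d.
    by rewrite /in_class (in_string_trans d bc) (in_string_trans d Nbc) orbb.
  move=> /existsPn dis; rewrite (bigID (in_string a b)) /=.
  rewrite [X in X + _ = _](eq_bigl (in_string a b)) => [|d]; last first.
    by rewrite /in_class andbC; case: (in_string a b d).
  rewrite s1 add0r -[RHS]s2; apply: eq_bigl => d; rewrite /in_class.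
  by have := dis d; case: (in_string a b d) => //=; case: (in_string a (opp b) d).
move: total; rewrite (sum_pos_half (hPhi:=hPhi) hPhip) => [|d|d]; last by rewrite tN.
  rewrite -scaler_nat => /eqP; rewrite scaler_eq0 (negPf (two_neq0 R)) /= => /eqP total.
  by rewrite -[RHS]total; apply: eq_bigl => d; rewrite andbC.
by rewrite /in_class orbC !in_string_opp oppRK.
Qed.

Lemma sum_edge_form n :
  \sum_(a in Phip) \sum_(b in Phip) act n (edge_form n a b) (lie (t a) (t b)) = 0.
Proof.
apply: (@edge_sum_zero _ _ _ _ hPhi _ hPhip _ (fun a b z => act n (edge_form n a b) z)
  (fun a b => lie (t a) (t b))).
- by move=> a b z z'; rewrite actD.
- by move=> a b z; rewrite edge_formC act_polyN.
- by move=> a z; rewrite /edge_form /omega mulrC subrr scale0r act_poly0.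
- by move=> a b g z _ _ _ gE; rewrite (edge_form_triangle n gE) act_polyD.
- by move=> a b; rewrite lieC.
- exact: class_relation.
Qed.

Lemma powers_bracketC n a b : powers_bracket n b a = - powers_bracket n a b.
Proof.
rewrite /powers_bracket -sumrN (reindex_inj rev_ord_inj) /=; apply: eq_bigr => i _.
by rewrite subSS subnBA -1?ltnS// addKn lieC scalerN [c i * _]mulrC.
Qed.

(** Symmetrisation in [a] and [b] turns the difference of both sides into half of
    [sum_edge_form]. *)
Lemma sum_brackets n :
  \sum_(a in Phip) \sum_(b in Phip) (a \@ u * b \@ v) *: powers_bracket n a b =
  c n.+1 *: \sum_(b in Phip) \sum_(a in Phip) (omega a b * half_pairing a b) *: mixed_bracket n a b.
Proof.
have two_inj (z w : L) : z + z = w + w -> z = w.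
  move=> /eqP; rewrite -(mulr2n z) -(mulr2n w) -(scaler_nat 2 z) -(scaler_nat 2 w) -subr_eq0 -scalerBr scaler_eq0.
  by rewrite (negPf (two_neq0 R)) /= subr_eq0 => /eqP.
apply: two_inj; apply/eqP; rewrite -subr_eq0; apply/eqP; rewrite -[RHS](sum_edge_form n).
have -> : \sum_(a in Phip) \sum_(b in Phip) act n (edge_form n a b) (lie (t a) (t b)) =
   (\sum_(a in Phip) \sum_(b in Phip) (a \@ u * b \@ v) *: powers_bracket n a b +
    \sum_(a in Phip) \sum_(b in Phip) (- (a \@ v * b \@ u)) *: powers_bracket n a b) +
   (- (c n.+1 *: \sum_(a in Phip) \sum_(b in Phip) (omega a b * half_pairing a b) *: mixed_bracket n a b) +
    c n.+1 *: \sum_(a in Phip) \sum_(b in Phip) (omega a b * half_pairing b a) *: mixed_bracket n b a).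
  rewrite -!scalerN -!scalerDr -[X in _ + _ *: (X + _)]sumrN -!big_split scaler_sumr -big_split.
  apply: eq_bigr => a _; rewrite /= -sumrN -!big_split scaler_sumr -big_split.
  apply: eq_bigr => b _; rewrite /= act_edge_form scalerBr -scalerDl; congr (_ + _).
  rewrite !(scalerBr, scalerN, scalerA) opprB addrC.
  by rewrite [RHS]scalerBr !scalerA; congr (_ *: _ - _ *: _); ring.
rewrite opprD; congr (_ + _ + (_ + _)).
- rewrite exchange_big /=; apply: eq_bigr => b _; apply: eq_bigr => a _.
  by rewrite powers_bracketC scalerN scaleNr mulrC.
- by rewrite exchange_big.
rewrite -scalerN -sumrN; congr (_ *: _).
apply: eq_bigr => b _; rewrite -sumrN; apply: eq_bigr => a _.
by rewrite (omegaC a b) mulNr scaleNr.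
Qed.

End Pair.

Lemma yZ k u : y (k *: u) = k *: y u.
Proof.
have y0 : y 0 = 0 by apply: (addIr (y 0)); rewrite -{1}[y 0]scale1r -yl scale1r !add0r.
by rewrite -[k *: u]addr0 yl y0 addr0.
Qed.

(** Only the bracket of [y w] with the factors [x_a] contributes, as [y w] commutes
    with [t_a]. *)
Lemma lie_y_adt w n a : a \@ w = 0 -> lie (y w) (adt n.+1 a) =
  \sum_(g in Phip) (g \@ w * half_pairing g a) *: mixed_bracket n g a.
Proof.
move=> aw; rewrite /adt lie_iter_lie -/(adt 0 a) [lie (y w) (t a)]lieC ty// oppr0 iter_lie0 addr0.
have yxa : lie (y w) (hx a) = \sum_(g in Phip) (g \@ w * half_pairing g a) *: t g.
  rewrite /hx lieZr yx scaler_sumr; apply: eq_bigr => g _; rewrite scalerA.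
  by congr (_ *: _); rewrite /half_pairing; move: (g \@ _) (g \@ _) (2^-1) => *; ring.
rewrite yxa /mixed_bracket.
under [RHS]eq_bigr do rewrite scaler_sumr.
rewrite exchange_big /=; apply: eq_bigr => i _.
rewrite lie_suml iter_lie_sum; apply: eq_bigr => g _.
by rewrite lieZl iter_lieZ.
Qed.

(** The component of degree [n + 2] of the image of [X u]. *)
Definition Xc n (u : h) : L := c n *: \sum_(a in Phip) a \@ u *: adt n a.

Lemma XcE n u : \sum_(a in Phip) a \@ u *: (c n *: adt n a) = Xc n u.
Proof. by rewrite /Xc scaler_sumr; apply: eq_bigr => a _; rewrite !scalerA mulrC. Qed.

Lemma Xc_linear n k u v : Xc n (k *: u + v) = k *: Xc n u + Xc n v.
Proof.
rewrite -!XcE scaler_sumr -big_split; apply: eq_bigr => a _.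
by rewrite form_eval_linear scalerDl -scalerA.
Qed.

Lemma Xc_coef0 n u : c n = 0 -> Xc n u = 0.
Proof. by rewrite /Xc => ->; rewrite scale0r. Qed.

Lemma lie_t_Xc n a u : a \@ u = 0 -> odd n -> lie (t a) (Xc n u) = 0.
Proof.
move=> au on; rewrite /Xc lieZr lie_sumr; under eq_bigr do rewrite lieZr.
by rewrite (odd_sum_adt hPhip tN tt xl xx tx)// scaler0.
Qed.

Lemma lie_t_Xc0 (w : 'End(dualE)) a u k : k = c 0 * 2 -> weyl_group ip Phi w ->
  simple_root Phip ((w^-1)%VF (val a)) -> a \@ u = 0 ->
  lie (t a) (Xc 0 u -
    k *: \sum_(b | inversion_root Phip w b) b \@ u *: t b) = 0.
Proof.
move=> -> hw simp au; rewrite /Xc lieDr lieNr !lieZr !lie_sumr.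
under eq_bigr do rewrite lieZr.
under [X in _ - _ *: X]eq_bigr do rewrite lieZr.
by rewrite (weyl_sum_t hPhip tN tt xl xx tx hw simp au) scalerA subrr.
Qed.

Lemma lie_y_Xc n u v :
  lie (Xc n u) (- y v) + lie (- y u) (Xc n v) =
  - (c n *: \sum_(a in Phip) lie (y (a \@ v *: u - a \@ u *: v)) (adt n a)).
Proof.
rewrite lieNr -lieC lieNl /Xc !lieZr !lie_sumr -scalerBr -[RHS]scalerN; congr (_ *: _).
rewrite -sumrB -sumrN; apply: eq_bigr => a _.
have -> : y (a \@ v *: u - a \@ u *: v) = a \@ v *: y u - a \@ u *: y v.
  by rewrite yl -!scaleNr yZ.
by rewrite lieDl lieNl !lieZl !lieZr opprB.
Qed.

Lemma degree3_zero u v : lie (Xc 0 u) (- y v) + lie (- y u) (Xc 0 v) = 0.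
Proof.
rewrite lie_y_Xc big1 ?scaler0 ?oppr0// => a _; rewrite lieC ty ?oppr0//.
by rewrite form_evalB !form_evalZ mulrC subrr.
Qed.

(** The component of degree [n + 4] of the bracket of the images of [X u] and
    [X v]. *)
Theorem quadratic_zero n u v : \sum_(i < n.+1) lie (Xc i u) (Xc (n - i) v) +
  (lie (Xc n.+1 u) (- y v) + lie (- y u) (Xc n.+1 v)) = 0.
Proof.
rewrite lie_y_Xc; apply/eqP; rewrite subr_eq0; apply/eqP.
transitivity (\sum_(a in Phip) \sum_(b in Phip) (a \@ u * b \@ v) *: powers_bracket n a b).
  under [RHS]eq_bigr => a _ do under eq_bigr => b _ do rewrite scaler_sumr.
  under [RHS]eq_bigr do rewrite exchange_big.
  rewrite [RHS]exchange_big; apply: eq_bigr => i _ /=.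
  rewrite /Xc lieZl lieZr scalerA lie_suml scaler_sumr; apply: eq_bigr => a _.
  rewrite lie_sumr scaler_sumr; apply: eq_bigr => b _.
  by rewrite lieZl lieZr !scalerA; congr (_ *: _); ring.
rewrite sum_brackets; congr (_ *: _); apply: eq_bigr => b _.
rewrite lie_y_adt; last by rewrite form_evalB !form_evalZ mulrC subrr.
apply: eq_bigr => a _; congr (_ * _ *: _).
by rewrite form_evalB !form_evalZ /omega; ring.
Qed.

End QuadraticRelation.

(** * The Lie algebra map to the completion *)

Local Open Scope classical_set_scope.

Section CompletionComponents.
Variables (K : numFieldType) (G : Type) (S : set (free_lie K G)) (wt : G -> nat).
Local Notation M := (completion S wt).
Local Notation L := (lie_pres S).

Lemma component_sum (I : Type) (r : seq I) (P : pred I) (F : I -> M) d :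
  component (\sum_(i <- r | P i) F i) d = \sum_(i <- r | P i) component (F i) d.
Proof. by apply: (big_morph (fun f : M => component f d)). Qed.

Lemma componentN (f : M) d : component (- f) d = - component f d.
Proof. by rewrite -scaleN1r componentZ scaleN1r. Qed.

Definition concentrated_in (f : M) m (X : L) :=
  forall d, component f d = if d == m then X else 0.

Lemma gen_concentrated g : concentrated_in (completion_gen S wt g) (wt g) (pres_gen S g).
Proof. by []. Qed.

Lemma lie_concentrated (f g : M) m X d : concentrated_in f m X ->
  component (lie f g) d = if (m <= d)%N then lie X (component g (d - m)%N) else 0.
Proof.
move=> hf; rewrite [LHS]completion_lieE; case: leqP => md.
  have md1 : (m < d.+1)%N by rewrite ltnS.
  rewrite (bigD1 (Ordinal md1)) //= hf eqxx big1 ?addr0// => i im.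
  by rewrite hf ifN ?lie0l.
rewrite big1// => i _; rewrite hf ifN ?lie0l// neq_ltn.
by rewrite (leq_ltn_trans (leq_ord i) md).
Qed.

Lemma lie_concentrated2 (f g : M) m k X Y : concentrated_in f m X ->
  concentrated_in g k Y -> concentrated_in (lie f g) (m + k)%N (lie X Y).
Proof.
move=> hf hg d; rewrite (lie_concentrated _ _ hf); case: leqP => md.
  rewrite hg -(eqn_add2l m) subnKC//; case: eqP => // _; exact: lie0r.
by rewrite ifN// neq_ltn (leq_trans md)// leq_addr.
Qed.

Lemma ad_series_component (c : nat -> K) (f g : M) (X Y : L) d :
  concentrated_in f 1 X -> concentrated_in g 2 Y ->
  component (ad_series c f g) d =
  if (2 <= d)%N then c (d - 2)%N *: iter (d - 2)%N (lie X) Y else 0.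
Proof.
move=> hf hg; have itc k : concentrated_in (iter k (lie f) g) (k + 2)%N (iter k (lie X) Y).
  elim: k => [|k IHk]; first exact: hg.
  exact: lie_concentrated2 hf IHk.
rewrite -[LHS]/(\sum_(k < d.+1) c k *: component (iter k (lie f) g) d).
case: (leqP 2 d) => d2; last first.
  rewrite big1// => k _; rewrite itc ifN ?scaler0// neq_ltn.
  by rewrite (leq_trans d2)// leq_addl.
have kd : (d - 2 < d.+1)%N by rewrite ltnS leq_subr.
rewrite (bigD1 (Ordinal kd)) //= itc subnK// eqxx big1 ?addr0// => k kne.
rewrite itc ifN ?scaler0//; apply: contraNneq kne => e.
by apply/eqP/val_inj; rewrite /= -[LHS](addnK 2) -e.
Qed.

(** [f] has no component of degree 0; the numbering of [X] starts at degree 2. *)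
Definition components (f : M) (f1 : L) (X : nat -> L) :=
  [/\ component f 0 = 0, component f 1 = f1 & forall n, component f n.+2 = X n].

Lemma components_sub_sum (y : M) (Y : L) (I : finType) (P : pred I) (r : I -> K)
    (H : I -> M) (T : I -> nat -> L) :
  concentrated_in y 1 Y ->
  (forall a d, component (H a) d = if (2 <= d)%N then T a (d - 2)%N else 0) ->
  components (- y + \sum_(a | P a) r a *: H a) (- Y) (fun n => \sum_(a | P a) r a *: T a n).
Proof.
move=> hy hH; have [y0 y1] := (hy 0%N : _ = 0, hy 1%N : _ = Y).
split=> [||n]; rewrite componentD componentN component_sum.
- by rewrite y0 oppr0 add0r big1// => a _; rewrite componentZ hH scaler0.
- by rewrite y1 big1 ?addr0// => a _; rewrite componentZ hH scaler0.
rewrite (hy n.+2 : _ = 0) oppr0 add0r; apply: eq_bigr => a _.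
by rewrite componentZ hH /= !subSS subn0.
Qed.

(** The bracket of two such elements starts in degree 2; the hypotheses are its
    vanishing in degrees 2, 3 and [n + 4]. *)
Lemma components_lie0 (f g : M) (f1 g1 : L) (X Y : nat -> L) :
  components f f1 X -> components g g1 Y ->
  lie f1 g1 = 0 -> lie (X 0%N) g1 + lie f1 (Y 0%N) = 0 ->
  (forall n, \sum_(i < n.+1) lie (X i) (Y (n - i)%N) +
    (lie (X n.+1) g1 + lie f1 (Y n.+1)) = 0) ->
  lie f g = 0.
Proof.
case=> f0 f1E XE [g0 g1E YE] deg2 deg3 deg4.
apply: completion_eq => d; rewrite component0 [LHS]completion_lieE.
case: d => [|[|[|[|n]]]].
- by rewrite big_ord1 f0 lie0l.
- by rewrite !big_ord_recl big_ord0 /= f0 g0 lie0l lie0r !addr0.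
- by rewrite !big_ord_recl big_ord0 /= f0 g0 f1E g1E lie0l lie0r !addr0 add0r.
- rewrite !big_ord_recl big_ord0 /= f0 g0 lie0l lie0r !addr0 add0r addrC.
  by rewrite f1E g1E XE YE.
rewrite big_ord_recl big_ord_recr big_ord_recl big_ord_recr /= f0 lie0l add0r.
rewrite !subnn g0 /= lie0r addr0 -[RHS](deg4 n) addrC addrA [in LHS]addrC addrA.
rewrite -addrA addrC; congr (_ + _ + _).
- by apply: eq_bigr => i _; rewrite -XE -YE -subSn ?leq_ord// -subSn// ltnW// ltnS leq_ord.
- by rewrite /bump /= !add1n !subSS subSnn g1E XE.
by rewrite -f1E -YE.
Qed.

Lemma concentrated_sum (I : finType) (P : pred I) (r : I -> K) (F : I -> M) m (X : I -> L) :
  (forall a, concentrated_in (F a) m (X a)) ->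
  concentrated_in (\sum_(a | P a) r a *: F a) m (\sum_(a | P a) r a *: X a).
Proof.
move=> hF d; rewrite component_sum; under eq_bigr do rewrite componentZ hF.
by case: eqP => // _; rewrite big1// => a _; rewrite scaler0.
Qed.

Lemma concentratedZ k (f : M) m X : concentrated_in f m X -> concentrated_in (k *: f) m (k *: X).
Proof. by move=> hf d; rewrite componentZ hf; case: eqP; rewrite ?scaler0. Qed.

Lemma concentrated_lie0 (f g k : M) (X g1 Y : L) (G1 : nat -> L) :
  concentrated_in f 2 X -> components g g1 G1 -> concentrated_in k 2 Y ->
  lie X g1 = 0 -> lie X (G1 0%N - Y) = 0 -> (forall n, lie X (G1 n.+1) = 0) ->
  lie f (g - k) = 0.
Proof.
move=> hf [g0 g1E gE] hk X1 X2 X3; apply: completion_eq => d.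
rewrite component0 (lie_concentrated _ _ hf); case: (2 <= d)%N => //.
rewrite componentD componentN hk; move: (d - 2)%N => [|[|[|n]]] /=.
- by rewrite g0 subr0 lie0r.
- by rewrite g1E subr0.
- by rewrite gE.
by rewrite gE subr0.
Qed.

End CompletionComponents.

Section Elliptic.
Variables (R : realType) (E : vectType R) (ip : {dot E for idfun}).
Local Notation dualE := 'Hom(E, R^o).
Local Notation C := R[i].
Local Notation h := (complexification E).
Variable Phi : {fset dualE}.
Hypothesis hPhi : root_system ip Phi.
Local Notation opp := (oppR hPhi).
Variable Phip : {set Phi}.
Hypothesis hPhip : positive_system Phip.
Local Notation "a \@ u" := (form_eval (val a) u) (at level 38).

Local Notation L := (lie_pres (@ell_relator R E Phi Phip)).
Local Notation rel := (@ell_relator R E Phi Phip).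
Definition el_t (a : Phi) : L := pres_gen rel (EllT a).
Definition el_x (u : h) : L := pres_gen rel (EllX Phi u).
Definition el_y (u : h) : L := pres_gen rel (EllY Phi u).

Let projP := quot_proj_lie_morphism rel.
Let proj := @quot_proj _ _ rel.

Let proj0 z w : rel (z - w) -> proj z = proj w.
Proof.
move=> /quot_proj_rel; rewrite (lie_morphismD projP) (lie_morphismN projP).
by move=> /eqP; rewrite subr_eq0 => /eqP.
Qed.

Lemma el_tN' (a b : Phi) : val b = - val a -> el_t b = el_t a.
Proof. by move=> ab; apply/proj0/ell_tN. Qed.

Lemma el_tN a : el_t (opp a) = el_t a.
Proof. exact: el_tN'. Qed.

Lemma el_xl c u v : el_x (c *: u + v) = c *: el_x u + el_x v.
Proof. by rewrite -projP.1; apply/proj0/ell_x_linear. Qed.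

Lemma el_yl c u v : el_y (c *: u + v) = c *: el_y u + el_y v.
Proof. by rewrite -projP.1; apply/proj0/ell_y_linear. Qed.

Lemma el_tt (Psi : {set Phi}) (a : Phi) :
  root_subsystem Psi -> subsystem_rank Psi = 2%N -> a \in Psi ->
  lie (el_t a) (\sum_(b in Psi :&: Phip) el_t b) = 0.
Proof.
move=> h1 h2 h3; rewrite -(lie_morphism_sum projP) -projP.2.
exact: quot_proj_rel (ell_tt _ h1 h2 h3).
Qed.

Lemma el_xx u v : lie (el_x u) (el_x v) = 0.
Proof. by rewrite -projP.2; exact: quot_proj_rel (ell_xx _ u v). Qed.

Lemma el_yy u v : lie (el_y u) (el_y v) = 0.
Proof. by rewrite -projP.2; exact: quot_proj_rel (ell_yy _ u v). Qed.

Lemma el_yx u v :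
  lie (el_y u) (el_x v) = \sum_(g in Phip) (g \@ v * g \@ u) *: el_t g.
Proof.
rewrite -projP.2; under eq_bigr do rewrite -(lie_morphismZ projP).
by rewrite -(lie_morphism_sum projP); apply/proj0/ell_yx.
Qed.

Lemma el_tx a u : a \@ u = 0 -> lie (el_t a) (el_x u) = 0.
Proof. by move=> au; rewrite -projP.2; exact: quot_proj_rel (ell_tx _ au). Qed.

Lemma el_ty a u : a \@ u = 0 -> lie (el_t a) (el_y u) = 0.
Proof. by move=> au; rewrite -projP.2; exact: quot_proj_rel (ell_ty _ au). Qed.

Local Notation adt := (adt ip el_t el_x).
Local Notation Xc := (Xc ip Phip el_t el_x (@kcoef R)).
Local Notation M := (t_ell_hat Phip).
Local Notation wt := (@ell_weight R E Phi).

Lemma half_ad_x_component (c : nat -> C) a d :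
  component (half_ad_x ip Phip c a) d = if (2 <= d)%N then c (d - 2)%N *: adt (d - 2)%N a else 0.
Proof.
apply: ad_series_component; last exact: gen_concentrated.
by move=> e; rewrite componentZ (gen_concentrated rel wt _ e); case: eqP; rewrite ?scaler0.
Qed.

Lemma X_image_components u : components (X_image ip Phip u) (- el_y u) (fun n => Xc n u).
Proof.
pose T (a : Phi) n : L := kcoef R n *: adt n a.
have hT (a : Phi) d : component (half_ad_x ip Phip (@kcoef R) a) d =
    if (2 <= d)%N then T a (d - 2)%N else 0.
  exact: half_ad_x_component.
have [h0 h1 h2] := components_sub_sum (mem Phip) (fun a => a \@ u)
  (gen_concentrated rel wt (EllY Phi u)) hT.
split=> [||n]; [exact: h0|exact: h1|].
by rewrite -XcE; exact: h2.
Qed.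

Lemma X_image_linear c u v : X_image ip Phip (c *: u + v) = c *: X_image ip Phip u + X_image ip Phip v.
Proof.
have [f0 f1 f2] := X_image_components (c *: u + v).
have [g0 g1 g2] := X_image_components u.
have [k0 k1 k2] := X_image_components v.
apply: completion_eq => d; rewrite [RHS]componentD [X in _ = X + _]componentZ.
case: d => [|[|n]].
- by rewrite f0 g0 k0 scaler0 addr0.
- by rewrite f1 g1 k1 el_yl opprD scalerN.
by rewrite f2 g2 k2 Xc_linear.
Qed.

Lemma X_image_commute u v : lie (X_image ip Phip u) (X_image ip Phip v) = 0.
Proof.
apply: (components_lie0 (X_image_components u) (X_image_components v)).
- by rewrite lieNl lieNr opprK el_yy.
- exact: (degree3_zero ip Phip el_x el_yl el_ty (@kcoef R) u v).
move=> n; exact: (quadratic_zero hPhip el_tN el_tt el_xl el_yl el_xx el_yx el_tx el_ty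
  (@kcoef_addition R) n u v).
Qed.

Lemma hat_tN (a b : Phi) : val b = - val a -> hat_t Phip b = hat_t Phip a.
Proof.
move=> ab; apply: completion_eq => d.
rewrite (gen_concentrated rel wt (EllT b) d) (gen_concentrated rel wt (EllT a) d).
by rewrite -/(el_t a) -/(el_t b) (el_tN' ab).
Qed.

Lemma hat_tt (Psi : {set Phi}) (a : Phi) :
  root_subsystem Psi -> subsystem_rank Psi = 2%N -> a \in Psi ->
  lie (hat_t Phip a) (\sum_(b in Psi :&: Phip) hat_t Phip b) = 0.
Proof.
move=> h1 h2 h3; apply: completion_eq => d.
rewrite component0 (lie_concentrated _ _ (gen_concentrated rel wt (EllT a))).
case: (2 <= d)%N => //; rewrite component_sum.
rewrite (eq_bigr (fun b => if (d - 2 == 2)%N then el_t b else 0)); last first.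
  by move=> b _; exact: (gen_concentrated rel wt (EllT b)).
case: (d - 2 == 2)%N; first exact: el_tt.
by rewrite big1// lie0r.
Qed.

Lemma hat_tX (a : Phi) (w : 'End(dualE)) u : weyl_group ip Phi w ->
  simple_root Phip ((w^-1)%VF (val a)) -> a \@ u = 0 ->
  lie (hat_t Phip a) (X_image ip Phip u - two_pi_i R *:
    \sum_(b | inversion_root Phip w b) b \@ u *: hat_t Phip b) = 0.
Proof.
move=> hw simp au.
have ht b : concentrated_in (hat_t Phip b) 2 (el_t b) by exact: gen_concentrated.
have T0 : two_pi_i R = kcoef R 0 * 2 by rewrite kcoef0 mulfVK// two_neq0.
have hk := concentratedZ (two_pi_i R)
  (concentrated_sum (inversion_root Phip w) (fun b => b \@ u) ht).
apply: (concentrated_lie0 (ht a) (X_image_components u) hk).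
- by rewrite lieNr el_ty// oppr0.
- exact: (lie_t_Xc0 hPhip el_tN el_tt el_xl el_xx el_tx T0 hw simp au).
move=> n; have [on|en] := boolP (odd n.+1).
  exact: (lie_t_Xc hPhip el_tN el_tt el_xl el_xx el_tx (@kcoef R) au on).
by rewrite Xc_coef0 ?lie0r// kcoef_even.
Qed.

Definition trig_gen_image (g : trig_generator Phi) : M :=
  match g with TrigT a => hat_t Phip a | TrigX u => X_image ip Phip u end.

Lemma trig_relator_image r : trig_relator ip Phip r -> free_lie_map trig_gen_image r = 0.
Proof.
have [lin br] := free_lie_map_morphism trig_gen_image.
have fP := free_lie_map_morphism trig_gen_image.
have fT a : free_lie_map trig_gen_image (free_gen C (TrigT a)) = hat_t Phip a.
  exact: free_lie_map_gen.
have fX u : free_lie_map trig_gen_image (free_gen C (TrigX Phi u)) = X_image ip Phip u.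
  exact: free_lie_map_gen.
case=> {r} [a b ab|c u v|Psi a h1 h2 h3|u v|a w u ap hw simp au].
- by rewrite (lie_morphismD fP) (lie_morphismN fP) !fT (hat_tN ab) subrr.
- by rewrite (lie_morphismD fP) (lie_morphismN fP) lin !fX X_image_linear subrr.
- rewrite br (lie_morphism_sum fP) fT; under eq_bigr do rewrite fT.
  exact: hat_tt.
- by rewrite br !fX X_image_commute.
rewrite br (lie_morphismD fP) (lie_morphismN fP) (lie_morphismZ fP) (lie_morphism_sum fP) fT fX.
under eq_bigr do rewrite (lie_morphismZ fP) fT.
exact: hat_tX.
Qed.

Definition trig_to_ell : t_trig ip Phip -> M := @pres_map _ _ _ trig_gen_image (trig_relator ip Phip).

End Elliptic.

(** * Degeneration of the connection *)

Lemma im_pinfty_filter (R : realType) : Filter (@im_pinfty R).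
Proof.
apply: filter_from_filter; first by exists 0.
move=> a b _ _; exists (Num.max a b) => // tau /=.
by rewrite gt_max => /andP[].
Qed.

(** The constant vector [w] is one more member of the fixed family, with
    coefficient 1. *)
Lemma cvg_in_sum (R : realType) (V : lmodType R[i]) (F : set_system R[i])
    (I : finType) (P : {set I}) (f : R[i] -> V) (l w : V) (b : I -> V)
    (c : R[i] -> I -> R[i]) (c0 : I -> R[i]) : Filter F ->
  (forall s, f s = w + \sum_(a in P) c s a *: b a) ->
  l = w + \sum_(a in P) c0 a *: b a ->
  (forall a, (c s a @[s --> F]) --> (c0 a : R[i]^o)) -> cvg_in F f l.
Proof.
move=> FF fE lE cc.
pose ext (X : Type) (x0 : X) (g : I -> X) (i : 'I_#|P|.+1) : X :=
  if unlift ord0 i is Some j then g (enum_val j) else x0.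
have sumE (k : I -> R[i]) : w + \sum_(a in P) k a *: b a = \sum_i ext _ 1 k i *: ext _ w b i.
  rewrite big_ord_recl /ext unlift_none scale1r big_enum_val; congr (_ + _).
  by apply: eq_bigr => i _; rewrite liftK.
exists #|P|.+1, (ext _ w b), (fun s => ext _ 1 (c s)), (ext _ 1 c0); split.
- by apply: nearW => s; rewrite fE sumE.
- by rewrite lE sumE.
move=> i; rewrite /ext; case: (unlift ord0 i) => [j|]; first exact: cc.
exact: (@cvg_cst (R[i]^o : topologicalType) 1 _ F).
Qed.

Lemma scale_two_components (K : comNzRingType) (V : lmodType K) (r p q : K) (T : nat -> V) d :
  (- r) *: ((if (2 <= d)%N then p *: T (d - 2)%N else 0) + q *: (if (d == 2)%N then T 0%N else 0)) =
  (- (r * (p + if (d - 2 == 0)%N then q else 0))) *: (if (2 <= d)%N then T (d - 2)%N else 0).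
Proof.
rewrite -mulNr -scalerA; congr (_ *: _).
case: d => [|[|[|d]]]; rewrite ?subSS ?subn0.
- by rewrite !scaler0 addr0.
- by rewrite !scaler0 addr0.
- by rewrite scalerDl.
by rewrite scaler0 !addr0.
Qed.

Section Degeneration.
Variables (R : realType) (E : vectType R) (ip : {dot E for idfun}).
Local Notation dualE := 'Hom(E, R^o).
Local Notation C := R[i].
Local Notation N := (@Normc.normc R).
Local Notation h := (complexification E).
Variable Phi : {fset dualE}.
Variable Phip : {set Phi}.
Variable theta : C -> C -> C.
Hypothesis htheta : theta_function theta.
Variables (n : nat) (e : n.-tuple h) (eps : n.-tuple 'Hom(h, C^o)).
Hypothesis hdual : dual_bases e eps.
Local Notation "a \@ u" := (form_eval (val a) u) (at level 38).
Local Notation M := (t_ell_hat Phip).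
Local Notation L := (lie_pres (@ell_relator R E Phi Phip)).
Local Notation rel := (@ell_relator R E Phi Phip).
Local Notation wt := (@ell_weight R E Phi).
Local Notation adt := (adt ip (@el_t R E Phi Phip) (@el_x R E Phi Phip)).

Lemma dual_expansion v : v = \sum_(i < n) tnth eps i v *: tnth e i.
Proof.
have [eb _ he] := hdual.
have vE := coord_basis eb (memvf v).
have epsE i : tnth eps i v = coord e i v.
  rewrite {1}vE linear_sum (bigD1 i) //= linearZ /= -(tnth_nth 0) he eqxx.
  rewrite /GRing.scale /= mulr1 big1 ?addr0// => j ji.
  rewrite linearZ /= -(tnth_nth 0) he eq_sym (negPf ji).
  exact: mulr0.
rewrite {1}vE; apply: eq_bigr => i _.
by rewrite epsE -(tnth_nth 0).
Qed.

Lemma kernel_coef_cvg_im (zeta r : C) k : e2pii zeta <> 1 ->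
  (- (r * power_series_at0 (fun x => kzb_kernel theta zeta x tau) k) @[tau --> @im_pinfty R]) -->
  (- (r * (kcoef R k + if k == 0%N then kernel_shift zeta else 0)) : C^o).
Proof.
move=> z1; have FF := @im_pinfty_filter R.
apply/(cvg_normcP FF) => d d0.
have r1 : 0 < N r + 1 by rewrite ltr_wpDl// normc_ge0.
have [m hm] := kernel_coef_cvg htheta z1 k (divr_gt0 d0 r1).
exists m => // tau /= /hm; rewrite -/(kcoef R k) => hd.
rewrite -opprD -mulrBr -[- (r * _)]mulNr Normc.normcM.
have -> : N (- r) = N r by rewrite -[- r]sub0r normcB subr0.
apply: (le_trans (ler_wpM2l (normc_ge0 r) hd)).
by rewrite mulrCA ger_pMr// ler_pdivrMr// mul1r lerDl.
Qed.

Lemma form_eval_dual (a : Phi) v : a \@ v = \sum_(i < n) tnth eps i v * (a \@ tnth e i).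
Proof.
rewrite {1}(dual_expansion v) (big_morph (form_eval (val a)) (form_evalD _) (form_eval0 _)).
by apply: eq_bigr => i _; rewrite form_evalZ.
Qed.

Let Ysum v : L := \sum_(i < n) tnth eps i v *: @el_y R E Phi Phip (tnth e i).

Let ycomp v d : component (\sum_(i < n) tnth eps i v *: hat_y Phip (tnth e i) : M) d =
  if d == 1%N then Ysum v else 0.
Proof.
exact: (concentrated_sum predT (fun i => tnth eps i v)
  (fun i => gen_concentrated rel wt (EllY Phi (tnth e i)))).
Qed.

Lemma kzb_component tau z v d : component (kzb_form ip Phip theta tau e eps z v) d =
  (if d == 1%N then Ysum v else 0) +
  \sum_(a in Phip) (- (a \@ v * power_series_at0
     (fun x => kzb_kernel theta (a \@ z) x tau) (d - 2)%N)) *: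
     (if (2 <= d)%N then adt (d - 2)%N a else 0).
Proof.
rewrite componentD ycomp addrC; congr (_ + _).
rewrite componentN component_sum -sumrN; apply: eq_bigr => a _.
rewrite componentZ half_ad_x_component scaleNr.
by case: (2 <= d)%N; rewrite ?scaler0// scalerA.
Qed.

(** The constant term of [kernel_coef_cvg] provides the rational terms in
    [t_a] of the limit form. *)
Lemma deg_component z v d : component (deg_form ip Phip e eps (torus_proj Phi z) v) d =
  (if d == 1%N then Ysum v else 0) +
  \sum_(a in Phip) (- (a \@ v * (kcoef R (d - 2)%N +
     if (d - 2 == 0)%N then kernel_shift (a \@ z) else 0))) *:
     (if (2 <= d)%N then adt (d - 2)%N a else 0).
Proof.
have degE : deg_form ip Phip e eps (torus_proj Phi z) v =
    \sum_(i < n) tnth eps i v *: hat_y Phip (tnth e i) +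
    \sum_(a in Phip) (- (a \@ v)) *: (half_ad_x ip Phip (@kcoef R) a +
      kernel_shift (a \@ z) *: hat_t Phip a).
  rewrite /deg_form.
  under [X in _ + X]eq_bigr do rewrite scalerBr.
  rewrite sumrB addrCA; congr (_ + _).
  under [X in _ - X]eq_bigr do rewrite scaler_sumr.
  rewrite exchange_big -opprD -big_split -sumrN; apply: eq_bigr => a _ /=.
  under eq_bigr do rewrite scalerA.
  rewrite -scaler_suml -form_eval_dual scaleNr -scalerDr addrC.
  by rewrite torus_char_proj ?root_in.
rewrite degE componentD ycomp component_sum; congr (_ + _).
apply: eq_bigr => a _; rewrite componentZ componentD componentZ half_ad_x_component.
rewrite (gen_concentrated rel wt (EllT a) d : _ = if (d == 2)%N then adt 0 a else 0).
exact: (scale_two_components _ _ _ (fun k => adt k a)).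
Qed.

Theorem kzb_degenerates z v d : (forall a : Phi, e2pii (a \@ z) <> 1) ->
  cvg_in (@im_pinfty R)
    (fun tau => hat_component (kzb_form ip Phip theta tau e eps z v) d)
    (hat_component (deg_form ip Phip e eps (torus_proj Phi z) v) d).
Proof.
move=> z1; apply: (cvg_in_sum (@im_pinfty_filter R) (fun tau => kzb_component tau z v d)
  (deg_component z v d)) => a.
exact: kernel_coef_cvg_im.
Qed.

End Degeneration.

Theorem theorem5 (R : realType) (E : vectType R) (ip : {dot E for idfun})
  (Phi : {fset 'Hom(E, R^o)}) (hPhi : root_system ip Phi)
  (Phip : {set Phi}) (hPhip : positive_system Phip)
  (theta : R[i] -> R[i] -> R[i]) (htheta : theta_function theta)
  (n : nat) (e : n.-tuple (complexification E))
  (eps : n.-tuple 'Hom(complexification E, R[i]^o)) (hdual : dual_bases e eps) :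
  (forall (z v : complexification E) (d : nat),
     (forall a : Phi, e2pii (form_eval (val a) z) <> 1) ->
     cvg_in (@im_pinfty R)
       (fun tau => hat_component (kzb_form ip Phip theta tau e eps z v) d)
       (hat_component (deg_form ip Phip e eps (torus_proj Phi z) v) d)) /\
  (exists phi : t_trig ip Phip -> t_ell_hat Phip,
     [/\ lie_morphism phi,
         forall a : Phi, phi (trig_t ip Phip a) = hat_t Phip a,
         forall u : complexification E,
           phi (trig_X ip Phip u) = X_image ip Phip u &
         forall (q : torus Phi) (v : complexification E), torus_reg q ->
           phi (trig_form ip Phip e eps q v) = deg_form ip Phip e eps q v]).
Proof.
split; first by move=> z v d; exact: kzb_degenerates.
have phiP : lie_morphism (@trig_to_ell R E ip Phi Phip).
  exact: (pres_map_morphism (trig_relator_image hPhi hPhip)).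
have phi_t a : trig_to_ell (trig_t ip Phip a) = hat_t Phip a.
  exact: (pres_map_gen (trig_relator_image hPhi hPhip)).
have phi_X u : trig_to_ell (trig_X ip Phip u) = X_image ip Phip u.
  exact: (pres_map_gen (trig_relator_image hPhi hPhip)).
exists (@trig_to_ell R E ip Phi Phip); split=> // q v _.
rewrite /trig_form (lie_morphismD phiP) !(lie_morphismN phiP) !(lie_morphism_sum phiP).
rewrite /deg_form -[in RHS]sumrN -sumrN -sumrN; congr (_ + _).
  by apply: eq_bigr => a _; rewrite !(lie_morphismZ phiP) phi_t.
apply: eq_bigr => i _; rewrite (lie_morphismZ phiP) phi_X -scalerN; congr (_ *: _).
by rewrite /X_image opprD opprK.
Qed.
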